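(* Let $a_F \in \mathbb{Z}$ be an integer for each proper flat $F$. The inverse system of the power ideal $$(v^{a_F+1} : v \in L_F \setminus \{0\},\ F \text{ proper flat}) \subseteq \operatorname{Sym} L$$ is the subspace $H^0(W_L, \mathcal{O}(\sum_F a_F D_F))$ of $\operatorname{Sym} L^*$, where the sum is over all proper flats $F$.
   Context: Let $L$ be a complex vector space of dimension $r$, and let $\ell_1,\dots,\ell_n \in L^*$ be linear forms (possibly zero, possibly proportional) with zero loci $H_1,\dots,H_n$ satisfying $H_1\cap\dots\cap H_n=0$. Set $E=\{1,\dots,n\}$. A flat is a subset $F\subseteq E$ such that if $\bigcap_{i\in F}H_i\subseteq H_j$ then $j\in F$; put $L_F=\bigcap_{i\in F}H_i$. A flat is proper if $F\ne E$ (equivalently $L_F\neq 0$). The augmented wonderful variety $W_L$ is the smooth projective variety obtained from the projective completion $\mathbb{P}(L\oplus\mathbb{C})$ of $L$ by blowing up the strict transforms of the strata $\mathbb{P}(L_F)$ of the hyperplane at infinity $\mathbb{P}L$, for $F$ a proper flat, in increasing order of dimension. It contains $L$ as an open subset, and $W_L\setminus L$ is a simple normal crossings divisor with irreducible components $D_F$, $F$ a proper flat, where $D_F$ is the strict transform of the exceptional divisor over $\mathbb{P}(L_F)$ (the strict transform of $\mathbb{P}L$ if $L_F=L$). For a divisor $D$ supported on $W_L\setminus L$, the space $H^0(W_L,\mathcal{O}(D))$ is the space of rational functions $f$ on $W_L$ with $\operatorname{div}(f)+D\ge 0$ (together with $0$); restricting to $L$ it is viewed as a subspace of $\operatorname{Sym}L^*$,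 the polynomials on $L$. $\operatorname{Sym} L$ acts on $\operatorname{Sym}L^*$ by differential operators: $v\in L$ acts by the directional derivative $D_v$, and $v_1\cdots v_k$ acts by $D_{v_1}\circ\cdots\circ D_{v_k}$; write $f\odot g$. The inverse system of a homogeneous ideal $I\subseteq \operatorname{Sym}L$ is the unique graded subspace $S\subseteq\operatorname{Sym}L^*$ such that $I=\{f\in\operatorname{Sym}L : (f\odot g)(0)=0 \text{ for all } g\in S\}$; equivalently $S=\{g : f\odot g=0 \text{ for all } f\in I\}$. If $a_F<0$ for some proper flat $F$, the power ideal is by definition the unit ideal. *)

(* Defs.v *)
From HB Require Import structures.
From mathcomp Require Import all_boot all_order all_algebra.
From mathcomp Require Import boolp classical_sets reals.
From mathcomp Require Import complex.
From mathcomp Require Import mpoly.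

Set Implicit Arguments.
Unset Strict Implicit.
Unset Printing Implicit Defensive.

Import Order.TTheory GRing.Theory Num.Theory.

Local Open Scope classical_set_scope.
Local Open Scope ring_scope.

(* The library has no schemes.  An integral separated scheme with function    *)
(* field K is encoded, following Zariski, as its "model": the set of the      *)
(* local rings of all its scheme-theoretic points, viewed as subrings of K.   *)
(* A point, equivalently the integral closed subscheme that is its closure,   *)
(* is identified with its local ring; a point specializes to another one iff  *)
(* the local ring of the former contains that of the latter.  A birational    *)
(* modification that is an isomorphism near the generic point of a closed     *)
(* subscheme does not change that local ring: a subscheme and its strict      *)
(* transform are represented by the same subset of K.                         *)

Section Ideals.
Variable A : comNzRingType.

Definition is_subring (B : set A) : Prop :=
  [/\ B 1, forall x y, B x -> B y -> B (x - y)
         & forall x y, B x -> B y -> B (x * y)].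

Definition subring_span (G : set A) : set A :=
  [set x | forall B, is_subring B -> G `<=` B -> B x].

Definition is_ideal_in (B q : set A) : Prop :=
  [/\ q `<=` B, q 0, forall x y, q x -> q y -> q (x + y)
    & forall x y, B x -> q y -> q (x * y)].

Definition is_prime_in (B q : set A) : Prop :=
  [/\ is_ideal_in B q, ~ q 1
    & forall x y, B x -> B y -> q (x * y) -> q x \/ q y].

Definition ideal_span (G : set A) : set A :=
  [set x | forall I, is_ideal_in setT I -> G `<=` I -> I x].

End Ideals.

Section Models.
Variable K : fieldType.

Definition localization (B q : set K) : set K :=
  [set x | exists b s, [/\ B b, B s, ~ q s & x = b / s]].

Definition unit_in (S : set K) (x : K) : Prop := [/\ x != 0, S x & S x^-1].

Definition maxid (S : set K) : set K := [set x | S x /\ ~ unit_in S x].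

Definition dominates (S Z : set K) : Prop := Z `<=` S /\ maxid Z `<=` maxid S.

(* Stalk at the point [P] of the ideal sheaf of the closure of the point [Z]; *)
(* it is the unit ideal when [P] is not on that closure.                      *)
Definition ideal_at (Z P : set K) : set K :=
  [set x | P x /\ (P `<=` Z -> maxid Z x)].

(* Over the local ring [P] with stalk [I] of the ideal of the center, the     *)
(* blow-up is covered by the spectra of the rings P[I/x], 0 <> x in I.        *)
Definition blowup (X : set (set K)) (Z : set K) : set (set K) :=
  [set S | exists P x q,
     let B := subring_span (P `|` [set y / x | y in ideal_at Z P]) in
     [/\ X P, ideal_at Z P x, x != 0, is_prime_in B q & S = localization B q]].

Definition uniformizer (S : set K) (p : K) : Prop :=
  [/\ p != 0, maxid S p
    & forall x, x != 0 -> exists k : int, unit_in S (x / p ^ k)].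

(* The models considered are regular, so that their points of codimension one *)
(* are those whose local ring is a discrete valuation ring.                   *)
Definition prime_divisor (X : set (set K)) (S : set K) : Prop :=
  X S /\ exists p, uniformizer S p.

Definition ord (S : set K) (f : K) : int :=
  xget 0 [set k : int | exists p, uniformizer S p /\ unit_in S (f / p ^ k)].

(* H^0(X, O(D)) for the divisor D with coefficient [D S] along [S]            *)
Definition H0 (X : set (set K)) (D : set K -> int) : set K :=
  [set f | f = 0 \/ forall S, prime_divisor X S -> 0 <= ord S f + D S].

End Models.

(* L = C^r is 'cV[C]_r and its dual is 'rV[C]_r.  Both Sym L and Sym L^* are  *)
(* {mpoly C[r]}, the variables being the standard basis of C^r in the first   *)
(* case and the coordinate functions in the second.                           *)

Section ProjectiveCompletion.
Variables (C : fieldType) (r : nat).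

Definition ratfun : fieldType := {fraction {mpoly C[r]}}.

(* Coordinates on L (+) C are indexed by 'I_r.+1, the one on C being ord0.    *)
Definition coords (T : Type) (c : T) (x : 'I_r -> T) (i : 'I_r.+1) : T :=
  oapp x c (unlift ord0 i).

(* Restriction of a form on L (+) C to L = L x {1}.                           *)
Definition dehom (G : {mpoly C[r.+1]}) : ratfun :=
  tofrac (G \mPo [tuple coords 1 (fun j => 'X_j) i | i < r.+1]).

Definition is_hom_ideal (P : set {mpoly C[r.+1]}) : Prop :=
  is_ideal_in setT P /\
  forall G d, P G -> P (pihomog mdeg d G).

(* Local ring of Proj at the homogeneous prime [P]: the degree 0 fractions    *)
(* with denominator outside [P].                                              *)
Definition proj_stalk (P : set {mpoly C[r.+1]}) : set ratfun :=
  [set x | exists d G H,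
     [/\ G \is d.-homog, H \is d.-homog, ~ P H & x = dehom G / dehom H]].

Definition proj_completion : set (set ratfun) :=
  [set S | exists P, [/\ is_hom_ideal P, is_prime_in setT P,
                         exists i, ~ P 'X_i & S = proj_stalk P]].

(* Homogeneous ideal, and generic point, of P(U) in the hyperplane at         *)
(* infinity P(L) = P(L (+) 0), for U a subspace of L.                         *)
Definition ideal_infty (U : {vspace 'cV[C]_r}) : set {mpoly C[r.+1]} :=
  [set G | forall v : 'cV[C]_r, v \in U ->
     G.@[coords 0 (fun j => v j ord0)] = 0].

Definition point_infty (U : {vspace 'cV[C]_r}) : set ratfun :=
  proj_stalk (ideal_infty U).

End ProjectiveCompletion.

Section Arrangement.
Variables (C : fieldType) (r n : nat) (l : 'I_n -> 'rV[C]_r).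

Definition hyp (i : 'I_n) : {vspace 'cV[C]_r} :=
  lker (linfun (mulmx (l i) : 'cV[C]_r -> 'M[C]_(1, 1))).

Definition LF (F : {set 'I_n}) : {vspace 'cV[C]_r} :=
  (\bigcap_(i in F) hyp i)%VS.

Definition flat (F : {set 'I_n}) : bool :=
  [forall j, (LF F <= hyp j)%VS ==> (j \in F)].

Definition proper_flat (F : {set 'I_n}) : bool := flat F && (F != [set: 'I_n]%SET).

Definition blowup_order (s : seq {set 'I_n}) : Prop :=
  perm_eq s [seq F <- enum {set 'I_n} | proper_flat F] /\
  sorted leq [seq \dim (LF F) | F <- s].

Definition wonderful (s : seq {set 'I_n}) : set (set (ratfun C r)) :=
  foldl (@blowup _) (@proj_completion C r) [seq point_infty (LF F) | F <- s].

(* [S] is D_F: the prime divisor over P(L_F) that appears when the strict     *)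
(* transform of P(L_F) is blown up.                                           *)
Definition is_D (s : seq {set 'I_n}) (F : {set 'I_n}) (S : set (ratfun C r)) :=
  prime_divisor (wonderful (take (index F s).+1 s)) S /\
  dominates S (point_infty (LF F)).

(* The divisor sum_F a_F D_F                                                  *)
Definition divD (s : seq {set 'I_n}) (a : {set 'I_n} -> int)
    (S : set (ratfun C r)) : int :=
  \sum_(F : {set 'I_n} | proper_flat F && `[< is_D s F S >]) a F.

End Arrangement.

Section InverseSystems.
Variables (C : fieldType) (r : nat).

Definition vec (v : 'cV[C]_r) : {mpoly C[r]} := \sum_(i < r) v i ord0 *: 'X_i.

Definition odot (f g : {mpoly C[r]}) : {mpoly C[r]} :=
  \sum_(m <- msupp f) f@_m *: g^`M[m].

Definition graded_subspace (S : set {mpoly C[r]}) : Prop :=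
  [/\ S 0, forall g h, S g -> S h -> S (g + h),
      forall (c : C) g, S g -> S (c *: g)
    & forall g d, S g -> S (pihomog mdeg d g)].

Definition is_inverse_system (I S : set {mpoly C[r]}) : Prop :=
  graded_subspace S /\
  I = [set f | forall g, S g -> (odot f g).@[fun=> 0] = 0].

End InverseSystems.

(* The value of absz (a F + 1) when a F < 0 is irrelevant.                        *)
Definition power_ideal (C : fieldType) (r n : nat) (l : 'I_n -> 'rV[C]_r)
    (a : {set 'I_n} -> int) : set {mpoly C[r]} :=
  [set f | (exists F, proper_flat l F /\ a F < 0) \/
     ideal_span [set g | exists F v,
       [/\ proper_flat l F, v \in LF l F, v != 0
         & g = vec v ^+ absz (a F + 1)]] f].

(* Main.v *)
Require Import Defs.
From HB Require Import structures.
From mathcomp Require Import all_boot all_order all_algebra.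
From mathcomp Require Import boolp classical_sets reals.
From mathcomp Require Import complex.
From mathcomp Require Import mpoly.
From mathcomp Require Import zify ring ssrcomplements.

Set Implicit Arguments.
Unset Strict Implicit.
Unset Printing Implicit Defensive.

Import Order.TTheory GRing.Theory Num.Theory.

Local Open Scope classical_set_scope.
Local Open Scope ring_scope.

(* For a proper flat [F] let [O_F] be the valuation ring of minus the degree   *)
(* along [L_F].  Locally the iterated blow-up is a localization of a chart     *)
(* generated by ratios of affine forms adapted to a flag of flats.  Scaling    *)
(* the directions of [L_F] by a parameter [t] shows that on such a chart the   *)
(* powers of the ideal of the centre [P(L_F)] are its filtration by the        *)
(* valuation of [O_F]; hence blowing up the centre creates exactly one new     *)
(* discrete valuation ring, [O_F], which is D_F.  The other prime divisors     *)
(* are those of [L], and as [C[x_1, ..., x_r]] is factorial, H^0 consists of   *)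
(* the polynomials of degree at most [a_F] along each [L_F].  This condition   *)
(* reads [D_v ^ (a_F + 1) g = 0] for all [v] in [L_F], and homogeneous ideals  *)
(* are recovered from their apolar complements.                                *)

(** Let [K] be the field of rational functions on L. For a subspace U of L and V = [ann U], the
    function [nu V], minus the degree along U, is a discrete valuation of [K] when U is nonzero; its
    ring is [vge V 0], called O_F when U = L_F. The geometric half of the theorem is [H0P]: the
    sections are the polynomials whose degree along each L_F is at most a_F. The algebraic half,
    [power_ideal_apolar] with [homog_apolar_dual], says that these polynomials form the apolar
    complement of the power ideal and that this complement is its inverse system.

    For the geometry one has to know the prime divisors. The localizations of the polynomial ring at
    its prime elements occur on the projective completion ([prime_stalk_proj]) and survive every
    blow-up ([wonderful_cat_dvr]); as the polynomial ring is factorial, a function regular at all of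
    them is a polynomial ([prime_stalk_range]). O_F occurs too: the order by dimension keeps the
    earlier centres away from the generic point of P(L_F) ([wonderful_point]), and blowing that
    point up creates O_F ([vge_blowup]). By [wonderful_classified] every further prime divisor
    contains all polynomials, hence has coefficient 0 and imposes nothing on a polynomial.

    The classification rests on charts. A chart is a ring A with a space W of linear forms on L (+)
    C and a pivot y in W, containing the ratios v/y for v in W. A centre P(L_G) is cut out in it by
    the v/y with v in V = [ann (LF G)], and the point is that an element of A of order at least k
    for [nu V] lies in the k-th power of that ideal ([chart_ipow]). Indeed, scaling the directions
    of L_G by t turns an element of A into a polynomial in 1/t whose coefficient of t^-j lies in the
    j-th power ([rees]); order at least k kills the terms with j < k, and t = 1 gives the claim. The
    property passes to the chart A[v/z : v in V] of the blow-up ([chart_step]), and [blowup_stage]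
    shows that such charts suffice: blowing up by increasing dimension makes L_G contained in L_F
    whenever a remaining P(L_F) shares a point of the strict transforms with the centre P(L_G).
    Consequently a discrete valuation ring over the blow-up in which the equation of the exceptional
    divisor is not invertible lies in O_G, and equals it because discrete valuation rings are
    maximal subrings ([classified_step]).

    For the algebra, restriction to lines shows that the degree of g along U is at most a iff
    D_v^(a+1) g = 0 for all v in U ([dg_odot]), and a homogeneous ideal is the complement of its
    complement because the apolar pairing is perfect in each degree in characteristic zero. *)

Section Factorial.
Variable R : idomainType.

Definition divides (p a : R) : Prop := exists c, a = c * p.

Definition prime_elt (p : R) : Prop :=
  [/\ p != 0, p \isn't a GRing.unit
    & forall a b, divides p (a * b) -> divides p a \/ divides p b].

Definition factors_in (a : R) (k : nat) : Prop := exists u s,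
  [/\ u \is a GRing.unit, {in s, forall p, prime_elt p}, size s = k
    & a = u * \prod_(p <- s) p].

(** Requiring the factors to be prime, and not merely irreducible, builds uniqueness into the
    existence of a factorization. *)
Definition factorial_ring : Prop := forall a, a != 0 -> exists k, factors_in a k.

Lemma factors_in_unit (u : R) : u \is a GRing.unit -> factors_in u 0.
Proof. by move=> uu; exists u, [::]; split=> //; rewrite big_nil mulr1. Qed.

Lemma factors_in_prime (p : R) : prime_elt p -> factors_in p 1.
Proof.
move=> pp; exists 1, [:: p]; split=> //; first exact: unitr1.
  by move=> q; rewrite inE => /eqP->.
by rewrite big_seq1 mul1r.
Qed.

Lemma factors_inM (a b : R) k m :
  factors_in a k -> factors_in b m -> factors_in (a * b) (k + m).
Proof.
move=> [u [s [uu sp <- ->]]] [v [t [vu tp <- ->]]].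
exists (u * v), (s ++ t); split; rewrite ?unitrM ?uu ?size_cat //.
  by move=> p; rewrite mem_cat => /orP[/sp|/tp].
by rewrite big_cat /= mulrACA.
Qed.

Lemma factors_in_ind (P : R -> Prop) :
    (forall u, u \is a GRing.unit -> P u) ->
    (forall p a, prime_elt p -> a != 0 -> P a -> P (p * a)) ->
  forall a k, factors_in a k -> P a.
Proof.
move=> Pu PM a k [u [s [uu sp _ ->]]]; elim: s sp => [|p s IHs] sp.
  by rewrite big_nil mulr1; apply: Pu.
have spr q : q \in s -> prime_elt q by move=> qs; apply: sp; rewrite inE qs orbT.
rewrite big_cons mulrCA; apply: PM; first by apply: sp; rewrite mem_head.
  rewrite mulf_neq0 //; first by apply: contraTneq uu => ->; rewrite unitr0.
  by rewrite prodf_seq_neq0; apply/allP=> q /spr[].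
exact: IHs.
Qed.

Lemma prime_elt_unit (p u : R) : prime_elt p -> u \is a GRing.unit -> ~ divides p u.
Proof. by case=> _ pN _ uu [c e]; move: uu pN; rewrite e unitrM => /andP[_ ->]. Qed.

(** A prime dividing a product of primes is associate to one of them. This makes the number of prime
    factors a measure for inductions. *)
Lemma factors_in_cancel (p a : R) k :
  prime_elt p -> factors_in (p * a) k -> exists2 j, k = j.+1 & factors_in a j.
Proof.
move=> pp [u [s [uu sp <- {k}]]].
elim: s a sp => [|q s IHs] a sp e.
  by case: (prime_elt_unit pp uu); exists a; rewrite mulrC e big_nil mulr1.
have qp : prime_elt q by apply: sp; rewrite mem_head.
have spr r : r \in s -> prime_elt r by move=> qs; apply: sp; rewrite inE qs orbT.
have [p0 pN pM] := pp; have [q0 qN qM] := qp.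
have e' : p * a = q * (u * \prod_(r <- s) r) by rewrite e big_cons mulrCA.
case: (pM q (u * \prod_(r <- s) r)); first by exists a; rewrite -e' mulrC.
- case=> c qe; case: (qM c p); first by exists 1; rewrite mul1r.
    case=> d ce; case/negP: pN; apply/unitrP; exists d.
    split; last rewrite mulrC; apply: (mulfI q0); rewrite mulr1 {2}qe ce;
      by rewrite mulrCA mulrA.
  case=> d pe; have cu : c \is a GRing.unit.
    apply/unitrP; exists d; split; last rewrite mulrC; apply: (mulIf p0);
      by rewrite -mulrA -qe mul1r -pe.
  exists (size s) => //; exists (c * u), s.
  split; rewrite ?unitrM ?cu //.
  apply: (mulfI p0); rewrite e' qe !mulrA; congr (_ * _).
  by rewrite (mulrC p c).
- case=> c ce; have [|j /= sj aj] := IHs c spr; first by rewrite mulrC ce.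
  exists j.+1; first by rewrite /= sj.
  have -> : a = q * c by apply: (mulfI p0); rewrite e' ce (mulrC c) mulrCA.
  by rewrite -add1n; apply: factors_inM => //; apply: factors_in_prime.
Qed.

End Factorial.

Section FactorialPoly.
Variable R : idomainType.
Hypothesis R_factorial : factorial_ring R.
Implicit Types (p : R) (f g h : {poly R}).

Lemma dividesCP p f : p != 0 -> divides p%:P f <-> forall i, divides p f`_i.
Proof.
move=> p0; split=> [[g ->] i|H].
  by exists g`_i; rewrite coefMC.
have /choice[c ce] : forall i, exists c, f`_i = c * p by move=> i; case: (H i) => c; exists c.
exists (\poly_(i < size f) c i); apply/polyP=> i; rewrite coefMC coef_poly.
case: ifP => // /negbT; rewrite -leqNgt => /(nth_default 0) h.
by rewrite mul0r.
Qed.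

(** Gauss's argument: if i and j are the least indices at which f and g have coefficients not
    divisible by p, then the coefficient of index i + j in f g is congruent to f_i g_j modulo p. *)
Lemma prime_eltC p : prime_elt p -> prime_elt p%:P.
Proof.
move=> [p0 pN pM]; split; first by rewrite polyC_eq0.
  by rewrite poly_unitE size_polyC p0 coefC.
move=> f g; rewrite !dividesCP // => H.
apply: contrapT => /not_orP[] /existsNP Nf /existsNP Ng.
have [i /asboolP ni imin] := ex_minnP (let: ex_intro i hi := Nf in
  ex_intro (fun i => `[< ~ divides p f`_i >]) i (asboolT hi)).
have [j /asboolP nj jmin] := ex_minnP (let: ex_intro i hi := Ng in
  ex_intro (fun i => `[< ~ divides p g`_i >]) i (asboolT hi)).
have dD x y : divides p x -> divides p y -> divides p (x + y).
  by move=> [c ->] [d ->]; exists (c + d); rewrite mulrDl.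
have dM x y : divides p x -> divides p (x * y).
  by move=> [c ->]; exists (c * y); rewrite mulrAC.
have dN x : divides p x -> divides p (- x).
  by move=> [c ->]; exists (- c); rewrite mulNr.
have fi k : (k < i)%N -> divides p f`_k.
  by move=> ki; apply: contrapT => hk; move: (imin k (asboolT hk)); rewrite leqNgt ki.
have gj k : (k < j)%N -> divides p g`_k.
  by move=> ki; apply: contrapT => hk; move: (jmin k (asboolT hk)); rewrite leqNgt ki.
case: (pM f`_i g`_j) => //.
have ij : (i < (i + j).+1)%N by rewrite ltnS leq_addr.
have := H (i + j)%N; rewrite coefM (bigD1 (Ordinal ij)) //= addKn => Hs.
rewrite -[_ * _](addrK (\sum_(k < (i + j).+1 | k != Ordinal ij) f`_k * g`_(i + j - k))).
apply: (dD _ _ Hs); apply: dN; elim/big_rec: _ => [|k x ki dx].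
  by exists 0; rewrite mul0r.
apply: (dD _ _ _ dx); case: (ltngtP k i) => [lt|lt|e]; first exact/dM/fi.
  rewrite mulrC; apply/dM/gj; rewrite ltn_subLR ?ltn_add2r //.
  by rewrite -ltnS ltn_ord.
by case/eqP: ki; apply: val_inj.
Qed.

(** Constant primes are split off one at a time; each uses up a prime factor of the leading
    coefficient, so the process stops. *)
Lemma poly_content f : f != 0 -> exists c g,
  [/\ c != 0, f = c%:P * g & forall p, prime_elt p -> ~ divides p%:P g].
Proof.
move=> f0; have [k] := R_factorial (a := lead_coef f) ltac:(by rewrite lead_coef_eq0).
elim: k f f0 => [|k IHk] f f0 fk.
  exists 1, f; split; rewrite ?oner_neq0 ?mul1r // => p pp [g fe].
  have [p0 _ _] := pp.
  move: fk; rewrite fe lead_coefM lead_coefC mulrC.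
  by case/(factors_in_cancel pp).
have [[p [pp [g fe]]]|nex] := EM (exists p, prime_elt p /\ divides p%:P f); last first.
  exists 1, f; split; rewrite ?oner_neq0 ?mul1r // => p pp pf.
  by apply: nex; exists p.
have [p0 _ _] := pp.
have g0 : g != 0 by apply: contraNneq f0 => g0; rewrite fe g0 mul0r.
move: fk; rewrite fe lead_coefM lead_coefC mulrC.
case/(factors_in_cancel pp) => j [<-] /(IHk _ g0)[c [h [c0 -> hp]]].
exists (p * c), h; split=> //; first by rewrite mulf_neq0.
by rewrite mulrC polyCM mulrA.
Qed.

Lemma divides_cancelC f g c :
    (forall p, prime_elt p -> ~ divides p%:P f) -> c != 0 ->
  divides f (c%:P * g) -> divides f g.
Proof.
move=> fP /R_factorial[k ck]; move: g.
apply: (factors_in_ind (P := fun c => forall g, divides f (c%:P * g) -> divides f g)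
  _ _ ck) => [u uu|p a pp a0 IH] g.
  case=> h e; exists ((u^-1)%:P * h); rewrite -mulrA -e mulrA -polyCM mulVr //.
  by rewrite mul1r.
case=> h e; have [p0 pN pM] := prime_eltC pp.
case: (pM h f) => [|[h' he]|/fP//].
  by exists (a%:P * g); rewrite -e polyCM -mulrA mulrC.
apply: IH; exists h'; apply: (mulfI p0).
rewrite -[LHS](_ : (p * a)%:P * g = _); last by rewrite polyCM mulrA.
by rewrite e he mulrAC mulrC.
Qed.

(** Each prime factor of c remains prime in the polynomial ring, so it divides g or h and can be
    cancelled there without changing degrees. *)
Lemma split_cancelC f g h c : c != 0 -> c%:P * f = g * h ->
  exists g' h', [/\ f = g' * h', size g' = size g & size h' = size h].
Proof.
move=> /R_factorial[k ck]; move: f g h.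
apply: (factors_in_ind (P := fun c => forall f g h, c%:P * f = g * h -> exists g' h',
  [/\ f = g' * h', size g' = size g & size h' = size h]) _ _ ck)
  => [u uu|p a pp a0 IH] f g h.
  have uu' : u^-1 \is a GRing.unit by rewrite unitrV.
  move=> e; exists ((u^-1)%:P * g), h; rewrite -mulrA -e mulrA -polyCM mulVr //.
  rewrite mul1r; split=> //; rewrite mul_polyC size_scale //.
  by apply: contraTneq uu' => ->; rewrite unitr0.
have [p0 pN pM] := prime_eltC pp.
have szp (q : {poly R}) : size (q * p%:P) = size q.
  by rewrite mulrC mul_polyC size_scale // -polyC_eq0.
rewrite polyCM -mulrA => e; case: (pM g h) => [|[q qe]|[q qe]].
- by exists (a%:P * f); rewrite -e mulrC.
- have [|g' [h' [fe sg sh]]] := IH f q h.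
    by apply: (mulfI p0); rewrite [LHS]e qe -mulrA mulrCA.
  by exists g', h'; rewrite qe szp.
- have [|g' [h' [fe sg sh]]] := IH f g q.
    by apply: (mulfI p0); rewrite [LHS]e qe mulrA mulrC.
  by exists g', h'; rewrite qe szp.
Qed.

(** Over a domain [%|] is divisibility up to a nonzero constant, that is, over the fraction field.
    Primitivity of f upgrades it to true divisibility, and over the fraction field an irreducible
    polynomial is prime by coprimality. *)
Lemma irreducible_prime_elt f :
    (forall p, prime_elt p -> ~ divides p%:P f) -> irreducible_poly f ->
  prime_elt f.
Proof.
move=> fP fi; have f0 := irredp_neq0 fi; have [f1 fd] := fi.
split=> //; first by rewrite poly_unitE (gtn_eqF f1).
have key g : (f %| g)%R -> divides f g.
  case/Pdiv.WeakIdomain.dvdpP => -[c q] /= c0 e.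
  by apply: (divides_cancelC fP c0); exists q; rewrite mul_polyC.
move=> a b [c e]; have fab : f %| a * b by rewrite e dvdp_mulIr.
have [/key|Nfa] := boolP (f %| a); first by left.
right; apply: key; rewrite -(Gauss_dvdpr _ (_ : coprimep f a)) //.
apply/coprimepP=> d df da; have [/eqP d1|d1] := boolP (size d == 1%N).
  by rewrite -size_poly_eq1 d1.
by case/negP: Nfa; rewrite -(eqp_dvdl _ (fd d d1 df)).
Qed.

Lemma factorial_poly : factorial_ring {poly R}.
Proof.
move=> f; have [m] := ubnP (size f); elim: m f => // m IHm f sfm.
move=> f0; have [c [g [c0 fe gP]]] := poly_content f0.
suff [k gk] : exists k, factors_in g k.
  have [j cj] := R_factorial c0; exists (j + k)%N; rewrite fe.
  apply: factors_inM gk; move: cj => [u [s [uu sp <- ->]]].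
  exists u%:P, (map polyC s); split; rewrite ?size_map //.
  - by rewrite rmorph_unit.
  - by move=> q /mapP[p /sp pp ->]; apply: prime_eltC.
  - by rewrite polyCM big_map rmorph_prod.
have g0 : g != 0 by apply: contraNneq f0 => g0; rewrite fe g0 mulr0.
have sg : (size g < m.+1)%N.
  by move: sfm; rewrite fe mul_polyC size_scale.
have [sg1|sg1] := leqP (size g) 1.
  have ge := size1_polyC sg1; set d := g`_0 in ge.
  have d0 : d != 0 by rewrite -polyC_eq0 -ge.
  have [k] := R_factorial d0; case=> u [[|p s] [uu sp _ de]].
    exists 0%N; apply: factors_in_unit; rewrite ge poly_unitE coefC eqxx /=.
    by rewrite size_polyC d0 de big_nil mulr1 uu.
  case: (gP p); first by apply: sp; rewrite mem_head.
  exists (u * \prod_(q <- s) q)%:P; rewrite -polyCM ge; congr _%:P.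
  by rewrite de big_cons mulrCA mulrC.
have [irr|] := EM (irreducible_poly g).
  by exists 1%N; apply/factors_in_prime/irreducible_prime_elt.
move=> /not_andP[//|/existsNP[q /not_implyP[q1 /not_implyP[qg Nqg]]]].
have [[d h] /= d0 e] := Pdiv.WeakIdomain.dvdpP _ _ qg.
have [h' [q' [ge sh sq]]] := split_cancelC d0 (etrans (mul_polyC _ _) e).
have h'0 : h' != 0 by apply: contraNneq g0 => h0; rewrite ge h0 mul0r.
have q'0 : q' != 0 by apply: contraNneq g0 => h0; rewrite ge h0 mulr0.
have szg : size g = (size h + size q).-1 by rewrite ge size_mul // sh sq.
have sq1 : (1 < size q)%N by rewrite ltn_neqAle eq_sym q1 -sq size_poly_gt0.
have sh1 : (1 < size h)%N.
  rewrite ltn_neqAle -sh size_poly_gt0 h'0 andbT eq_sym; apply/negP => /eqP h1.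
  apply: Nqg; apply/negPn/negP => Nqg.
  case/negP: Nqg; rewrite -dvdp_size_eqp //.
  by rewrite szg -sh h1.
have [|k hk] := IHm h' _ h'0.
  rewrite sh -ltnS; apply: leq_trans sg; rewrite ltnS szg.
  by case: (size h) (size q) sq1 => [|a] [|[|b]] //= _; rewrite ?addnS ?ltnS ?leq_addr.
have [|j qj] := IHm q' _ q'0.
  rewrite sq -ltnS; apply: leq_trans sg; rewrite ltnS szg.
  by case: (size q) (size h) sh1 => [|a] [|[|b]] //= _; rewrite ?addSn ?addnS ?ltnS ?leq_addl.
by exists (k + j)%N; rewrite ge; apply: factors_inM.
Qed.

End FactorialPoly.

Lemma mpoly_rmorph_ext (R : nzRingType) (S : comNzRingType) n
    (f g : {rmorphism {mpoly R[n]} -> S}) :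
    (forall c, f c%:MP = g c%:MP) -> (forall i, f 'X_i = g 'X_i) -> f =1 g.
Proof.
move=> fgC fgX p; rewrite [p]mpolyE !rmorph_sum; apply: eq_bigr => m _.
rewrite -mul_mpolyC !rmorphM fgC mpolyXE_id !rmorph_prod; congr (_ * _).
by apply: eq_bigr => i _; rewrite !rmorphXn fgX.
Qed.

Lemma factorial_iso (R S : idomainType) (f : {rmorphism R -> S})
    (g : {rmorphism S -> R}) :
  cancel f g -> cancel g f -> factorial_ring S -> factorial_ring R.
Proof.
move=> fK gK SF a a0.
have dvd p b : divides p b -> divides (g p) (g b).
  by move=> [c ->]; exists (g c); rewrite rmorphM.
have [|k [u [s [uu sp sk fa]]]] := SF (f a).
  by rewrite -(rmorph0 f) (can_eq fK).
exists k, (g u), (map g s); split; rewrite ?size_map ?rmorph_unit //; last first.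
  by rewrite -[a]fK fa rmorphM rmorph_prod big_map.
move=> q /mapP[p /sp[p0 pN pM] ->]; split.
- by rewrite -(rmorph0 g) (can_eq gK).
- by apply: contra pN => /(rmorph_unit f); rewrite gK.
- move=> x y [c e]; case: (pM (f x) (f y)); first by exists (f c); rewrite -rmorphM e rmorphM gK.
  + by move/dvd; rewrite fK; left.
  + by move/dvd; rewrite fK; right.
Qed.

Section UniMulti.
Variables (R : comNzRingType) (n : nat).

Definition mmulti_horner (p : {poly {mpoly R[n]}}) : {mpoly R[n.+1]} :=
  horner_eval 'X_ord_max (map_poly (@mwiden n R) p).

HB.instance Definition _ := GRing.RMorphism.copy mmulti_horner
  (horner_eval 'X_ord_max \o map_poly (@mwiden n R)).

Lemma muniXmax : muni ('X_ord_max : {mpoly R[n.+1]}) = 'X.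
Proof.
rewrite muniE msuppX big_seq1 mcoeffX eqxx scale1r mnm1E eqxx.
rewrite (_ : [multinom _ | i < n] = 0%MM) ?mpolyX0 ?scale1r ?expr1 //.
apply/mnmP => i; rewrite mnmE mnm0E mnm1E; case: eqP => // /(congr1 val) /= e.
by move: (ltn_ord i); rewrite -e ltnn.
Qed.

Lemma muniXwiden i : muni ('X_(widen_ord (leqnSn n) i) : {mpoly R[n.+1]}) = ('X_i)%:P.
Proof.
rewrite muniE msuppX big_seq1 mcoeffX eqxx scale1r mnm1E.
case: eqP => [/(congr1 val) /= e|_].
  by move: (ltn_ord i); rewrite e ltnn.
rewrite expr0 (_ : [multinom _ | i < n] = U_(i)%MM); last first.
  by apply/mnmP => j; rewrite mnmE !mnm1E -!val_eqE.
by rewrite alg_polyC.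
Qed.

Lemma muniK : cancel (@muni n R) mmulti_horner.
Proof.
apply: (mpoly_rmorph_ext (f := mmulti_horner \o @muni n R) (g := idfun)) => [c|i] /=.
  by rewrite muniC /mmulti_horner map_polyC /horner_eval hornerC /= mwidenC.
have [j ->|->] := unliftP ord_max i; last first.
  by rewrite muniXmax /mmulti_horner map_polyX /horner_eval hornerX.
rewrite (_ : lift ord_max j = widen_ord (leqnSn n) j); last first.
  by apply: val_inj; rewrite /= /bump leqNgt ltn_ord.
rewrite muniXwiden /mmulti_horner map_polyC /horner_eval hornerC /= mwidenX.
by rewrite mnmwiden1.
Qed.

Lemma mmulti_hornerK : cancel mmulti_horner (@muni n R).
Proof.
move=> p; elim/poly_ind: p => [|p c IHp]; first by rewrite !rmorph0.
have -> : muni (mmulti_horner (p * 'X + c%:P)) =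
    muni (mmulti_horner p) * muni (mmulti_horner 'X) + muni (mmulti_horner c%:P).
  by rewrite -rmorphM -rmorphD -rmorphM -rmorphD.
rewrite IHp; congr (_ * _ + _).
  by rewrite /mmulti_horner map_polyX /horner_eval hornerX muniXmax.
rewrite /mmulti_horner map_polyC /horner_eval hornerC /=.
move: c; apply: (mpoly_rmorph_ext (f := @muni n R \o @mwiden n R) (g := polyC)).
  by move=> c /=; rewrite mwidenC muniC.
by move=> i; rewrite /= mwidenX mnmwiden1 muniXwiden.
Qed.

End UniMulti.

Lemma mpoly_factorial (F : fieldType) n : factorial_ring {mpoly F[n]}.
Proof.
elim: n => [|n IHn].
  move=> p p0; exists 0%N; apply: factors_in_unit; rewrite [p]nvar0_mpolyC.
  rewrite rmorph_unit // unitfE; apply: contraNneq p0 => e.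
  by rewrite [p]nvar0_mpolyC e mpolyC0.
exact: factorial_iso (@muniK F n) (@mmulti_hornerK F n) (factorial_poly IHn).
Qed.

Lemma div_neq0 (F : fieldType) (x y : F) : x != 0 -> y != 0 -> x / y != 0.
Proof. by move=> x0 y0; rewrite mulf_neq0 ?invr_eq0. Qed.

(** * Local rings and blow-ups *)

Section Subrings.
Variable K : fieldType.
Implicit Types (A B P Q S X Y : set K) (x y : K).

Lemma subring1 B : is_subring B -> B 1. Proof. by case. Qed.
Lemma subringB B x y : is_subring B -> B x -> B y -> B (x - y).
Proof. by case=> _ h _; apply: h. Qed.
Lemma subringM B x y : is_subring B -> B x -> B y -> B (x * y).
Proof. by case=> _ _; apply. Qed.
Lemma subring0 B : is_subring B -> B 0.
Proof. by move=> h; rewrite -(subrr 1); apply: subringB (subring1 _) (subring1 _). Qed.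
Lemma subringN B x : is_subring B -> B x -> B (- x).
Proof. by move=> h Bx; rewrite -sub0r; apply: subringB => //; apply: subring0. Qed.
Lemma subringD B x y : is_subring B -> B x -> B y -> B (x + y).
Proof. by move=> h Bx By; rewrite -[y]opprK; apply: subringB => //; apply: subringN. Qed.
Lemma subringX B x k : is_subring B -> B x -> B (x ^+ k).
Proof.
move=> h Bx; elim: k => [|k IHk]; first by rewrite expr0; apply: subring1.
by rewrite exprS; apply: subringM.
Qed.
Lemma subring_span_subring X : is_subring (subring_span X).
Proof.
split=> [B hB _|x y Bx By B hB XB|x y Bx By B hB XB]; first exact: subring1.
  by apply: subringB => //; [apply: Bx | apply: By].
by apply: subringM => //; [apply: Bx | apply: By].
Qed.

Lemma sub_subring_span X : X `<=` subring_span X.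
Proof. by move=> x Xx B _; apply. Qed.

Lemma subring_span_sub X B : is_subring B -> X `<=` B -> subring_span X `<=` B.
Proof. by move=> hB XB x; apply. Qed.

Lemma unit_inM S x y : is_subring S -> unit_in S x -> unit_in S y -> unit_in S (x * y).
Proof.
move=> h [x0 Sx Sx'] [y0 Sy Sy']; split; first by rewrite mulf_neq0.
  exact: subringM.
by rewrite invfM; apply: subringM.
Qed.

Lemma unit_inV S x : unit_in S x -> unit_in S x^-1.
Proof. by case=> x0 Sx Sx'; split; rewrite ?invr_eq0 ?invrK. Qed.

Lemma unit_in1 S : is_subring S -> unit_in S 1.
Proof. by move=> h; split; rewrite ?invr1 ?oner_neq0 //; apply: subring1. Qed.

Lemma unit_in_div S x y : is_subring S -> unit_in S x -> unit_in S y -> unit_in S (x / y).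
Proof. by move=> h ux uy; apply/unit_inM/unit_inV. Qed.

Lemma unit_inX S x k : is_subring S -> unit_in S x -> unit_in S (x ^+ k).
Proof.
move=> h Sx; elim: k => [|k IHk]; first by rewrite expr0; apply: unit_in1.
by rewrite exprS; apply: unit_inM.
Qed.

Lemma unit_in_exprz S x k : is_subring S -> unit_in S x -> unit_in S (x ^ k).
Proof.
move=> h Sx; case: k => k; first exact: unit_inX.
by rewrite NegzE -exprnN; apply/unit_inV/unit_inX.
Qed.

Lemma sub_unit_in S Q x : S `<=` Q -> unit_in S x -> unit_in Q x.
Proof. by move=> SQ [x0 /SQ ? /SQ ?]. Qed.

Lemma maxid0 S : is_subring S -> maxid S 0.
Proof. by move=> h; split; [apply: subring0 | case; rewrite eqxx]. Qed.

Lemma maxid1 S : is_subring S -> ~ maxid S 1.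
Proof. by move=> h [_]; apply; apply: unit_in1. Qed.

Lemma maxidM S x y : is_subring S -> S x -> maxid S y -> maxid S (x * y).
Proof.
move=> h Sx [Sy Ny]; split; first exact: subringM.
case=> xy0 _ Sxy; have [x0 y0] : x != 0 /\ y != 0.
  by move: xy0; rewrite mulf_eq0 negb_or => /andP[].
apply: Ny; split=> //; have -> : y^-1 = x * (x * y)^-1 by rewrite invfM mulVKf.
exact: subringM.
Qed.

Lemma maxid_unit S x : maxid S x -> ~ unit_in S x. Proof. by case. Qed.

Lemma sub_maxid P Q x : P `<=` Q -> P x -> maxid Q x -> maxid P x.
Proof. by move=> PQ Px [_ Nx]; split=> // ux; apply: Nx; apply: sub_unit_in ux. Qed.

Definition is_local S : Prop :=
  is_subring S /\ forall x y, maxid S x -> maxid S y -> maxid S (x + y).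

Lemma maxid_ideal S : is_local S -> is_ideal_in S (maxid S).
Proof.
move=> [h hD]; split=> //; first by move=> x [].
  exact: maxid0.
by move=> x y; apply: maxidM.
Qed.

Lemma maxid_prime S : is_local S -> is_prime_in S (maxid S).
Proof.
move=> hS; have [h hD] := hS; split; first exact: maxid_ideal.
  exact: maxid1.
move=> x y Sx Sy xy; have [ux|] := EM (unit_in S x); last by left.
right; have [x0 _ Sx'] := ux.
by rewrite -[y](mulKf x0); apply: maxidM.
Qed.

(** S is a localization of A. The denominators are described by the units of S instead of a prime of
    A, which makes the relation transitive and lets different charts be compared inside one S. *)
Definition is_loc A S : Prop :=
  [/\ A `<=` S, is_subring S
    & forall x, S x -> exists a d, [/\ A a, A d, unit_in S d & x = a / d]].

Lemma is_loc_refl S : is_subring S -> is_loc S S.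
Proof.
move=> h; split=> // x Sx; exists x, 1; split=> //; rewrite ?invr1 ?mulr1 //.
  exact: subring1.
exact: unit_in1.
Qed.

Definition fractions_in A S : set K :=
  [set x | exists a d, [/\ A a, A d, unit_in S d & x = a / d]].

Lemma sub_fractions_in A S : is_subring A -> is_subring S -> A `<=` fractions_in A S.
Proof.
move=> hA hS x Ax; exists x, 1; split=> //; rewrite ?invr1 ?mulr1 //.
  exact: subring1.
exact: unit_in1.
Qed.

Lemma fractions_in_subring A S :
  is_subring A -> is_subring S -> is_subring (fractions_in A S).
Proof.
move=> hA hS; split.
- by apply: sub_fractions_in => //; apply: subring1.
- move=> _ _ [a [d [Aa Ad ud ->]]] [b [e [Ab Ae ue ->]]].
  exists (a * e - b * d), (d * e); split; last 1 first.
  + by rewrite -mulNr addf_div; [rewrite mulNr | case: ud | case: ue].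
  + by apply: subringB => //; apply: subringM.
  + exact: subringM.
  + exact: unit_inM.
- move=> _ _ [a [d [Aa Ad ud ->]]] [b [e [Ab Ae ue ->]]].
  exists (a * b), (d * e); split; last by rewrite mulf_div.
  + exact: subringM.
  + exact: subringM.
  + exact: unit_inM.
Qed.

Lemma fractions_in_inv A S x : A `<=` S -> is_subring S ->
  fractions_in A S x -> unit_in S x -> fractions_in A S x^-1.
Proof.
move=> AS hS [a [d [Aa Ad ud ->]]] uad; exists d, a; rewrite invf_div; split=> //.
have -> : a = a / d * d by case: ud => d0 _ _; rewrite divfK.
exact: unit_inM.
Qed.

Lemma is_loc_trans A S Q : is_subring A -> is_loc A S -> is_loc S Q -> is_loc A Q.
Proof.
move=> hA [AS hS locS] [SQ hQ locQ]; split=> //; first exact: subset_trans SQ.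
have AQ := subset_trans AS SQ.
have SF : S `<=` fractions_in A Q.
  move=> x /locS[a [d [Aa Ad ud ->]]]; exists a, d; split=> //.
  exact: sub_unit_in ud.
move=> x /locQ[a [d [/SF Fa /SF Fd ud ->]]].
by apply: subringM (fractions_in_subring hA hQ) Fa (fractions_in_inv AQ hQ Fd ud).
Qed.

Section Localization.
Variables (B q : set K).
Hypotheses (hB : is_subring B) (hq : is_prime_in B q).

Let q0 x : ~ q x -> x != 0.
Proof. by case: hq => -[_ h0 _ _ _ _] nx; apply: contra_notN nx => /eqP->. Qed.

Lemma unit_localization d : B d -> ~ q d -> unit_in (localization B q) d.
Proof.
move=> Bd qd; have [_ q1 _] := hq; have d0 := q0 qd; split=> //.
  by exists d, 1; rewrite divr1; split=> //; apply: subring1.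
by exists 1, d; rewrite div1r; split=> //; apply: subring1.
Qed.

Lemma sub_localization : B `<=` localization B q.
Proof. by move=> x Bx; exists x, 1; case: hq => _ q1 _; rewrite divr1; split=> //; apply: subring1. Qed.

Lemma localization_subring : is_subring (localization B q).
Proof.
have [[qB _ qD qM] q1 qP] := hq.
have qMn d e : B d -> B e -> ~ q d -> ~ q e -> ~ q (d * e).
  by move=> Bd Be qd qe h; case: (qP _ _ Bd Be h).
split; first by apply: sub_localization; apply: subring1.
- move=> _ _ [a [d [Ba Bd qd ->]]] [b [e [Bb Be qe ->]]].
  exists (a * e - b * d), (d * e); split; last 1 first.
  + by rewrite -mulNr addf_div ?q0 // mulNr.
  + by apply: subringB => //; apply: subringM.
  + exact: subringM.
  + exact: qMn.
- move=> _ _ [a [d [Ba Bd qd ->]]] [b [e [Bb Be qe ->]]].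
  exists (a * b), (d * e); split; last by rewrite mulf_div.
  + exact: subringM.
  + exact: subringM.
  + exact: qMn.
Qed.

Lemma is_loc_localization : is_loc B (localization B q).
Proof.
split; [exact: sub_localization | exact: localization_subring |].
by move=> _ [a [d [Ba Bd qd ->]]]; exists a, d; split=> //; apply: unit_localization.
Qed.

Lemma maxid_localization x : B x -> maxid (localization B q) x <-> q x.
Proof.
have [[qB _ qD qM] q1 qP] := hq.
move=> Bx; split=> [[_ ux]|qx].
  by apply: contrapT => nx; apply: ux; apply: unit_localization.
split; first exact: sub_localization.
case=> x0 _ [a [d [Ba Bd qd e]]]; apply: qd.
have -> : d = a * x.
  have d0 : d != 0 by apply: contraNneq x0 => d0; move: e; rewrite d0 invr0 mulr0 => /eqP; rewrite invr_eq0.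
  by rewrite -[a](divfK d0) -e mulrAC mulVf // mul1r.
exact: qM.
Qed.

Lemma localization_local : is_local (localization B q).
Proof.
have hL := localization_subring; have [[qB q00 qD qM] q1 qP] := hq.
split=> // x y [[a [d [Ba Bd qd xe]]] Nx] [[b [e [Bb Be qe ye]]] Ny].
have mq a' d' : B a' -> B d' -> ~ q d' -> maxid (localization B q) (a' / d') -> q a'.
  move=> Ba' Bd' qd' m; apply/maxid_localization => //.
  by rewrite -(divfK (q0 qd') a') mulrC; apply: maxidM => //; apply: sub_localization.
have mx : maxid (localization B q) x by split=> //; exists a, d.
have my : maxid (localization B q) y by split=> //; exists b, e.
have qa : q a by apply: (mq a d); rewrite -?xe.
have qb : q b by apply: (mq b e); rewrite -?ye.
rewrite xe ye addf_div ?q0 // mulrC; apply: maxidM => //.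
  by case: (unit_localization (d := d * e)) => //; [apply: subringM | move=> h; case: (qP _ _ Bd Be h)].
apply/maxid_localization; first by apply: subringD => //; apply: subringM.
by apply: qD; rewrite mulrC; apply: qM.
Qed.

End Localization.

Section Valuation.
Variables (S : set K) (p : K).
Hypotheses (hS : is_subring S) (pS : uniformizer S p).

Let p0 : p != 0. Proof. by case: pS. Qed.

Lemma unit_uniformizerX k : unit_in S (p ^ k) -> k = 0.
Proof.
have [_ [Sp Np] _] := pS.
have key j : ~ unit_in S (p ^+ j.+1).
  case=> _ _ h; apply: Np; split=> //.
  have -> : p^-1 = p ^+ j * (p ^+ j.+1)^-1 by rewrite exprSr invfM mulVKf ?expf_neq0.
  by apply: subringM => //; apply: subringX.
by case: k => [[|k]|k] // => [/key|/unit_inV]; rewrite // NegzE -exprnN invrK => /key.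
Qed.

Lemma uniformizer_sub (x : K) k : unit_in S (x / p ^ k) -> S x <-> 0 <= k.
Proof.
have [_ [Sp Np] _] := pS; move=> u; have [xp0 Sxp Spx] := u.
have x0 : x != 0 by apply: contraNneq xp0 => ->; rewrite mul0r.
have pk0 : p ^ k != 0 by rewrite expfz_neq0.
split=> [Sx|]; last first.
  case: k u xp0 Sxp Spx pk0 => // k u xp0 Sxp Spx pk0 _.
  by rewrite -[x](divfK pk0); apply: subringM => //; apply: subringX.
case: k u xp0 Sxp Spx pk0 => // k u xp0 Sxp Spx pk0; exfalso.
have : unit_in S (p ^ k.+1%:Z).
  split; first by rewrite expfz_neq0.
    exact: subringX.
  have -> : (p ^ k.+1%:Z)^-1 = x * (x / p ^ Negz k)^-1.
    by rewrite invf_div mulrCA divff // mulr1 NegzE exprnN.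
  exact: subringM.
by move/unit_uniformizerX.
Qed.

Lemma unit_expM x y k l :
  unit_in S (x / p ^ k) -> unit_in S (y / p ^ l) -> unit_in S (x * y / p ^ (k + l)).
Proof. by move=> ux uy; rewrite expfzDr // -mulf_div; apply: unit_inM. Qed.

Lemma unit_expX x k j : unit_in S (x / p ^ k) -> unit_in S (x ^ j / p ^ (k * j)).
Proof.
move=> ux; rewrite -exprz_exp invr_expz -exprz_inv -expfzMl.
exact: unit_in_exprz.
Qed.

Lemma unit_exp_inj x k l : unit_in S (x / p ^ k) -> unit_in S (x / p ^ l) -> k = l.
Proof.
move=> uk ul; have x0 : x != 0.
  by case: uk => + _ _; apply: contraNneq => ->; rewrite mul0r.
have pk j : p ^ j != 0 by rewrite expfz_neq0.
have : unit_in S (p ^ (l - k)).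
  have -> : p ^ (l - k) = (x / p ^ k) / (x / p ^ l).
    by rewrite expfzDr // -invr_expz invf_div [RHS]mulrC mulrA divfK.
  exact: unit_in_div.
by move/unit_uniformizerX/eqP; rewrite subr_eq0 => /eqP.
Qed.

(** [ord] may have been computed with another uniformizer p'. Writing p' as a unit times p^b and p
    as a unit times p'^a gives b a = 1, and b >= 0 because p' lies in S; hence b = 1. *)
Lemma ord_unit x : x != 0 -> unit_in S (x / p ^ ord S x).
Proof.
move=> x0; rewrite /ord; case: xgetP => [k _ [p' [p'S u]]|]; last first.
  by have [_ _ /(_ x x0)[k u]] := pS; move/(_ k) => []; exists p.
have [_ _ /(_ p' _)[|b ub]] := pS; first by case: p'S.
have [p'0 [Sp' Np'] /(_ p p0)[a ua]] := p'S.
have p'k j : p' ^ j != 0 by rewrite expfz_neq0.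
have ba : b * a = 1.
  apply: (@unit_exp_inj p); last by rewrite expr1z divff //; apply: unit_in1.
  rewrite -[b * a]add0r -[X in X / _](divfK (p'k a)).
  by apply: unit_expM (unit_expX a ub); rewrite expr0z divr1.
have b1 : b = 1.
  have bp : 0 <= b by apply/(uniformizer_sub ub).
  have : b \is a GRing.unit by apply/unitrP; exists a; rewrite mulrC ba.
  by case: b bp {ub ba} => // n _ /=; rewrite unitrE /= => /eqP; case: n => [|[|n]].
rewrite -[k]add0r -{1}[k]mul1r -b1 -[X in X / _](divfK (p'k k)).
by apply: unit_expM (unit_expX k ub); rewrite expr0z divr1.
Qed.

Lemma ord_eq x k : unit_in S (x / p ^ k) -> ord S x = k.
Proof.
move=> u; apply: unit_exp_inj (u); apply: ord_unit.
by case: u => + _ _; apply: contraNneq => ->; rewrite mul0r.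
Qed.

Lemma uniformizer_local : is_local S.
Proof.
have [_ [Sp Np] pu] := pS.
have mp x : maxid S x -> S (x / p).
  move=> [Sx Nx]; have [->|/pu[k uk]] := eqVneq x 0; first by rewrite mul0r; apply: subring0.
  have k0 : 0 <= k by apply/(uniformizer_sub uk).
  case: k k0 uk => // -[|k] _ uk; first by case: Nx; rewrite -[x]divr1 -(expr0z p).
  apply/(@uniformizer_sub _ k); last by [].
  have pk : p ^ k != 0 by rewrite expfz_neq0.
  by rewrite -mulrA -invfM -exprnP -exprS.
split=> // x y /mp Sx /mp Sy.
have -> : x + y = (x / p + y / p) * p by rewrite -mulrDl divfK.
by apply: maxidM => //; apply: subringD.
Qed.

(** An element outside S has negative order, so a larger ring contains p^-1, and then every element
    of the field. *)
Lemma uniformizer_maximal Q : is_subring Q -> (exists y, ~ Q y) -> S `<=` Q -> Q = S.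
Proof.
move=> hQ [y Qy] SQ; apply/seteqP; split=> // x Qx; apply: contrapT => Sx.
have [_ [Sp Np] pu] := pS.
have x0 : x != 0 by apply: contra_notN Sx => /eqP->; apply: subring0.
have [k uk] := pu x x0.
case: k uk => k uk; first by case: Sx; apply/(uniformizer_sub uk).
have ue : x / p ^ Negz k = x * p ^+ k * p.
  by rewrite NegzE -invr_expz invrK -exprnP exprSr mulrA.
have Qp : Q p^-1.
  have -> : p^-1 = x * p ^+ k * (x / p ^ Negz k)^-1.
    by rewrite ue invfM mulVKf // mulf_neq0 // expf_neq0.
  apply: subringM => //; last by case: uk => _ _ /SQ.
  by apply: subringM => //; apply: subringX => //; apply: SQ.
apply: Qy; have [->|/pu[j uj]] := eqVneq y 0; first exact: subring0.
have pj : p ^ j != 0 by rewrite expfz_neq0.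
rewrite -[y](divfK pj); apply: subringM => //; first by apply: SQ; case: uj.
case: j {uj pj} => j; first by apply: subringX => //; apply: SQ.
by rewrite NegzE -exprnN -exprVn; apply: subringX.
Qed.

End Valuation.
End Subrings.

Section Blowup.
Variable K : fieldType.
Implicit Types (X : set (set K)) (P S Z : set K).

Lemma localization_maxid S : is_local S -> localization S (maxid S) = S.
Proof.
move=> hS; have [h _] := hS; apply/seteqP; split=> [_ [b [s [Sb Ss Ns ->]]]|].
  by apply: subringM => //; have [|] := EM (unit_in S s); [case | move=> Nu; case: Ns].
by apply: sub_localization => //; apply: maxid_prime.
Qed.

Lemma ideal_at_nsub Z P : ~ P `<=` Z -> ideal_at Z P = P.
Proof. by move=> PZ; apply/seteqP; split=> [x []|x Px]. Qed.

Lemma ideal_at_sub Z P x : P `<=` Z -> ideal_at Z P x <-> P x /\ maxid Z x.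
Proof. by move=> PZ; split=> [[Px /(_ PZ)]|[Px mx]]; split. Qed.

Lemma blowup_local X Z S : (forall P, X P -> is_subring P) -> blowup X Z S -> is_local S.
Proof.
move=> hX [P [x [q [XP Ix x0 qP ->]]]].
by apply: localization_local => //; apply: subring_span_subring.
Qed.

(** Away from the centre its ideal is the unit ideal, and the chart with pivot 1 returns P
    itself. *)
Lemma blowup_nsub X Z P : X P -> is_local P -> ~ P `<=` Z -> blowup X Z P.
Proof.
move=> XP lP PZ; have [hP _] := lP; exists P, 1, (maxid P); cbv zeta.
have -> : subring_span (P `|` [set y / 1 | y in ideal_at Z P]) = P.
  apply/seteqP; split; last by move=> x Px; apply: sub_subring_span; left.
  by apply: subring_span_sub => // _ [//|[y [Py _] <-]]; rewrite divr1.
rewrite localization_maxid //; split=> //; rewrite ?oner_neq0 //.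
  by rewrite ideal_at_nsub //; apply: subring1.
exact: maxid_prime.
Qed.

(** A discrete valuation ring survives a blow-up. If it lies on the centre then the centre is S
    itself by maximality, and its ideal is already principal, generated by p. *)
Lemma blowup_uniformizer X Z S p : X S -> is_subring S -> uniformizer S p ->
  is_subring Z -> (exists y, ~ Z y) -> blowup X Z S.
Proof.
move=> XS hS pS hZ ZK; have lS := uniformizer_local hS pS.
have [SZ|] := EM (S `<=` Z); last exact: blowup_nsub.
have := uniformizer_maximal hS pS hZ ZK SZ => {hZ ZK} Ze.
have [p0 mp _] := pS; have [Sp _] := mp.
exists S, p, (maxid S); cbv zeta.
have -> : subring_span (S `|` [set y / p | y in ideal_at Z S]) = S.
  apply/seteqP; split; last by move=> x Px; apply: sub_subring_span; left.
  apply: subring_span_sub => // _ [//|[y + <-]].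
  rewrite ideal_at_sub // Ze => -[Sy [_ Ny]].
  have [->|y0] := eqVneq y 0; first by rewrite mul0r; apply: subring0.
  have uy := ord_unit hS pS y0.
  have := (uniformizer_sub hS pS uy).1 Sy.
  case: (ord S y) uy => // -[|k] uy _; first by case: Ny; rewrite -[y]divr1 -(expr0z p).
  apply/(@uniformizer_sub _ _ _ hS pS _ k%:Z) => //.
  by rewrite -mulrA -invfM -exprnP -exprS.
rewrite localization_maxid //; split=> //; last exact: maxid_prime.
by rewrite ideal_at_sub // Ze.
Qed.

(** Where the equation x of the exceptional divisor is invertible, the blow-up has changed nothing:
    S localizes the ring P below. *)
Lemma is_loc_unit (P B S : set K) x : is_loc B S -> is_subring P -> P `<=` S -> P x ->
    unit_in S x -> B `<=` [set b | exists k h, P h /\ b = h / x ^+ k] ->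
  is_loc P S.
Proof.
move=> [BS hS locB] hP PS Px ux Bx; split=> // f /locB[a [d [Ba Bd ud ->]]].
have [k [h [Ph ae]]] := Bx a Ba; have [j [g [Pg de]]] := Bx d Bd.
have [x0 _ _] := ux; have [xk xj] := conj (expf_neq0 k x0) (expf_neq0 j x0).
exists (h * x ^+ j), (g * x ^+ k); split.
- by apply: subringM => //; apply: subringX.
- by apply: subringM => //; apply: subringX.
- apply: unit_inM => //; last exact: unit_inX.
  by rewrite -[g](divfK xj) -de; apply: unit_inM => //; apply: unit_inX.
- by rewrite ae de invf_div mulf_div [x ^+ k * g]mulrC.
Qed.

Lemma blowup_span_form (P I : set K) x : is_subring P -> I `<=` P -> P x -> x != 0 ->
  subring_span (P `|` [set y / x | y in I]) `<=`
    [set b | exists k h, P h /\ b = h / x ^+ k].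
Proof.
move=> hP IP Px x0; apply: subring_span_sub; last first.
  move=> x1 [Pb|[y Iy <-]]; last by exists 1%N, y; split; [apply: IP | rewrite expr1].
  by exists 0%N, x1; rewrite expr0 divr1.
split.
- by exists 0%N, 1; rewrite expr0 divr1; split=> //; apply: subring1.
- move=> _ _ [k [h [Ph ->]]] [j [g [Pg ->]]].
  have [xk xj] := conj (expf_neq0 k x0) (expf_neq0 j x0).
  exists (k + j)%N, (h * x ^+ j - g * x ^+ k); split.
    by apply: subringB => //; apply: subringM => //; apply: subringX.
  by rewrite -mulNr (addf_div _ _ xk xj) mulNr exprD.
- move=> _ _ [k [h [Ph ->]]] [j [g [Pg ->]]].
  exists (k + j)%N, (h * g); split; first exact: subringM.
  by rewrite mulf_div exprD.
Qed.

End Blowup.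

(** * Auxiliary facts on polynomials and rational functions *)

Lemma mpoly_ring_ind (R : comNzRingType) n (P : {mpoly R[n]} -> Prop) :
    (forall c, P c%:MP) -> (forall i, P 'X_i) ->
    (forall g h, P g -> P h -> P (g + h)) -> (forall g h, P g -> P h -> P (g * h)) ->
  forall g, P g.
Proof.
move=> PC PX PD PM g; have P1 : P 1 by rewrite -mpolyC1.
have PXn k i : P ('X_i ^+ k) by elim: k => [|k IHk]; rewrite ?expr0 // exprS; apply: (PM).
rewrite [g]mpolyE; elim/big_rec: _ => [|m p _ Pp]; first by rewrite -mpolyC0.
apply: (PD) => //; rewrite -mul_mpolyC; apply: (PM) => //.
by rewrite mpolyXE_id; elim/big_rec: _ => // i q _; apply: (PM).
Qed.

Lemma poly_roots_eq0 (C : numFieldType) (q : {poly C}) :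
  (forall x, q.[x] = 0) -> q = 0.
Proof.
move=> q0; apply/eqP/negPn/negP => qN0.
pose s : seq C := [seq k%:R | k <- iota 0 (size q)].
have us : uniq s.
  by rewrite map_inj_uniq ?iota_uniq // => a b /eqP; rewrite eqr_nat => /eqP.
have rs : all (root q) s by apply/allP => x _; rewrite /root q0.
by have := max_poly_roots qN0 rs us; rewrite size_map size_iota ltnn.
Qed.

Lemma meval_muni (R : comNzRingType) n (g : {mpoly R[n.+1]}) (u : 'I_n -> R) x :
  (map_poly (meval u) (muni g)).[x] =
    g.@[fun i => oapp u x (unlift ord_max i)].
Proof.
move: g; apply: (mpoly_rmorph_ext
    (f := horner_eval x \o map_poly (meval u) \o @muni n R)
    (g := meval (fun i => oapp u x (unlift ord_max i)))) => [c|i] /=.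
  by rewrite muniC map_polyC /horner_eval hornerC /= !mevalC.
rewrite mevalXU; have [j ->|->] := unliftP ord_max i; last first.
  by rewrite muniXmax map_polyX /horner_eval hornerX.
rewrite (_ : lift ord_max j = widen_ord (leqnSn n) j); last first.
  by apply: val_inj; rewrite /= /bump leqNgt ltn_ord.
by rewrite muniXwiden map_polyC /horner_eval hornerC /= mevalXU.
Qed.

Lemma mpoly_eval_eq0 (C : numFieldType) n (g : {mpoly C[n]}) :
  (forall u, g.@[u] = 0) -> g = 0.
Proof.
elim: n g => [|n IHn] g g0.
  by move: (g0 (fun=> 0)); rewrite [g]nvar0_mpolyC mevalC => ->; rewrite mpolyC0.
rewrite -[g]muniK; suff -> : muni g = 0 by rewrite rmorph0.
apply/polyP => i; rewrite coef0; apply: IHn => u.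
have : map_poly (meval u) (muni g) = 0.
  by apply: poly_roots_eq0 => x; rewrite meval_muni.
by move/(congr1 (fun q : {poly C} => q`_i)); rewrite coef_map coef0.
Qed.

Lemma ratfun_num_den (C : fieldType) r (f : ratfun C r) :
  exists nd : {mpoly C[r]} * {mpoly C[r]}, nd.2 != 0 /\ f = tofrac nd.1 / tofrac nd.2.
Proof.
elim/quotW: f => x; exists (frac x); split; first exact: denom_ratioP.
rewrite -[RHS]/(FracField.mul _ (FracField.inv _)) !piE.
apply/eqmodP; rewrite /= FracField.equivfE /FracField.mulf /FracField.invf.
by rewrite !numden_Ratio ?mul1r ?mulr1 ?oner_neq0 ?denom_ratioP // mulrC.
Qed.

Lemma size_polyM_leqS (R : nzRingType) (p q : {poly R}) a b :
  (size p <= a.+1)%N -> (size q <= b.+1)%N -> (size (p * q)%R <= (a + b).+1)%N.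
Proof.
move=> sp sq; apply: leq_trans (size_polyMleq _ _) _.
by rewrite -subn1 leq_subLR (leq_trans (leq_add sp sq)) // addSn addnS.
Qed.

(** * Degree along a subspace *)

Section Embedding.
Variables (C : fieldType) (r : nat).

Fact emb_key : unit. Proof. exact: tt. Qed.

Definition emb : {mpoly C[r]} -> ratfun C r :=
  locked_with emb_key (@tofrac {mpoly C[r]}).

Lemma embE g : emb g = tofrac g. Proof. by rewrite /emb unlock. Qed.

Fact emb_is_zmod_morphism : zmod_morphism emb.
Proof. by move=> g h; rewrite !embE rmorphB. Qed.

Fact emb_is_monoid_morphism : monoid_morphism emb.
Proof. by split=> [|g h]; rewrite !embE ?rmorph1 ?rmorphM. Qed.

HB.instance Definition _ :=
  GRing.isZmodMorphism.Build {mpoly C[r]} (ratfun C r) emb emb_is_zmod_morphism.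
HB.instance Definition _ :=
  GRing.isMonoidMorphism.Build {mpoly C[r]} (ratfun C r) emb emb_is_monoid_morphism.

Lemma emb0 : emb 0 = 0. Proof. exact: rmorph0. Qed.
Lemma emb1 : emb 1 = 1. Proof. exact: rmorph1. Qed.
Lemma embN : {morph emb : g / - g}. Proof. exact: rmorphN. Qed.
Lemma embD : {morph emb : g h / g + h}. Proof. exact: rmorphD. Qed.
Lemma embB : {morph emb : g h / g - h}. Proof. exact: rmorphB. Qed.
Lemma embM : {morph emb : g h / g * h}. Proof. exact: rmorphM. Qed.
Lemma emb_eq g h : (emb g == emb h) = (g == h). Proof. by rewrite !embE tofrac_eq. Qed.
Lemma emb_eq0 g : (emb g == 0) = (g == 0). Proof. by rewrite embE tofrac_eq0. Qed.

Lemma ratfun_emb (f : ratfun C r) :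
  exists nd : {mpoly C[r]} * {mpoly C[r]}, nd.2 != 0 /\ f = emb nd.1 / emb nd.2.
Proof. by have [nd h] := ratfun_num_den f; exists nd; rewrite !embE. Qed.

End Embedding.

Section Affine.
Variables (C : numFieldType) (r : nat).
Local Notation E := 'rV[C]_r.+1.
Local Notation M := {mpoly C[r]}.
Implicit Types (U : {vspace 'cV[C]_r}) (V W : {vspace E}) (w : E) (pi rho : 'End(E)).

(* A vector [w] of [E] is a linear form on [L (+) C], and [aff w] is its      *)
(* restriction to [L x {1}]; [ann U] consists of the forms vanishing on       *)
(* [U (+) 0], so that [aff w] is constant along [U] for [w] in [ann U].       *)
Definition hcoord (i : 'I_r.+1) : M := coords 1 (fun j => 'X_j) i.
Definition aff w : M := \sum_i w ord0 i *: hcoord i.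
Definition unitv (i : 'I_r.+1) : E := delta_mx ord0 i.

Fact aff_is_linear : linear aff.
Proof.
move=> c v w; rewrite /aff scaler_sumr -big_split /=; apply: eq_bigr => i _.
by rewrite !mxE scalerA -scalerDl.
Qed.

HB.instance Definition _ := GRing.isLinear.Build C E M _ aff aff_is_linear.

Lemma hcoord0 : hcoord ord0 = 1.
Proof. by rewrite /hcoord /coords unlift_none. Qed.

Lemma hcoord_lift j : hcoord (lift ord0 j) = 'X_j.
Proof. by rewrite /hcoord /coords liftK. Qed.

Lemma affE w : aff w = (w ord0 ord0)%:MP + \sum_j w ord0 (lift ord0 j) *: 'X_j.
Proof.
rewrite /aff big_ord_recl hcoord0 -mul_mpolyC mulr1; congr (_ + _).
by apply: eq_bigr => j _; rewrite hcoord_lift.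
Qed.

Lemma aff_unitv i : aff (unitv i) = hcoord i.
Proof.
rewrite /aff (bigD1 i) //= big1 ?addr0 => [|j ji].
  by rewrite mxE !eqxx scale1r.
by rewrite mxE (negbTE ji) andbF scale0r.
Qed.

Lemma aff0 : aff (unitv ord0) = 1. Proof. by rewrite aff_unitv hcoord0. Qed.

Lemma aff_lift j : aff (unitv (lift ord0 j)) = 'X_j.
Proof. by rewrite aff_unitv hcoord_lift. Qed.

Lemma aff_eq0 w : (aff w == 0) = (w == 0).
Proof.
apply/idP/idP => [/eqP|/eqP->]; last by rewrite linear0.
rewrite affE => e; apply/eqP/rowP => i; rewrite mxE.
have [j ->|->] := unliftP ord0 i.
  move/(congr1 (mcoeff U_(j))): e; rewrite mcoeffD mcoeffC mnm1_eq0 mulr0 add0r.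
  rewrite raddf_sum (bigD1 j) //= big1 ?addr0 => [|k kj].
    by rewrite mcoeffZ mcoeffXU eqxx mulr1 mcoeff0.
  by rewrite mcoeffZ mcoeffXU (negbTE kj) mulr0.
move/(congr1 (mcoeff 0%MM)): e; rewrite mcoeffD mcoeffC eqxx mulr1 mcoeff0.
rewrite raddf_sum big1 ?addr0 // => k _ /=.
by rewrite mcoeffZ mcoeffX mnm1_eq0 mulr0.
Qed.

Definition pairing w (v : 'cV[C]_r) : C := \sum_j w ord0 (lift ord0 j) * v j ord0.

Lemma meval_aff w (v : 'cV[C]_r) :
  (aff w).@[fun j => v j ord0] = w ord0 ord0 + pairing w v.
Proof.
rewrite affE mevalD mevalC; congr (_ + _); rewrite raddf_sum.
by apply: eq_bigr => j _ /=; rewrite mevalZ mevalXU.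
Qed.

Definition ann U : {vspace E} :=
  lker (linfun (mulmxr (\matrix_(i, k) coords 0 (fun j => (vbasis U)`_k j ord0) i :
    'M[C]_(r.+1, \dim U)))).

Fact pairing_is_linear w : scalar (pairing w).
Proof.
move=> c u v; rewrite /pairing mulr_sumr -big_split /=; apply: eq_bigr => j _.
by rewrite !mxE mulrDr mulrCA.
Qed.

HB.instance Definition _ w :=
  GRing.isLinear.Build C 'cV[C]_r C _ (pairing w) (pairing_is_linear w).

Lemma annP U w : reflect (forall v, v \in U -> pairing w v = 0) (w \in ann U).
Proof.
rewrite memv_ker lfunE /=.
have e k : (w *m \matrix_(i, k) coords 0 (fun j => (vbasis U)`_k j ord0) i) ord0 k
    = pairing w (vbasis U)`_k.
  rewrite mxE big_ord_recl mxE /coords unlift_none mulr0 add0r.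
  by apply: eq_bigr => j _; rewrite mxE liftK.
apply: (iffP eqP) => [w0 v vU|h].
  rewrite (coord_vbasis vU) linear_sum big1 // => k _.
  by rewrite linearZ /= -e w0 mxE mulr0.
apply/rowP => k; rewrite e mxE; apply: h; apply: vbasis_mem.
by rewrite memt_nth.
Qed.

Lemma unitv0_ann U : unitv ord0 \in ann U.
Proof. by apply/annP => v _; rewrite /pairing big1 // => j _; rewrite mxE mul0r. Qed.

Definition isproj W pi : Prop := (forall w, pi w \in W) /\ {in W, forall w, pi w = w}.

Lemma isproj_projv W : isproj W (projv W).
Proof. by split=> w; [apply: memv_proj | apply: projv_id]. Qed.

(** The freedom in the choice of the projection is used to kill the pivot of a chart, so that
    [sig pi] multiplies the pivot by t exactly. *)
Lemma isproj_ex W y : y \notin W -> exists2 pi, isproj W pi & pi y = 0.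
Proof.
move=> yW; have Wy : (W :&: <[y]> = 0)%VS.
  apply/eqP; rewrite -subv0; apply/subvP => v; rewrite memv_cap => /andP[vW /vlineP[c ve]].
  rewrite memv0 ve; have [->|c0] := eqVneq c 0; first by rewrite scale0r.
  case/negP: yW; rewrite -[y](scalerK c0) -?[c *: y]ve; exact: memvZ.
exists (daddv_pi W <[y]>).
  by split=> w; [apply: memv_pi | apply: daddv_pi_id].
have := daddv_pi_add Wy (subvP (addvSr W <[y]>%VS) _ (memv_line y)).
by rewrite (daddv_pi_id _ (memv_line y)) 1?capvC // => /(canRL (addrK _)); rewrite subrr.
Qed.

Lemma isproj_comp V W rho pi : (V <= W)%VS -> isproj V rho -> isproj W pi ->
  isproj V (rho \o pi)%VF.
Proof.
move=> VW [rV rid] [pW pid]; split=> w; rewrite lfunE //= => wV.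
by rewrite pid ?rid //; apply: (subvP VW).
Qed.

(* When [pi] is a projection onto [ann U], the substitution [sig pi] at time  *)
(* [t] fixes the affine forms that are constant along [U] and multiplies by   *)
(* [t] those in the kernel of [pi].                                           *)
Definition sig_var pi (j : 'I_r) : {poly M} :=
  let w := unitv (lift ord0 j) in (aff (pi w))%:P + aff (w - pi w) *: 'X.

Fact sig_key : unit. Proof. exact: tt. Qed.

Definition sig pi : M -> {poly M} :=
  locked_with sig_key (mmap (polyC \o @mpolyC r C) (sig_var pi)).

Lemma sigE pi g : sig pi g = mmap (polyC \o @mpolyC r C) (sig_var pi) g.
Proof. by rewrite /sig unlock. Qed.

Fact sig_is_zmod_morphism pi : zmod_morphism (sig pi).
Proof. by move=> g h; rewrite !sigE rmorphB. Qed.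

Fact sig_is_monoid_morphism pi : monoid_morphism (sig pi).
Proof. by split=> [|g h]; rewrite !sigE ?rmorph1 ?rmorphM. Qed.

HB.instance Definition _ pi :=
  GRing.isZmodMorphism.Build M {poly M} (sig pi) (sig_is_zmod_morphism pi).
HB.instance Definition _ pi :=
  GRing.isMonoidMorphism.Build M {poly M} (sig pi) (sig_is_monoid_morphism pi).

Lemma sigC pi c : sig pi c%:MP = (c%:MP)%:P.
Proof. by rewrite sigE mmapC. Qed.

Lemma sigX pi j : sig pi 'X_j = sig_var pi j.
Proof. by rewrite sigE mmapX mmap1U. Qed.

Lemma sig_aff pi w : pi (unitv ord0) = unitv ord0 ->
  sig pi (aff w) = (aff (pi w))%:P + aff (w - pi w) *: 'X.
Proof.
move=> p0; pose f w : {poly M} := (aff (pi w))%:P + aff (w - pi w) *: 'X.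
have fE i : f (unitv i) = sig pi (hcoord i).
  have [j ->|->] := unliftP ord0 i; first by rewrite hcoord_lift sigX.
  by rewrite /f p0 subrr linear0 scale0r addr0 aff0 hcoord0 !rmorph1.
have fD c v u : f (c *: v + u) = c%:MP *: f v + f u.
  rewrite /f scalerDr addrACA; congr (_ + _).
    by rewrite !linearP rmorphD /= -!mul_mpolyC polyCM mul_polyC.
  rewrite linearP opprD addrACA -scalerBr linearP /= scalerDl scalerA.
  by rewrite mul_mpolyC.
have f0 : f 0 = 0 by have := fD (- 1) 0 0; rewrite scaler0 addr0 mpolyCN mpolyC1 scaleN1r addNr.
rewrite -/(f w) [in RHS](row_sum_delta w) /aff rmorph_sum /=.
apply: (big_ind2 (fun a b => a = f b)) => [|a b c d -> ->|i _]; first by rewrite f0.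
  by rewrite -[b]scale1r fD mpolyC1 !scale1r.
rewrite -mul_mpolyC rmorphM /= sigC -fE mul_polyC.
by rewrite -[_ *: delta_mx _ _]addr0 fD f0 addr0.
Qed.

Lemma sig1 pi g : (sig pi g).[1] = g.
Proof.
move: g; apply: (mpoly_rmorph_ext (f := horner_eval 1 \o sig pi) (g := idfun)) => [c|j] /=.
  by rewrite sigC /horner_eval hornerC.
rewrite sigX /sig_var /horner_eval hornerD hornerC hornerZ hornerX mulr1 -linearD /=.
by rewrite addrC subrK aff_lift.
Qed.

Lemma sigD pi : {morph sig pi : g h / g + h}. Proof. exact: rmorphD. Qed.
Lemma sigM pi : {morph sig pi : g h / g * h}. Proof. exact: rmorphM. Qed.
Lemma sig0 pi : sig pi 0 = 0. Proof. exact: rmorph0. Qed.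

Lemma sig_eq0 pi g : (sig pi g == 0) = (g == 0).
Proof.
by apply/eqP/eqP => [e|->]; [rewrite -(sig1 pi g) e horner0 | rewrite rmorph0].
Qed.

(** For V = [ann U] these are the polynomials of degree at most a along U: forms of V are free, any
    other form costs one. Membership in a blow-up algebra can be proved by induction on this
    description, which mentions no projection. *)
Inductive fil V : nat -> M -> Prop :=
| fil_const a c : fil V a c%:MP
| fil_add a g h : fil V a g -> fil V a h -> fil V a (g + h)
| fil_mulV a w g : w \in V -> fil V a g -> fil V a (aff w * g)
| fil_mulE a w g : fil V a g -> fil V a.+1 (aff w * g).

Lemma fil_le V a b g : (a <= b)%N -> fil V a g -> fil V b g.
Proof.
move/subnK <-; elim: (b - a)%N => [//|k IHk] /IHk fg.
by rewrite addSn -[g]mul1r -aff0; apply: fil_mulE.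
Qed.

Lemma filM V a b g h : fil V a g -> fil V b h -> fil V (a + b) (g * h).
Proof.
move=> fg fh; elim: fg => {a g} [a c|a g g' _ IH _ IH'|a w g wV _ IH|a w g _ IH].
- rewrite mul_mpolyC; elim: fh => {b h} [b d|b g g' _ IH _ IH'|b w g wV _ IH|b w g _ IH].
  + by rewrite -mul_mpolyC -mpolyCM; apply: fil_const.
  + by rewrite scalerDr; apply: fil_add.
  + by rewrite scalerAr; apply: fil_mulV.
  + by rewrite addnS scalerAr; apply: fil_mulE.
- by rewrite mulrDl; apply: fil_add.
- by rewrite -mulrA; apply: fil_mulV.
- by rewrite -mulrA; apply: fil_mulE.
Qed.

Lemma fil_sum V a I (s : seq I) (P : pred I) F :
  (forall i, P i -> fil V a (F i)) -> fil V a (\sum_(i <- s | P i) F i).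
Proof.
move=> h; elim/big_rec: _ => [|i g Pi fg]; last by apply: fil_add => //; apply: h.
by rewrite -mpolyC0; apply: fil_const.
Qed.

Lemma fil_aff0 V w : w \in V -> fil V 0 (aff w).
Proof. by move=> wV; rewrite -[aff w]mulr1 -mpolyC1; apply/fil_mulV/fil_const. Qed.

Lemma fil_aff1 V w : fil V 1 (aff w).
Proof. by rewrite -[aff w]mulr1 -mpolyC1; apply/fil_mulE/fil_const. Qed.

Section Projection.
Variables (V : {vspace E}) (pi : 'End(E)).
Hypotheses (V0 : unitv ord0 \in V) (Vpi : isproj V pi).

Let pi0 : pi (unitv ord0) = unitv ord0. Proof. by case: Vpi => _; apply. Qed.

Lemma sig_aff_in w : w \in V -> sig pi (aff w) = (aff w)%:P.
Proof.
by move=> wV; rewrite sig_aff //; case: Vpi => _ ->; rewrite // subrr linear0 scale0r addr0.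
Qed.

Lemma size_sig_aff w : (size (sig pi (aff w)) <= 2)%N.
Proof.
rewrite sig_aff // (leq_trans (size_polyD _ _)) // geq_max (leq_trans (size_polyC_leq1 _)) //.
by rewrite (leq_trans (size_scale_leq _ _)) // size_polyX.
Qed.

Lemma size_sig_aff_notin w : w \notin V -> size (sig pi (aff w)) = 2.
Proof.
move=> wV; have [pV pid] := Vpi; have nz : aff (w - pi w) != 0.
  by rewrite aff_eq0 subr_eq0; apply: contraNneq wV => ->; apply: pV.
have s2 : size (aff (w - pi w) *: 'X : {poly M}) = 2 by rewrite size_scale // size_polyX.
by rewrite sig_aff // addrC size_polyDl // s2 ltnS size_polyC_leq1.
Qed.

Lemma fil_size a g : fil V a g -> (size (sig pi g) <= a.+1)%N.
Proof.
elim=> {a g} [a c|a g h _ IHg _ IHh|a w g wV _ IH|a w g _ IH].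
- by rewrite sigC; apply: leq_trans (size_polyC_leq1 _) _.
- by rewrite sigD; apply: leq_trans (size_polyD _ _) _; rewrite geq_max IHg.
- rewrite sigM -[a]add0n; apply: size_polyM_leqS => //.
  by rewrite sig_aff_in // size_polyC_leq1.
- rewrite sigM -[a.+1]add1n; apply: size_polyM_leqS => //.
  exact: size_sig_aff.
Qed.

Lemma fil_coef j g : fil V j (sig pi g)`_j.
Proof.
have [pV pid] := Vpi.
have f0 k : fil V k 0 by rewrite -mpolyC0; apply: fil_const.
move: g j; apply: (mpoly_ring_ind (P := fun g => forall j, fil V j (sig pi g)`_j)).
- by move=> c j; rewrite sigC coefC; case: ifP => // _; apply: fil_const.
- move=> i j; rewrite sigX coefD coefC coefZ coefX; apply: fil_add.
    by case: ifP => // _; apply: (fil_le (leq0n j)); apply: fil_aff0.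
  by case: eqP => [->|_]; rewrite ?mulr1 ?mulr0 //; apply: fil_aff1.
- by move=> g h fg fh j; rewrite sigD coefD; apply: fil_add.
- move=> g h fg fh j; rewrite sigM coefM; apply: fil_sum => i _.
  have ij : (i <= j)%N by rewrite -ltnS ltn_ord.
  by rewrite -[X in fil V X _](subnKC ij); apply: filM.
Qed.

(** The coefficient of t^j in [sig pi g] lies in step j of the filtration ([fil_coef]), and g is the
    sum of these coefficients, by t = 1. *)
Lemma filE a g : fil V a g <-> (size (sig pi g) <= a.+1)%N.
Proof.
split=> [|sg]; first exact: fil_size.
rewrite -(sig1 pi g) horner_coef; apply: fil_sum => i _.
rewrite expr1n mulr1; apply: fil_le (fil_coef i g).
by rewrite -ltnS (leq_trans (ltn_ord i)).
Qed.

End Projection.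

Lemma size_sig V pi rho g : unitv ord0 \in V -> isproj V pi -> isproj V rho ->
  size (sig pi g) = size (sig rho g).
Proof.
move=> V0 Vp Vr; have [->|g0] := eqVneq g 0; first by rewrite !sig0.
have key p q : isproj V p -> isproj V q -> (size (sig p g) <= size (sig q g))%N.
  move=> Vp' Vq'; have : (0 < size (sig q g))%N by rewrite size_poly_gt0 sig_eq0.
  by case E1: (size (sig q g)) => [//|a] _; apply/(filE V0 Vp')/(filE V0 Vq'); rewrite E1.
by apply/eqP; rewrite eqn_leq !key.
Qed.

(* For [V = ann U], the degree of [g] along [U]. *)
Definition dg V (g : M) : nat := (size (sig (projv V) g)).-1.

Section Degree.
Variable V : {vspace E}.
Hypothesis V0 : unitv ord0 \in V.

Lemma size_sigE pi g : isproj V pi -> g != 0 -> size (sig pi g) = (dg V g).+1.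
Proof.
move=> Vp g0; rewrite (size_sig g V0 Vp (isproj_projv V)) /dg prednK //.
by rewrite size_poly_gt0 sig_eq0.
Qed.

Lemma dgE a g : fil V a g <-> (dg V g <= a)%N.
Proof. by rewrite (filE V0 (isproj_projv V)) /dg; case: (size _). Qed.

Lemma dgM g h : g != 0 -> h != 0 -> dg V (g * h) = (dg V g + dg V h)%N.
Proof.
move=> g0 h0; apply: succn_inj; rewrite -(size_sigE (isproj_projv V)) ?mulf_neq0 //.
by rewrite sigM size_mul ?sig_eq0 // !(size_sigE (isproj_projv V)) // addSn addnS.
Qed.

Lemma dgD g h a : (dg V g <= a)%N -> (dg V h <= a)%N -> (dg V (g + h) <= a)%N.
Proof. by move=> /dgE fg /dgE fh; apply/dgE; apply: fil_add. Qed.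

Lemma dgC c : dg V c%:MP = 0%N.
Proof. by apply/eqP; rewrite -leqn0; apply/dgE; apply: fil_const. Qed.

Lemma dg_aff_in w : w \in V -> dg V (aff w) = 0%N.
Proof. by move=> wV; apply/eqP; rewrite -leqn0; apply/dgE; apply: fil_aff0. Qed.

Lemma dg_aff_notin w : w \notin V -> dg V (aff w) = 1%N.
Proof. by move=> wV; rewrite /dg (size_sig_aff_notin V0 (isproj_projv V)). Qed.

End Degree.

Local Notation K := (ratfun C r).
Local Notation fr := (@emb C r).
Implicit Types (f : K).

Definition num f : M := (projT1 (cid (ratfun_emb f))).1.
Definition den f : M := (projT1 (cid (ratfun_emb f))).2.

Lemma den_neq0 f : den f != 0.
Proof. by rewrite /den; case: cid => -[n d] []. Qed.

Lemma num_den f : f = fr (num f) / fr (den f).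
Proof. by rewrite /num /den; case: cid => -[n d] []. Qed.

Fact nu_key : unit. Proof. exact: tt. Qed.

(** The result does not depend on the chosen fraction, by [nu_frac]. The value at 0 is meaningless,
    which is why [vge] treats 0 apart. *)
Definition nu V f : int :=
  locked_with nu_key ((dg V (den f))%:Z - (dg V (num f))%:Z).

Lemma nuE V f : nu V f = (dg V (den f))%:Z - (dg V (num f))%:Z.
Proof. by rewrite /nu unlock. Qed.

Definition afr w : K := fr (aff w).

Lemma afrD v w : afr (v + w) = afr v + afr w.
Proof. by rewrite /afr linearD rmorphD. Qed.

Lemma afrZ c w : afr (c *: w) = fr c%:MP * afr w.
Proof. by rewrite /afr linearZ /= -mul_mpolyC embM. Qed.

Lemma afr_eq0 w : (afr w == 0) = (w == 0).
Proof. by rewrite /afr emb_eq0 aff_eq0. Qed.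

Lemma afr0 : afr (unitv ord0) = 1. Proof. by rewrite /afr aff0 rmorph1. Qed.

Section Nu.
Variable V : {vspace E}.
Hypothesis V0 : unitv ord0 \in V.

Lemma nu_frac n d : n != 0 -> d != 0 ->
  nu V (fr n / fr d) = (dg V d)%:Z - (dg V n)%:Z.
Proof.
move=> n0 d0; rewrite nuE; set f := fr n / fr d.
have d'0 := den_neq0 f; have n'0 : num f != 0.
  apply: contraNneq (_ : f != 0) => [e|]; first by rewrite [f]num_den e rmorph0 mul0r.
  by rewrite mulf_neq0 ?invr_eq0 ?emb_eq0.
have e : n * den f = num f * d.
  apply/eqP; rewrite -emb_eq !embM; apply/eqP.
  have := num_den f; rewrite {1}/f => /eqP; rewrite eqr_div ?emb_eq0 //.
  by move/eqP ->; rewrite mulrC.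
by have := congr1 (dg V) e; rewrite !dgM //; lia.
Qed.

Lemma nu_fr g : g != 0 -> nu V (fr g) = - (dg V g)%:Z.
Proof.
move=> g0; rewrite -[fr g]divr1 -(rmorph1 fr) nu_frac ?oner_neq0 //.
by rewrite -mpolyC1 dgC // sub0r.
Qed.

Lemma num_neq0 f : f != 0 -> num f != 0.
Proof. by apply: contraNneq => e; rewrite [f]num_den e rmorph0 mul0r. Qed.

Lemma nuM (f g : K) : f != 0 -> g != 0 -> nu V (f * g) = nu V f + nu V g.
Proof.
move=> f0 g0; have e : f * g = fr (num f * num g) / fr (den f * den g).
  by rewrite {1}[f]num_den {1}[g]num_den mulf_div !embM.
have [f1 g1 f2 g2] := And4 (num_neq0 f0) (num_neq0 g0) (den_neq0 f) (den_neq0 g).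
rewrite e nu_frac ?mulf_neq0 // !nuE.
by rewrite (dgM V0 f2 g2) (dgM V0 f1 g1); lia.
Qed.

Lemma nu1 : nu V 1 = 0.
Proof. by rewrite -(rmorph1 fr) nu_fr ?oner_neq0 // -mpolyC1 dgC. Qed.

Lemma nuV f : f != 0 -> nu V f^-1 = - nu V f.
Proof.
move=> f0; have fV0 : f^-1 != 0 by rewrite invr_eq0.
by have := nuM f0 fV0; rewrite divff // nu1; lia.
Qed.

Lemma nu_div (f g : K) : f != 0 -> g != 0 -> nu V (f / g) = nu V f - nu V g.
Proof. by move=> f0 g0; rewrite nuM ?invr_eq0 // nuV. Qed.

Lemma nuX f k : f != 0 -> nu V (f ^+ k) = nu V f *+ k.
Proof.
by move=> f0; elim: k => [|k IHk]; rewrite ?nu1 // exprS mulrS nuM ?expf_neq0 ?IHk.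
Qed.

Lemma nu_exprz f k : f != 0 -> nu V (f ^ k) = nu V f * k.
Proof.
move=> f0; case: k => k; first by rewrite -exprnP nuX // -mulr_natr natz.
by rewrite NegzE -exprnN nuV ?expf_neq0 // nuX // mulrN -mulr_natr natz.
Qed.

Lemma nu_afr_in w : w != 0 -> w \in V -> nu V (afr w) = 0.
Proof. by move=> w0 wV; rewrite nu_fr ?aff_eq0 // dg_aff_in. Qed.

Lemma notin_neq0 w : w \notin V -> w != 0.
Proof. by apply: contraNneq => ->; rewrite mem0v. Qed.

Lemma nu_afr_notin w : w \notin V -> nu V (afr w) = -1.
Proof. by move=> wV; rewrite nu_fr ?aff_eq0 ?notin_neq0 // dg_aff_notin. Qed.

Lemma nu_afr_ge w : w != 0 -> -1 <= nu V (afr w).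
Proof. by move=> w0; have [/nu_afr_in->|/nu_afr_notin->] := boolP (w \in V). Qed.

Definition vge (k : int) : set K := [set f | f = 0 \/ k <= nu V f].

Lemma vgeM k l (f g : K) : vge k f -> vge l g -> vge (k + l) (f * g).
Proof.
have [->|f0] := eqVneq f 0; first by rewrite mul0r; left.
have [->|g0] := eqVneq g 0; first by rewrite mulr0; left.
move=> [/eqP|kf]; first by rewrite (negbTE f0).
move=> [/eqP|lg]; first by rewrite (negbTE g0).
by right; rewrite nuM // lerD.
Qed.

Lemma vge_le k l f : l <= k -> vge k f -> vge l f.
Proof. by move=> lk [|kf]; [left | right; apply: le_trans kf]. Qed.

Lemma vgeN k f : vge k f -> vge k (- f).
Proof.
move=> [->|kf]; first by left; rewrite oppr0.
have [->|f0] := eqVneq f 0; first by left; rewrite oppr0.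
right; rewrite -mulN1r nuM ?oppr_eq0 ?oner_neq0 //.
rewrite -(rmorph1 fr) -rmorphN nu_fr ?oppr_eq0 ?oner_neq0 //.
by rewrite -mpolyC1 -mpolyCN dgC // oppr0 add0r.
Qed.

Lemma vgeD k (f g : K) : vge k f -> vge k g -> vge k (f + g).
Proof.
have [->|f0] := eqVneq f 0; first by rewrite add0r.
have [->|g0] := eqVneq g 0; first by rewrite addr0.
move=> [/eqP|kf]; first by rewrite (negbTE f0).
move=> [/eqP|kg]; first by rewrite (negbTE g0).
have [->|fg0] := eqVneq (f + g) 0; [by left | right].
have e : f + g = fr (num f * den g + num g * den f) / fr (den f * den g).
  rewrite {1}[f]num_den {1}[g]num_den addf_div ?emb_eq0 ?den_neq0 //.
  by rewrite !rmorphM rmorphD !rmorphM.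
rewrite e nu_frac ?mulf_neq0 ?den_neq0 //; last first.
  by apply: contraNneq fg0 => e'; rewrite e e' rmorph0 mul0r.
suff : (dg V (num f * den g + num g * den f))%:Z <= (dg V (den f * den g))%:Z - k.
  by lia.
rewrite !nuE in kf kg.
have b1 : (dg V (num f * den g))%:Z <= (dg V (den f * den g))%:Z - k.
  by rewrite !dgM ?num_neq0 ?den_neq0 //; lia.
have b2 : (dg V (num g * den f))%:Z <= (dg V (den f * den g))%:Z - k.
  by rewrite !dgM ?num_neq0 ?den_neq0 //; lia.
move: b1 b2; case: (_ - k) => // a b1 b2; rewrite lez_nat; exact: dgD.
Qed.

Lemma vge_neq0 k f : f != 0 -> vge k f -> k <= nu V f.
Proof. by move=> f0 [/eqP|//]; rewrite (negbTE f0). Qed.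

Lemma vge0_subring : is_subring (vge 0).
Proof.
split; first by right; rewrite nu1.
  by move=> x y vx vy; apply: vgeD => //; apply: vgeN.
by move=> x y vx vy; have := vgeM vx vy; rewrite addr0.
Qed.

Lemma unit_in_vge0 f : unit_in (vge 0) f <-> f != 0 /\ nu V f = 0.
Proof.
split=> [[f0 /(vge_neq0 f0) h]|[f0 e]]; last first.
  by split=> //; right; rewrite ?nuV // e ?oppr0.
rewrite -invr_eq0 in f0 *; move=> /(vge_neq0 f0); rewrite invr_eq0 in f0 *.
by rewrite nuV // oppr_ge0 => h'; split=> //; apply: le_anti; rewrite h h'.
Qed.

Lemma uniformizer_vge0 w : w \notin V -> uniformizer (vge 0) (afr w)^-1.
Proof.
move=> wV; have w0 := notin_neq0 wV; have n1 : nu V (afr w)^-1 = 1.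
  by rewrite nuV ?afr_eq0 // nu_afr_notin.
split; first by rewrite invr_eq0 afr_eq0.
  split; first by right; rewrite n1.
  by rewrite unit_in_vge0 n1 => -[].
move=> x x0; exists (nu V x); apply/unit_in_vge0.
rewrite mulf_neq0 ?invr_eq0 ?expfz_neq0 ?invr_eq0 ?afr_eq0 //.
rewrite nu_div ?expfz_neq0 ?invr_eq0 ?afr_eq0 // nu_exprz ?invr_eq0 ?afr_eq0 //.
by rewrite n1 mul1r subrr.
Qed.

Lemma vge0_proper w : w \notin V -> ~ vge 0 (afr w).
Proof. by move=> wV /vge_neq0; rewrite afr_eq0 notin_neq0 // nu_afr_notin // => /(_ isT). Qed.

Lemma maxid_vge0 f : maxid (vge 0) f <-> vge 1 f.
Proof.
split=> [[h Nf]|h]; last first.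
  split; first exact: vge_le h.
  by case/unit_in_vge0=> f0 nf; move: (vge_neq0 f0 h); rewrite nf.
have [->|f0] := eqVneq f 0; [by left | right].
rewrite -gtz0_ge1 lt_neqAle (vge_neq0 f0 h) andbT eq_sym.
by apply/eqP => nf; apply: Nf; apply/unit_in_vge0.
Qed.

Lemma ord_vge0 f w : w \notin V -> f != 0 -> ord (vge 0) f = nu V f.
Proof.
move=> wV f0; apply: (ord_eq vge0_subring (uniformizer_vge0 wV)).
have p0 : (afr w)^-1 != 0 by rewrite invr_eq0 afr_eq0 notin_neq0.
have p1 : nu V (afr w)^-1 = 1.
  by rewrite nuV ?afr_eq0 ?notin_neq0 // nu_afr_notin.
move: _^-1 p0 p1 => p p0 p1; have pk : p ^ nu V f != 0 by rewrite expfz_neq0.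
have pkV : (p ^ nu V f)^-1 != 0 by rewrite invr_eq0.
apply/unit_in_vge0; split; first exact: mulf_neq0 f0 pkV.
rewrite (nu_div f0 pk).
rewrite (nu_exprz _ p0) p1.
by rewrite mul1r subrr.
Qed.

End Nu.
End Affine.

(** * Forms, their top parts along a subspace, and generic points at infinity *)

Lemma dhomog_ind (R : comNzRingType) n d (P : {mpoly R[n]} -> Prop) :
    P 0 -> (forall g h, P g -> P h -> P (g + h)) ->
    (forall c m, mdeg m = d -> P (c *: 'X_[m])) ->
  forall g, g \is d.-homog -> P g.
Proof.
move=> P0 PD PX g /dhomogP gh; rewrite [g]mpolyE big_seq.
by apply: (big_ind P) => // m /gh; apply: PX.
Qed.

Lemma meval_dhomog (R : comNzRingType) n d (g : {mpoly R[n]}) c x :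
  g \is d.-homog -> g.@[fun i => c * x i] = c ^+ d * g.@[x].
Proof.
move: g; apply: dhomog_ind => [|g h eg eh|a m <-]; first by rewrite !meval0 mulr0.
  by rewrite !mevalD eg eh mulrDr.
rewrite !mevalZ !mevalX mulrCA; congr (_ * _); rewrite mdegE.
rewrite (big_morph _ (exprD c) (expr0 c)) -big_split /=.
by apply: eq_bigr => i _; rewrite exprMn.
Qed.

Section LeadingTerm.
Variable R : nzRingType.

(** The coefficient a is allowed to vanish; this is what makes the relation additive. *)
Definition leading (d : nat) (p : {poly R}) (a : R) : Prop :=
  (size p <= d.+1)%N /\ p`_d = a.

Lemma leading0 d : leading d 0 0. Proof. by split; rewrite ?size_poly0 ?coef0. Qed.

Lemma leadingD d p q a b : leading d p a -> leading d q b -> leading d (p + q) (a + b).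
Proof.
move=> [sp <-] [sq <-]; split; last by rewrite coefD.
by apply: leq_trans (size_polyD _ _) _; rewrite geq_max sp.
Qed.

Lemma leadingM d e p q a b : leading d p a -> leading e q b ->
  leading (d + e) (p * q) (a * b).
Proof.
move=> [sp <-] [sq <-]; split; first exact: size_polyM_leqS.
have de : (d < (d + e).+1)%N by rewrite ltnS leq_addr.
rewrite coefM (bigD1 (Ordinal de)) //= addKn big1 ?addr0 // => i ne.
have [lt|lt|e'] := ltngtP i d.
- by rewrite [q`_ _]nth_default ?mulr0 // (leq_trans sq) // ltn_subRL ltn_add2r.
- by rewrite [p`_ _]nth_default ?mul0r // (leq_trans sp).
- by case/eqP: ne; apply: val_inj.
Qed.

Lemma leading_prod I (s : seq I) (d : I -> nat) p a :
    (forall i, leading (d i) (p i) (a i)) ->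
  leading (\sum_(i <- s) d i) (\prod_(i <- s) p i) (\prod_(i <- s) a i).
Proof.
move=> h; elim: s => [|i s IHs]; last by rewrite !big_cons; apply: leadingM.
by rewrite !big_nil; split; rewrite ?size_poly1 ?coef1.
Qed.

Lemma leadingX d p a k : leading d p a -> leading (d * k) (p ^+ k) (a ^+ k).
Proof.
move=> h; elim: k => [|k IHk].
  by rewrite muln0 !expr0; split; rewrite ?size_poly1 ?coef1.
by rewrite mulnS !exprS; apply: leadingM.
Qed.

End LeadingTerm.

Section PointInfty.
Variables (C : numFieldType) (r : nat).
Local Notation E := 'rV[C]_r.+1.
Local Notation M := {mpoly C[r]}.
Local Notation N := {mpoly C[r.+1]}.
Local Notation K := (ratfun C r).
Local Notation fr := (@emb C r).
Implicit Types (G H : N) (pi : 'End(E)).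

Fact dehomp_key : unit. Proof. exact: tt. Qed.

Definition dehomp : N -> M :=
  locked_with dehomp_key (comp_mpoly [tuple hcoord C i | i < r.+1]).

Lemma dehompE G : dehomp G = G \mPo [tuple hcoord C i | i < r.+1].
Proof. by rewrite /dehomp unlock. Qed.

Lemma dehomE G : dehom G = fr (dehomp G). Proof. by rewrite dehompE embE. Qed.

Fact dehomp_is_zmod_morphism : zmod_morphism dehomp.
Proof. by move=> G H; rewrite !dehompE rmorphB. Qed.

Fact dehomp_is_monoid_morphism : monoid_morphism dehomp.
Proof. by split=> [|G H]; rewrite !dehompE ?rmorph1 ?rmorphM. Qed.

HB.instance Definition _ := GRing.isZmodMorphism.Build N M dehomp dehomp_is_zmod_morphism.
HB.instance Definition _ :=
  GRing.isMonoidMorphism.Build N M dehomp dehomp_is_monoid_morphism.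

Lemma dehomp0 : dehomp 0 = 0. Proof. exact: rmorph0. Qed.
Lemma dehomp1 : dehomp 1 = 1. Proof. exact: rmorph1. Qed.
Lemma dehompD : {morph dehomp : G H / G + H}. Proof. exact: rmorphD. Qed.
Lemma dehompB : {morph dehomp : G H / G - H}. Proof. exact: rmorphB. Qed.
Lemma dehompM : {morph dehomp : G H / G * H}. Proof. exact: rmorphM. Qed.
Lemma dehompZ c G : dehomp (c *: G) = c%:MP * dehomp G.
Proof. by rewrite !dehompE comp_mpolyZ mul_mpolyC. Qed.

Lemma tnth_hcoord (f : 'I_r.+1 -> M) i : tnth [tuple f j | j < r.+1] i = f i.
Proof. by rewrite tnth_mktuple. Qed.

Lemma dehompX m : dehomp 'X_[m] = \prod_i hcoord C i ^+ m i.
Proof. by rewrite dehompE comp_mpolyX; apply: eq_bigr => i _; rewrite tnth_hcoord. Qed.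

Lemma meval_dehomp G u :
  (dehomp G).@[u] = G.@[fun i => coords 1 u i].
Proof.
rewrite dehompE comp_mpoly_meval; apply: meval_eq => i; rewrite tnth_hcoord.
rewrite /hcoord /coords; case: unlift => [j|] /=; first by rewrite mevalXU.
by rewrite meval1.
Qed.

Lemma dehomp_neq0 d G : G \is d.-homog -> G != 0 -> dehomp G != 0.
Proof.
move=> hG; apply: contraNneq => e.
(* The factor ['X_ord0] takes care of the points at infinity, where the dehomogenization says
   nothing; at the others homogeneity rescales the first coordinate to 1. *)
have : 'X_ord0 * G = 0.
  apply: mpoly_eval_eq0 => u; rewrite mevalM mevalXU.
  have [->|u0] := eqVneq (u ord0) 0; first by rewrite mul0r.
  have -> : G.@[u] = G.@[fun i => u ord0 * coords 1 (fun j => u (lift ord0 j) / u ord0) i].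
    apply: meval_eq => i; rewrite /coords.
    have [j ->|->] := unliftP ord0 i; rewrite ?liftK ?unlift_none /= ?mulr1 //.
    by rewrite mulrC divfK.
  by rewrite (meval_dhomog _ _ hG) -meval_dehomp e meval0 !mulr0.
move/eqP; rewrite mulf_eq0 => /orP[|/eqP//].
by move/eqP/(congr1 (mcoeff U_(ord0)))/eqP; rewrite mcoeffXU eqxx mcoeff0 oner_eq0.
Qed.

(** For a form G of degree d this is the coefficient of t^d in [sig pi (dehomp G)]. It amounts to
    the restriction of G to U, pulled back along [moving pi], when [pi] is the chosen projection
    onto [ann U]. *)
Definition topmap pi G : M := G \mPo [tuple aff (unitv C i - pi (unitv C i)) | i < r.+1].

Lemma dehomp_leading pi d G : pi (unitv C ord0) = unitv C ord0 ->
  G \is d.-homog -> leading d (sig pi (dehomp G)) (topmap pi G).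
Proof.
move=> p0; move: G; apply: dhomog_ind => [|G H hG hH|c m <-].
- by rewrite dehomp0 sig0 /topmap rmorph0; apply: leading0.
- by rewrite dehompD sigD /topmap rmorphD /=; apply: leadingD.
rewrite dehompZ sigM sigC /topmap comp_mpolyZ -mul_mpolyC.
rewrite -[mdeg m]add0n; apply: leadingM.
  by split; rewrite ?size_polyC_leq1 // coefC.
rewrite dehompX comp_mpolyX rmorph_prod mdegE.
have -> : \prod_i tnth [tuple aff (unitv C i - pi (unitv C i)) | i < r.+1] i ^+ m i =
    \prod_i aff (unitv C i - pi (unitv C i)) ^+ m i.
  by apply: eq_bigr => i _; rewrite tnth_hcoord.
apply: leading_prod => i; rewrite rmorphXn /=.
suff h1 : leading 1 (sig pi (hcoord C i)) (aff (unitv C i - pi (unitv C i))).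
  by have := leadingX (m i) h1; rewrite mul1n.
rewrite -aff_unitv sig_aff //; split.
  apply: leq_trans (size_polyD _ _) _; rewrite geq_max.
  rewrite (leq_trans (size_polyC_leq1 _)) //=.
  by apply: leq_trans (size_scale_leq _ _) _; rewrite size_polyX.
by rewrite coefD coefC coefZ coefX mulr1 add0r.
Qed.

(** The double annihilator property; for the spaces L_F it can be read off their equations
    ([bidual_LF]). *)
Definition bidual (U : {vspace 'cV[C]_r}) : Prop :=
  forall v, {in ann U, forall w, pairing w v = 0} -> v \in U.

(* The component of the point [u] in the direction scaled by [sig pi].        *)
Definition moving pi (u : 'cV[C]_r) : 'cV[C]_r := \col_j
  (aff (unitv C (lift ord0 j) - pi (unitv C (lift ord0 j)))).@[fun j => u j ord0].

Section Subspace.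
Variable U : {vspace 'cV[C]_r}.
Hypothesis Ubi : bidual U.
Local Notation V := (ann U).
Local Notation pi := (projv V).

Let V0 : unitv C ord0 \in V := unitv0_ann U.
Let Vpi : isproj V pi := isproj_projv V.

Let pi0 : pi (unitv C ord0) = unitv C ord0. Proof. by case: Vpi => _; apply. Qed.

Local Notation z := (moving pi).

Lemma moving_in u : z u \in U.
Proof.
apply: Ubi => w wV; have [pV pid] := Vpi.
have : aff (w - pi w) = \sum_j w ord0 (lift ord0 j) *:
    aff (unitv C (lift ord0 j) - pi (unitv C (lift ord0 j))).
  pose e (j : 'I_r) : E := unitv C (lift ord0 j).
  have we : w = w ord0 ord0 *: unitv C ord0 + \sum_(j < r) w ord0 (lift ord0 j) *: e j.
    by rewrite {1}[w]row_sum_delta big_ord_recl.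
  have pwe : pi w = w ord0 ord0 *: unitv C ord0 + \sum_(j < r) w ord0 (lift ord0 j) *: pi (e j).
    rewrite {1}we linearD linearZ /= pi0 linear_sum; congr (_ + _).
    by apply: eq_bigr => j _; rewrite linearZ.
  rewrite pwe {1}we opprD addrACA subrr add0r -sumrB linear_sum.
  by apply: eq_bigr => j _; rewrite -scalerBr linearZ.
rewrite pid // subrr linear0 => /(congr1 (meval (fun j => u j ord0))).
rewrite meval0 raddf_sum => e'; rewrite [RHS]e'; apply: eq_bigr => j _ /=.
by rewrite mxE mevalZ.
Qed.

(** On U the map [moving] is the translation by -c, where c collects the constant terms of the
    projected coordinates and lies in U. *)
Let z_surj v : v \in U -> exists u, z u = v.
Proof.
move=> vU; have [pV pid] := Vpi.
pose c : 'cV[C]_r := \col_j (pi (unitv C (lift ord0 j))) ord0 ord0.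
have zE x : x \in U -> z x = x - c.
  move=> xU; apply/colP => j; rewrite !mxE linearB mevalB !meval_aff.
  rewrite ((annP _ _ (pV _)) x xU) addr0; congr (_ - _).
  rewrite mxE /= add0r /pairing (bigD1 j) //= big1 => [|k kj].
    by rewrite mxE !eqxx mul1r addr0.
  by rewrite mxE (inj_eq lift_inj) (negbTE kj) andbF mul0r.
have cU : c \in U.
  by rewrite -memvN -sub0r -(zE 0) ?mem0v //; apply: moving_in.
by exists (v + c); rewrite zE ?memvD // addrK.
Qed.

Lemma topmap_eq0 G : topmap pi G = 0 <-> ideal_infty U G.
Proof.
have key (u : 'cV[C]_r) : (topmap pi G).@[fun j => u j ord0] = G.@[coords 0 (fun j => z u j ord0)].
  rewrite /topmap comp_mpoly_meval; apply: meval_eq => i; rewrite tnth_hcoord.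
  rewrite /coords; have [j ->|->] := unliftP ord0 i.
    by rewrite /= mxE.
  by rewrite /= pi0 subrr linear0 meval0.
split=> [e v /z_surj[u <-]|h]; first by rewrite -key e meval0.
apply: mpoly_eval_eq0 => u; rewrite -(h _ (moving_in (\col_j u j))) -key.
by apply: meval_eq => j; rewrite mxE.
Qed.

(** For v in U the polynomial in x obtained by evaluating G at x v vanishes identically, and its
    coefficients are the values at v of the homogeneous components of G. *)
Lemma ideal_infty_hom : is_hom_ideal (ideal_infty U).
Proof.
split.
  split=> // [v _|G H hG hH v vU|G H _ hH v vU]; first by rewrite meval0.
    by rewrite mevalD hG // hH // addr0.
  by rewrite mevalM hH // mulr0.
move=> G d hG v vU.
pose q : {poly C} := \sum_(k < msize G)
  (pihomog mdeg k G).@[coords 0 (fun j => v j ord0)] *: 'X^k.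
have q0 : q = 0.
  apply: poly_roots_eq0 => x; rewrite horner_sum.
  transitivity (G.@[coords 0 (fun j => (x *: v) j ord0)]); last by apply: hG; apply: memvZ.
  rewrite [in RHS](pihomog_partitionE (leqnn (msize G))) raddf_sum; apply: eq_bigr => k _ /=.
  rewrite hornerZ hornerXn mulrC -(meval_dhomog _ _ (pihomogP _ _ _)).
  apply: meval_eq => i; rewrite /coords; case: unlift => [j|] /=; rewrite ?mulr0 //.
  by rewrite mxE.
have [dG|dG] := ltnP d (msize G).
  move/(congr1 (fun q : {poly C} => q`_d)): q0; rewrite coef0 coef_sum.
  rewrite (bigD1 (Ordinal dG)) //= coefZ coefXn eqxx mulr1 big1 ?addr0 // => k kd.
  rewrite coefZ coefXn; case: eqP => [e|]; last by rewrite mulr0.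
  by case/eqP: kd; apply: val_inj.
rewrite pihomogE big1_seq ?meval0 // => m /andP[/eqP md /msize_mdeg_lt].
by rewrite /= md ltnNge dG.
Qed.

(** The ideal is the kernel of the ring morphism [topmap pi] into a domain. *)
Lemma ideal_infty_prime : is_prime_in setT (ideal_infty U).
Proof.
have [h _] := ideal_infty_hom; split=> //.
  by move=> /(_ 0 (mem0v _)); rewrite meval1 => /eqP; rewrite oner_eq0.
move=> G H _ _; rewrite -!topmap_eq0 /topmap rmorphM /= => /eqP.
by rewrite mulf_eq0 => /orP[] /eqP; [left | right].
Qed.

Lemma dg_dehomp d G : G \is d.-homog -> (dg V (dehomp G) <= d)%N.
Proof.
move=> hG; have [s _] := dehomp_leading pi0 hG.
by rewrite /dg; case: (size _) s.
Qed.

Lemma dg_dehompE d G : G \is d.-homog -> ~ ideal_infty U G -> dg V (dehomp G) = d.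
Proof.
move=> hG NG; apply/eqP; rewrite eqn_leq dg_dehomp // leqNgt; apply/negP => lt.
apply: NG; apply/topmap_eq0; have [s <-] := dehomp_leading pi0 hG.
by rewrite nth_default //; move: lt; rewrite /dg; case: (size _).
Qed.

Lemma ideal_infty_dg d G : G \is d.-homog -> ideal_infty U G -> G != 0 ->
  (dg V (dehomp G) < d)%N.
Proof.
move=> hG /topmap_eq0 e G0; have [s1 s2] := dehomp_leading pi0 hG.
have G0' := dehomp_neq0 hG G0.
have : (0 < size (sig pi (dehomp G)))%N by rewrite size_poly_gt0 sig_eq0.
rewrite /dg; case E1: (size _) s1 => [//|k]; rewrite ltnS => kd _ /=.
rewrite ltn_neqAle kd andbT; apply/eqP => kde; move: G0'.
by rewrite -(sig_eq0 pi) -lead_coef_eq0 lead_coefE E1 /= kde s2 e eqxx.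
Qed.

End Subspace.
End PointInfty.

Lemma linear_polyM (R : comNzRingType) (a b c : R) :
  ((c * a)%:P + (c * b) *: 'X) * 'X^1 = (0%:P + c *: 'X) * (a%:P + b *: 'X).
Proof. by rewrite -!mul_polyC !polyCM polyC0 expr1; ring. Qed.

(** * Charts of the iterated blow-up *)

Section Stalks.
Variables (C : numFieldType) (r : nat).
Local Notation E := 'rV[C]_r.+1.
Local Notation M := {mpoly C[r]}.
Local Notation N := {mpoly C[r.+1]}.
Local Notation K := (ratfun C r).
Local Notation fr := (@emb C r).
Implicit Types (G H : N) (V W : {vspace E}) (v w y : E) (A T : set K) (f g : K) (pi rho : 'End(E)).

Definition linform w : N := \sum_i w ord0 i *: 'X_i.

Lemma linform_homog w : linform w \is 1.-homog.
Proof. by apply: rpred_sum => i _; apply: dhomogZ; rewrite dhomogX /= mdeg1. Qed.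

Lemma dehomp_linform w : dehomp (linform w) = aff w.
Proof.
rewrite dehompE /linform raddf_sum; apply: eq_bigr => i _ /=.
by rewrite comp_mpolyZ comp_mpolyXU -tnth_nth tnth_hcoord.
Qed.

Lemma linform_infty U w : ideal_infty U (linform w) <-> w \in ann U.
Proof.
have e (u : 'cV[C]_r) : (linform w).@[coords 0 (fun j => u j ord0)] = pairing w u.
  rewrite /linform raddf_sum big_ord_recl /= mevalZ mevalXU.
  rewrite /coords unlift_none mulr0 add0r; apply: eq_bigr => j _ /=.
  by rewrite mevalZ mevalXU liftK.
split=> [h|/annP h v vU]; last by rewrite e h.
by apply/annP => v vU; rewrite -e h.
Qed.

Lemma linform_unitv i : linform (unitv C i) = 'X_i.
Proof.
rewrite /linform (bigD1 i) //= big1 ?addr0 => [|j ji].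
  by rewrite mxE !eqxx scale1r.
by rewrite mxE (negbTE ji) andbF scale0r.
Qed.

Lemma ratio_stalk (P : set N) d G H :
  G \is d.-homog -> H \is d.-homog -> ~ P H -> proj_stalk P (fr (dehomp G) / fr (dehomp H)).
Proof. by move=> hG hH PH; exists d, G, H; rewrite !dehomE. Qed.

Section PrimeStalk.
Variable P : set N.
Hypothesis P_prime : is_prime_in setT P.

Lemma stalk_neq0 d H : H \is d.-homog -> ~ P H -> fr (dehomp H) != 0.
Proof.
move=> hH PH; rewrite emb_eq0; apply: dehomp_neq0 (hH) _.
by apply: contra_notN PH => /eqP->; case: P_prime => -[].
Qed.

Lemma proj_stalk_subring : is_subring (proj_stalk P).
Proof.
have [_ P1 PM] := P_prime.
have PMn H H' : ~ P H -> ~ P H' -> ~ P (H * H').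
  by move=> h h' /(PM _ _ I I)[].
split.
- have := ratio_stalk (dhomog1 _ _) (dhomog1 _ _) P1.
  by rewrite dehomp1 emb1 divr1.
- move=> _ _ [d [G [H [hG hH PH ->]]]] [d' [G' [H' [hG' hH' PH' ->]]]].
  have [H0 H'0] := conj (stalk_neq0 hH PH) (stalk_neq0 hH' PH').
  rewrite !dehomE -mulNr addf_div //.
  rewrite -!embM -embN -embM -embD -!dehompM.
  have -> : dehomp (G * H') + - dehomp G' * dehomp H = dehomp (G * H' - G' * H).
    by rewrite dehompB !dehompM mulNr.
  apply: (@ratio_stalk _ (d + d')); last exact: PMn.
    by apply: rpredB; [apply: dhomogM | rewrite addnC; apply: dhomogM].
  exact: dhomogM.
- move=> _ _ [d [G [H [hG hH PH ->]]]] [d' [G' [H' [hG' hH' PH' ->]]]].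
  rewrite !dehomE mulf_div -!embM -!dehompM.
  by apply: (@ratio_stalk _ (d + d')); rewrite ?dhomogM //; apply: PMn.
Qed.

Lemma maxid_stalk x : maxid (proj_stalk P) x <-> exists d G H,
  [/\ G \is d.-homog, H \is d.-homog, ~ P H, P G & x = fr (dehomp G) / fr (dehomp H)].
Proof.
have [[_ _ _ PI] P1 PM] := P_prime; split=> [[[d [G [H [hG hH PH ->]]]] Nx]|].
  exists d, G, H; rewrite !dehomE; split=> //; apply: contrapT => PG; apply: Nx.
  have [G0 H0] := conj (stalk_neq0 hG PG) (stalk_neq0 hH PH).
  rewrite !dehomE; split; first exact: div_neq0 G0 H0.
    exact: ratio_stalk hH PH.
  by rewrite invf_div; apply: ratio_stalk hG PG.
case=> d [G [H [hG hH PH PG ->]]]; split; first exact: ratio_stalk hH PH.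
have H0 := stalk_neq0 hH PH.
case=> x0 _ [d' [G' [H' [hG' hH' PH']]]]; rewrite !dehomE invf_div.
have H'0 := stalk_neq0 hH' PH'.
have G0 : fr (dehomp G) != 0 by apply: contraNneq x0 => ->; rewrite mul0r.
move/eqP; rewrite (eqr_div _ _ G0 H'0) -!embM emb_eq -!dehompM => /eqP e.
have PHH' : ~ P (H * H') by move=> /(PM _ _ I I)[].
apply: PHH'; suff -> : H * H' = G * G' by rewrite mulrC; apply: PI.
apply/eqP; rewrite -subr_eq0; apply/negPn/negP => ne.
have := dehomp_neq0 (_ : H * H' - G * G' \is (d + d').-homog) ne.
rewrite rpredB ?dhomogM // => /(_ isT); rewrite dehompB e [G' * G]mulrC subrr eqxx.
by [].
Qed.

Lemma proj_stalk_local : is_local (proj_stalk P).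
Proof.
have hP := proj_stalk_subring; have [[_ _ PD PI] P1 PM] := P_prime.
split=> // x y /maxid_stalk[d [G [H [hG hH PH PG ->]]]].
case/maxid_stalk=> d' [G' [H' [hG' hH' PH' PG' ->]]].
have [H0 H'0] := conj (stalk_neq0 hH PH) (stalk_neq0 hH' PH').
rewrite (addf_div _ _ H0 H'0) -!embM -embD -!dehompM -dehompD; apply/maxid_stalk.
exists (d + d')%N, (G * H' + G' * H), (H * H'); split=> //.
- by apply: rpredD; [apply: dhomogM | rewrite addnC; apply: dhomogM].
- exact: dhomogM.
- by move=> /(PM _ _ I I)[].
- by apply: PD; rewrite mulrC; apply: PI.
Qed.

End PrimeStalk.

(** For W = [ann U] these are the equations of P(U) where the pivot y is invertible. *)
Definition lfr (W : {vspace E}) (y : E) : set K := [set afr v / afr y | v in [set v | v \in W]].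

Lemma lfr_in W y v : v \in W -> lfr W y (afr v / afr y).
Proof. by move=> vW; exists v. Qed.

Lemma lfr_const W y c : y \in W -> y != 0 -> lfr W y (fr c%:MP).
Proof.
move=> yW y0; exists (c *: y); first exact: memvZ.
by rewrite afrZ mulfK // afr_eq0.
Qed.

Lemma homog_in_span A i d G : is_subring A ->
  lfr fullv (unitv C i) `<=` A -> G \is d.-homog -> A (fr (dehomp G) / fr (hcoord C i) ^+ d).
Proof.
move=> hA lA; have ye : afr (unitv C i) = fr (hcoord C i) by rewrite /afr aff_unitv.
have y0 : fr (hcoord C i) != 0.
  rewrite -ye afr_eq0; apply/eqP => /matrixP/(_ ord0 i)/eqP.
  by rewrite !mxE !eqxx oner_eq0.
move: G; apply: dhomog_ind => [|G H hG hH|c m <-].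
- by rewrite dehomp0 emb0 mul0r; apply: subring0.
- by rewrite dehompD embD mulrDl; apply: subringD.
rewrite dehompZ embM -mulrA.
apply: subringM => //.
  apply: lA; apply: lfr_const; rewrite ?memvf //.
  by rewrite -(afr_eq0 (unitv C i)) ye.
rewrite dehompX mdegE rmorph_prod /=.
rewrite (big_morph _ (exprD _) (expr0 _)) -prodf_div.
elim/big_rec: _ => [|j g _ Ag]; first exact: subring1.
apply: subringM => //; rewrite rmorphXn -expr_div_n; apply: subringX => //.
apply: lA; have := lfr_in (unitv C i) (memvf (unitv C j)).
by rewrite /afr !aff_unitv.
Qed.

Section PointStalk.
Variable U : {vspace 'cV[C]_r}.
Hypothesis Ubi : bidual U.
Local Notation V := (ann U).
Local Notation Z := (point_infty U).

Let V0 : unitv C ord0 \in V := unitv0_ann U.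
Let Iprime := ideal_infty_prime Ubi.

Lemma point_subring : is_subring Z.
Proof. exact: proj_stalk_subring. Qed.

Lemma nu_stalk d G H : G \is d.-homog -> H \is d.-homog -> ~ ideal_infty U H ->
  G != 0 -> nu V (dehom G / dehom H) = d%:Z - (dg V (dehomp G))%:Z.
Proof.
move=> hG hH IH G0; have G0' := dehomp_neq0 hG G0.
have := stalk_neq0 Iprime hH IH; rewrite emb_eq0 => H0.
by rewrite !dehomE nu_frac // (dg_dehompE Ubi hH IH).
Qed.

(** A form of degree d has degree at most d along U, with equality when it does not vanish on U; so
    a fraction regular at the generic point of P(U) has [nu] at least 0. *)
Lemma point_sub : Z `<=` vge V 0.
Proof.
move=> _ [d [G [H [hG hH IH ->]]]].
have [->|G0] := eqVneq G 0.
  by left; rewrite !dehomE dehomp0 emb0 mul0r.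
right; rewrite (nu_stalk hG hH IH G0) subr_ge0 lez_nat; exact: dg_dehomp hG.
Qed.

Lemma point_inv f : Z f -> f != 0 -> nu V f = 0 -> Z f^-1.
Proof.
move=> [d [G [H [hG hH IH ->]]]].
have [->|G0] := eqVneq G 0; first by rewrite !dehomE dehomp0 emb0 mul0r eqxx.
move=> _; rewrite (nu_stalk hG hH IH G0) => e; rewrite invf_div !dehomE.
apply: (ratio_stalk hH hG).
move=> IG; have := ideal_infty_dg Ubi hG IG G0.
by lia.
Qed.

Lemma unit_point f : unit_in Z f <-> [/\ Z f, f != 0 & nu V f = 0].
Proof.
split=> [[f0 /[dup] Zf /point_sub h /point_sub h']|[Zf f0 nf]]; last first.
  by split=> //; apply: point_inv.
split=> //; have := vge_neq0 f0 h; have := vge_neq0 (f := f^-1) _ h'.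
by rewrite invr_eq0 nuV // => /(_ f0); lia.
Qed.

Lemma maxid_point f : maxid Z f <-> Z f /\ vge V 1 f.
Proof.
split=> [[Zf Nf]|[Zf h]]; last first.
  by split=> // /unit_point[_ f0 nf]; have := vge_neq0 f0 h; rewrite nf.
split=> //; have [->|f0] := eqVneq f 0; [by left | right].
rewrite -gtz0_ge1 lt_neqAle (vge_neq0 f0 (point_sub Zf)) andbT eq_sym.
by apply/eqP => nf; apply: Nf; apply/unit_point.
Qed.

Lemma point_local : is_local Z.
Proof.
split=> [|x y /maxid_point[Zx vx] /maxid_point[Zy vy]]; first exact: point_subring.
apply/maxid_point; split; first exact: subringD (point_subring) _ _.
exact: vgeD.
Qed.

Lemma lfr_point y v : y \notin V -> Z (afr v / afr y).
Proof.
move=> yV; rewrite /afr -!dehomp_linform; apply: ratio_stalk (linform_homog _) _ _ => //.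
  exact: linform_homog.
by move/linform_infty; apply/negP.
Qed.

Lemma lfr_maxid y v : y \notin V -> v \in V -> maxid Z (afr v / afr y).
Proof.
move=> yV vV; apply/maxid_point; split; first exact: lfr_point.
have [->|v0] := eqVneq v 0; first by left; rewrite /afr linear0 emb0 mul0r.
right; rewrite nu_div ?afr_eq0 ?(notin_neq0 yV) //.
by rewrite nu_afr_in // nu_afr_notin.
Qed.

End PointStalk.

(** When T lies in the ring A this is the k-th power of the ideal generated by T, and A itself for k
    = 0. *)
Inductive ipow A T : nat -> K -> Prop :=
| ipow_base a : A a -> ipow A T 0 a
| ipow_zero k : ipow A T k 0
| ipow_add k a b : ipow A T k a -> ipow A T k b -> ipow A T k (a + b)
| ipow_mul k t a : T t -> ipow A T k a -> ipow A T k.+1 (t * a).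

Lemma ipow0 A T a : is_subring A -> ipow A T 0 a -> A a.
Proof.
move=> hA; move E: 0%N => k ip; elim: ip E => {k a} // [k _|k a b _ IHa _ IHb e].
  exact: subring0.
by apply: subringD; rewrite ?IHa ?IHb //; [apply: IHa | apply: IHb].
Qed.

Lemma ipowA A T k a b : is_subring A -> A a -> ipow A T k b -> ipow A T k (a * b).
Proof.
move=> hA Aa; elim=> {k b} [b Ab|k|k b c _ IHb _ IHc|k t b Tt _ IH].
- by apply: ipow_base; apply: subringM.
- by rewrite mulr0; apply: ipow_zero.
- by rewrite mulrDr; apply: ipow_add.
- by rewrite mulrCA; apply: ipow_mul.
Qed.

Lemma ipowM A T j k a b : is_subring A ->
  ipow A T j a -> ipow A T k b -> ipow A T (j + k) (a * b).
Proof.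
move=> hA ia ib; elim: ia => {j a} [a Aa|j|j a c _ IHa _ IHc|j t a Tt _ IH].
- exact: ipowA.
- by rewrite mul0r; apply: ipow_zero.
- by rewrite mulrDl; apply: ipow_add.
- by rewrite -mulrA; apply: ipow_mul.
Qed.

Lemma ipow_sub A T A' T' k a : is_subring A' -> A `<=` A' ->
  (forall t, T t -> ipow A' T' 1 t) -> ipow A T k a -> ipow A' T' k a.
Proof.
move=> hA' AA TT; elim=> {k a} [a Aa|k|k a c _ IHa _ IHc|k t a Tt _ IH].
- by apply: ipow_base; apply: AA.
- exact: ipow_zero.
- exact: ipow_add.
- by rewrite -add1n; apply: ipowM => //; apply: TT.
Qed.

Lemma ipow_gen A T t : is_subring A -> T t -> ipow A T 1 t.
Proof.
by move=> hA Tt; rewrite -[t]mulr1; apply/ipow_mul/ipow_base => //; apply: subring1.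
Qed.

Lemma ipow_le A T j k a : is_subring A -> T `<=` A -> (j <= k)%N ->
  ipow A T k a -> ipow A T j a.
Proof.
move=> hA TA /subnK <-; elim: (k - j)%N => [//|i IHi]; rewrite addSn => ia.
apply: IHi; move: ia; move E: (i + j).+1 => m ip.
elim: ip (i + j)%N E => {m a} // [m l _|m a b _ IHa _ IHb l e|m t a Tt ia IHa l [->]].
- exact: ipow_zero.
- by apply: ipow_add; [apply: IHa | apply: IHb].
- by apply: ipowA => //; apply: TA.
Qed.

Lemma ipow_sum A T k I (s : seq I) (Q : pred I) F :
  (forall i, Q i -> ipow A T k (F i)) -> ipow A T k (\sum_(i <- s | Q i) F i).
Proof.
by move=> h; elim/big_rec: _ => [|i a Qi ia]; [apply: ipow_zero | apply: ipow_add; first apply: h].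
Qed.

(* Presentation of [g] along the substitution [sig pi]: up to [t ^ e] the     *)
(* image of [g] is a polynomial in [1 / t] lying in the Rees algebra of the   *)
(* ideal generated by [T] in [A].                                             *)
Definition rees (pi : 'End(E)) A T : set K := [set g | exists n d e (G : {poly K}),
  [/\ d != 0, g = fr n / fr d,
      map_poly fr (sig pi n) * 'X^e = map_poly fr (sig pi d) * G,
      (size G <= e.+1)%N & forall i j, (i + j)%N = e -> ipow A T j G`_i]].

Lemma rees_subring pi A T : is_subring A -> is_subring (rees pi A T).
Proof.
move=> hA; split.
- exists 1, 1, 0%N, 1; split=> //.
  + exact: oner_neq0.
  + by rewrite emb1 divr1.
  + by rewrite size_poly1.
  + move=> i j /eqP; rewrite addn_eq0 => /andP[/eqP-> /eqP->].
    by rewrite coef1; apply: ipow_base; apply: subring1.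
- move=> _ _ [n [d [e [G [d0 -> eG sG iG]]]]] [n' [d' [e' [G' [d'0 -> eG' sG' iG']]]]].
  exists (n * d' - n' * d), (d * d'), (e + e')%N, (G * 'X^e' - G' * 'X^e); split.
  + exact: mulf_neq0.
  + by rewrite -mulNr addf_div ?emb_eq0 // rmorphB !rmorphM mulNr.
  + rewrite rmorphB !sigM rmorphB !rmorphM /= exprD.
    move: eG eG'; set a := map_poly _ (sig pi n); set b := map_poly _ (sig pi d).
    set a' := map_poly _ (sig pi n'); set b' := map_poly _ (sig pi d') => eG eG'.
    have -> : (a * b' - a' * b) * ('X^e * 'X^e') =
        (a * 'X^e) * (b' * 'X^e') - (a' * 'X^e') * (b * 'X^e) by ring.
    by rewrite eG eG'; ring.
  + apply: leq_trans (size_polyD _ _) _; rewrite size_polyN geq_max.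
    rewrite size_polyM_leqS ?size_polyXn //=.
    by rewrite addnC size_polyM_leqS ?size_polyXn.
  + move=> i j ij; rewrite coefB !coefMXn; apply: ipow_add.
      case: ltnP => [_|ei]; [exact: ipow_zero | apply: iG; lia].
    rewrite -mulN1r; apply: ipowA => //.
      by apply: subringN => //; apply: subring1.
    case: ltnP => [_|ei]; [exact: ipow_zero | apply: iG'; lia].
- move=> _ _ [n [d [e [G [d0 -> eG sG iG]]]]] [n' [d' [e' [G' [d'0 -> eG' sG' iG']]]]].
  exists (n * n'), (d * d'), (e + e')%N, (G * G'); split.
  + exact: mulf_neq0.
  + by rewrite mulf_div !rmorphM.
  + by rewrite !sigM !rmorphM /= exprD mulrACA eG eG' mulrACA.
  + exact: size_polyM_leqS.
  + move=> i j ij; rewrite coefM; apply: ipow_sum => -[k /= ki] _.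
    have [ek|ke] := ltnP e k; first by rewrite nth_default ?mul0r; [exact: ipow_zero | exact: leq_trans ek].
    have [ek'|ke'] := ltnP e' (i - k).
      by rewrite [G'`_ _]nth_default ?mulr0; [exact: ipow_zero | exact: leq_trans ek'].
    have -> : j = ((e - k) + (e' - (i - k)))%N by lia.
    by apply: ipowM => //; [apply: iG; lia | apply: iG'; lia].
Qed.

Lemma rees_sub pi A T A' T' : is_subring A' -> A `<=` A' ->
  (forall t, T t -> ipow A' T' 1 t) -> rees pi A T `<=` rees pi A' T'.
Proof.
move=> hA' AA TT g [n [d [e [G [d0 ge eG sG iG]]]]].
exists n, d, e, G; split=> // i j ij.
by apply: (ipow_sub hA' AA TT); apply: iG.
Qed.

Lemma map_sig_aff pi w : pi (unitv C ord0) = unitv C ord0 ->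
  map_poly fr (sig pi (aff w)) = (afr (pi w))%:P + afr (w - pi w) *: 'X.
Proof. by move=> p0; rewrite sig_aff // rmorphD /= map_polyC map_polyZ map_polyX. Qed.

(** Since [pi y = 0], the substitution sends y to t y, and v/y becomes (pi v / y) t^-1 + (v - pi v)
    / y: the coefficient of t^-1 lies in the ideal, the constant one in A. *)
Lemma rees_lfr pi V W y A v : is_subring A -> isproj V pi -> unitv C ord0 \in V ->
  y != 0 -> pi y = 0 -> (forall w, w \in W -> pi w \in W) -> lfr W y `<=` A ->
  v \in W -> rees pi A (lfr V y) (afr v / afr y).
Proof.
move=> hA Vpi V0 y0 piy piW WA vW; have [pV pid] := Vpi.
have p0 : pi (unitv C ord0) = unitv C ord0 by apply: pid.
pose G : {poly K} := (afr (pi v) / afr y)%:P + (afr (v - pi v) / afr y) *: 'X.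
exists (aff v), (aff y), 1%N, G; split=> //.
- by rewrite aff_eq0.
- rewrite !map_sig_aff // piy subr0 /G.
  have -> : afr (0 : E) = 0 by apply/eqP; rewrite afr_eq0.
  have y1 : afr y != 0 by rewrite afr_eq0.
  have ey x : x = afr y * (x / afr y) by rewrite mulrC divfK.
  rewrite {1}[afr (pi v)]ey {1}[afr (v - pi v)]ey.
  exact: linear_polyM.
- apply: leq_trans (size_polyD _ _) _; rewrite geq_max (leq_trans (size_polyC_leq1 _)) //=.
  by apply: leq_trans (size_scale_leq _ _) _; rewrite size_polyX.
- move=> [|[|i]] j ij; rewrite coefD coefC coefZ coefX /= ?mulr0 ?mulr1 ?addr0 ?add0r.
  + move: ij; rewrite add0n => ->; apply: ipow_gen => //; exact: lfr_in.
  + have -> : j = 0%N by lia.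
    apply: ipow_base; apply: WA; apply: lfr_in; apply: memvB => //; exact: piW.
  + exact: ipow_zero.
Qed.

(** The substituted g is G / t^e, and g is its value at t = 1. Order at least k leaves only the
    powers t^-j with j >= k, whose coefficients lie in the k-th power of the ideal. *)
Lemma rees_ipow pi V A T g k : unitv C ord0 \in V -> isproj V pi -> is_subring A ->
  T `<=` A -> rees pi A T g -> vge V k%:Z g -> ipow A T k g.
Proof.
move=> V0 Vpi hA TA [n [d [e [G [d0 ge eG sG iG]]]]] vg.
have [g0|g0] := eqVneq g 0; first by rewrite g0; apply: ipow_zero.
have n0 : n != 0 by apply: contraNneq g0 => e'; rewrite ge e' emb0 mul0r.
have frI : injective fr by move=> a b /eqP; rewrite emb_eq => /eqP.
have szf (p : {poly M}) : size (map_poly fr p) = size p.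
  by rewrite size_map_inj_poly // emb0.
have G0 : G != 0.
  apply: contraNneq n0 => G0; move/eqP: eG; rewrite G0 mulr0 mulf_eq0.
  rewrite expf_eq0 polyX_eq0 andbF orbF -size_poly_eq0 szf size_poly_eq0.
  by rewrite sig_eq0.
have gG : g = G.[1].
  move/(congr1 (horner_eval 1)): eG; rewrite /horner_eval !hornerM hornerXn expr1n mulr1.
  rewrite -(emb1 C r) !horner_map !sig1 emb1 => h.
  have d0' : fr d != 0 by rewrite emb_eq0.
  by rewrite ge; apply: (canLR (mulfK d0')); rewrite h mulrC.
(* [nu V g] is the t-degree of the denominator minus that of the numerator, so the equation [eG]
   bounds the degree of G by e - k. *)
have szG : (size G + k <= e.+1)%N.
  have := vge_neq0 g0 vg; rewrite ge nu_frac // => h.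
  have e1 : (dg V n + e.+1 = dg V d + size G)%N.
    have := congr1 (fun p : {poly K} => size p) eG.
    rewrite !size_mul ?expf_neq0 ?polyX_eq0 -?size_poly_eq0 ?szf ?size_poly_eq0 ?sig_eq0 //.
    by rewrite size_polyXn !(size_sigE V0 Vpi).
  have e2 : (k + dg V n <= dg V d)%N by move: h; rewrite lerBrDr -PoszD lez_nat.
  by rewrite -(leq_add2l (dg V d)) addnA -e1; lia.
rewrite gG horner_coef; apply: ipow_sum => -[i /= iG'] _.
have h3 : (i + k < e.+1)%N by apply: leq_trans szG; rewrite ltn_add2r.
rewrite expr1n mulr1; apply: (@ipow_le _ _ k (e - i)%N) => //; first lia.
by apply: iG; lia.
Qed.

(** W is the annihilator of the last centre on the way to this chart, or everything at the start,
    and y is the pivot by which its forms are divided. The [rees] clause covers every possible later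
    centre V inside W; [theta] retains the projections used so far, so that all generators of A
    transform well at once. *)
Definition chart A W y (theta : 'End(E)) : Prop :=
  [/\ is_subring A, isproj W theta, y != 0 /\ y \in W, lfr W y `<=` A
    & (forall V rho, unitv C ord0 \in V -> (V <= W)%VS -> isproj V rho -> rho y = 0 ->
        A `<=` rees (rho \o theta)%VF A (lfr V y)) /\
      (forall U, bidual U -> (ann U <= W)%VS -> y \notin ann U -> A `<=` point_infty U)].

Lemma chart_ipow A W y theta V g k : chart A W y theta ->
  unitv C ord0 \in V -> (V <= W)%VS -> y \notin V -> A g -> vge V k%:Z g ->
  ipow A (lfr V y) k g.
Proof.
move=> [hA Wth [y0 yW] WA [reesA _]] V0 VW yV Ag vg.
have [rho Vrho rhoy] := isproj_ex yV.
apply: (rees_ipow V0 (isproj_comp VW Vrho Wth)) => //; last exact: reesA.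
by move=> _ [v vV <-]; apply: WA; apply: lfr_in; apply: (subvP VW).
Qed.

Lemma chart_base i : chart (subring_span (lfr fullv (unitv C i))) fullv (unitv C i) \1%VF.
Proof.
have hA := subring_span_subring (lfr fullv (unitv C i)).
have y0 : unitv C i != 0.
  by apply/eqP => /matrixP/(_ ord0 i)/eqP; rewrite !mxE !eqxx oner_eq0.
split=> //.
- by split=> w; rewrite ?memvf // lfunE.
- by rewrite y0 memvf.
- exact: sub_subring_span.
- split=> [V rho V0 _ Vrho rhoy|U Ubi _ yU].
    have -> : (rho \o \1 = rho)%VF by apply/lfunP => w; rewrite !lfunE /= lfunE.
    apply: subring_span_sub; first exact: rees_subring.
    move=> _ [v _ <-]; apply: (rees_lfr (W := fullv)) => //; rewrite ?memvf //.
      by move=> w _; rewrite memvf.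
    exact: sub_subring_span.
  apply: subring_span_sub; first exact: point_subring.
  by move=> _ [v _ <-]; apply: lfr_point.
Qed.

(** For V1 inside V the composite [rho1 \o rho] is a projection onto V1 that kills y, so the old
    generators are controlled by V1/y, and V1/y = (z/y)(V1/z) lies in the ideal of the new chart.
    The new generators v/z are handled by [rees_lfr]. *)
Lemma chart_step A W y theta V z : chart A W y theta ->
  unitv C ord0 \in V -> (V <= W)%VS -> y \notin V -> z \in V -> z != 0 ->
  exists theta', chart (subring_span (A `|` lfr V z)) V z theta'.
Proof.
move=> [hA Wth [y0 yW] WA [reesA pointA]] V0 VW yV zV z0.
have [rho Vrho rhoy] := isproj_ex yV; exists (rho \o theta)%VF.
set A' := subring_span _; have hA' : is_subring A' := subring_span_subring _.
have AA' : A `<=` A' by move=> x Ax; apply: sub_subring_span; left.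
have VA' : lfr V z `<=` A' by move=> x Vx; apply: sub_subring_span; right.
split=> //; first exact: isproj_comp Wth.
split=> [V1 rho1 V10 V1V V1rho rho1z|U Ubi UV zU].
  have e : (rho1 \o (rho \o theta) = (rho1 \o rho) \o theta)%VF by rewrite comp_lfunA.
  have V1r := isproj_comp V1V V1rho Vrho.
  have V1W := subv_trans V1V VW.
  have V1rt := isproj_comp V1W V1r Wth.
  apply: subring_span_sub; first exact: rees_subring.
  move=> x [Ax|[v vV <-]].
    rewrite e; apply: (@rees_sub _ A (lfr V1 y)) => //; last first.
      by apply: reesA => //; rewrite lfunE /= rhoy linear0.
    move=> _ [v vV1 <-].
    have -> : afr v / afr y = (afr z / afr y) * (afr v / afr z).
      by rewrite [RHS]mulrC mulrA divfK ?afr_eq0.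
    apply: ipowA => //; last by apply: ipow_gen => //; apply: lfr_in.
    by apply: AA'; apply: WA; apply: lfr_in; apply: (subvP VW).
  have Vid w : w \in V -> (rho1 \o (rho \o theta))%VF w = rho1 w.
    move=> wV; rewrite !lfunE /=; have [_ thid] := Wth; have [_ rid] := Vrho.
    by rewrite lfunE /= thid ?rid // (subvP VW).
  apply: (rees_lfr (V := V1) (W := V)) => //.
  - by rewrite e.
  - by rewrite Vid.
  - by move=> w wV; rewrite Vid //; apply: (subvP V1V); case: V1rho.
apply: subring_span_sub; first exact: point_subring.
move=> x [Ax|[v vV <-]]; last exact: lfr_point.
apply: (pointA U) => //; first exact: subv_trans VW.
by apply: contra yV => /(subvP UV).
Qed.

End Stalks.

(** * Blowing up the flats *)

Section ArrangementTheory.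
Variables (C : numFieldType) (r n : nat) (l : 'I_n -> 'rV[C]_r).
Local Notation E := 'rV[C]_r.+1.
Implicit Types (F G H : {set 'I_n}) (v : 'cV[C]_r) (w y : E).

Lemma hypP i v : reflect (l i *m v = 0) (v \in hyp l i).
Proof. by rewrite memv_ker lfunE; apply: eqP. Qed.

Lemma LFP F v : reflect (forall i, i \in F -> v \in hyp l i) (v \in LF l F).
Proof.
rewrite memvE; apply: (iffP subv_bigcapP) => h i /h; by rewrite -memvE.
Qed.

Definition lrow i : E := \row_k coords 0 (fun j => l i ord0 j) k.

Lemma pairing_lrow i v : pairing (lrow i) v = (l i *m v) ord0 ord0.
Proof.
by rewrite mxE; apply: eq_bigr => j _; rewrite mxE /coords liftK.
Qed.

Lemma lrow_ann F i : i \in F -> lrow i \in ann (LF l F).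
Proof.
move=> iF; apply/annP => v /LFP/(_ i iF)/hypP e.
by rewrite pairing_lrow e mxE.
Qed.

Lemma bidual_LF F : bidual (LF l F).
Proof.
move=> v h; apply/LFP => i iF; apply/hypP/matrixP => a b.
by rewrite !ord1 -pairing_lrow h ?lrow_ann // mxE.
Qed.

Lemma ann_LF F w : w \in ann (LF l F) -> exists c : 'I_n -> C,
  w = w ord0 ord0 *: unitv C ord0 + \sum_(i in F) c i *: lrow i.
Proof.
move=> wF; pose B : 'M[C]_(n, r) := \matrix_(i, j) (if i \in F then l i ord0 j else 0).
pose w' : 'rV[C]_r := \row_j w ord0 (lift ord0 j).
have /submxP[c ce] : (w' <= B)%MS.
  rewrite submxE; apply/eqP/rowP => k; rewrite mxE [RHS]mxE.
  transitivity (pairing w (col k (cokermx B))).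
    by apply: eq_bigr => j _; rewrite [col _ _ _ _]mxE [w' _ _]mxE.
  apply: (annP _ _ wF); apply/LFP => i iF; apply/hypP/matrixP => a b.
  rewrite !ord1 mxE [RHS]mxE.
  have := congr1 (fun A : 'M_(n, r) => A i k) (mulmx_coker B).
  rewrite /= mxE [RHS]mxE => e; rewrite -[RHS]e.
  by apply: eq_bigr => j _; rewrite ![col _ _ _ _]mxE [B i j]mxE iF.
exists (fun i => c ord0 i); apply/rowP => k; rewrite !mxE summxE.
have [j ->|->] := unliftP ord0 k; last first.
  rewrite eqxx mulr1 big1 ?addr0 // => i _.
  by rewrite !mxE /coords unlift_none mulr0.
rewrite andbF mulr0 add0r.
have /rowP/(_ j) := ce; rewrite !mxE => ->; rewrite [RHS]big_mkcond /=.
by apply: eq_bigr => i _; rewrite !mxE /coords liftK; case: ifP => //; rewrite mulr0.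
Qed.

Lemma ann_LF_subv F G : (ann (LF l F) <= ann (LF l G))%VS = (LF l G <= LF l F)%VS.
Proof.
apply/subvP/subvP => [h v vG|h w /annP wF].
  by apply: bidual_LF => w /h/annP; apply.
by apply/annP => v /h; apply: wF.
Qed.

Lemma ann_neq0 (U : {vspace 'cV[C]_r}) w : w \notin ann U -> U != 0%VS.
Proof.
apply: contraNneq => ->; apply/annP => v; rewrite memv0 => /eqP->; exact: linear0.
Qed.

Lemma ann_proper (U : {vspace 'cV[C]_r}) : U != 0%VS -> exists w, w \notin ann U.
Proof.
move=> U0; have vU := memv_pick U.
have : vpick U != 0 by rewrite vpick0.
case/cV0Pn => j vj; exists (unitv C (lift ord0 j)).
apply/negP => /annP/(_ _ vU); rewrite /pairing (bigD1 j) //= big1 => [|k kj].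
  by rewrite mxE !eqxx mul1r addr0 => /eqP; rewrite (negbTE vj).
by rewrite mxE (inj_eq lift_inj) (negbTE kj) andbF mul0r.
Qed.

Definition cl F : {set 'I_n} := [set j | (LF l F <= hyp l j)%VS].

Lemma LF_cl F : LF l (cl F) = LF l F.
Proof.
apply/vspaceP => v; apply/LFP/LFP => h i iF.
  by apply: h; rewrite inE; apply/subvP => u /LFP; apply.
by move: iF; rewrite inE => /subvP; apply; apply/LFP.
Qed.

Lemma flat_cl F : flat l (cl F).
Proof. by apply/forallP => j; rewrite LF_cl; apply/implyP; rewrite inE. Qed.

Lemma flat_clE F : flat l F -> F = cl F.
Proof.
move=> /forallP h; apply/setP => j; rewrite inE; apply/idP/idP => [jF|/(implyP (h j))//].
by apply/subvP => v /LFP; apply.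
Qed.

Lemma LF_inj F G : flat l F -> flat l G -> LF l F = LF l G -> F = G.
Proof. by move=> /flat_clE-> /flat_clE->; rewrite !LF_cl /cl => ->. Qed.

Lemma proper_flat_neq0 F : proper_flat l F -> LF l F != 0%VS.
Proof.
case/andP=> /flat_clE fF; apply: contraNneq => e; rewrite fF; apply/eqP/setP => j.
by rewrite !inE e sub0v.
Qed.

Hypothesis hl : (\bigcap_(j < n) hyp l j)%VS = 0%VS.

Lemma neq0_proper_flat F : flat l F -> LF l F != 0%VS -> proper_flat l F.
Proof.
move=> fF F0; rewrite /proper_flat fF; apply: contraNneq F0 => ->.
by rewrite -hl /LF; apply/eqP/eq_bigl => j; rewrite inE.
Qed.

Lemma proper_cl F w : w \notin ann (LF l F) -> proper_flat l (cl F).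
Proof.
by move=> /ann_neq0 F0; apply: neq0_proper_flat (flat_cl F) _; rewrite LF_cl.
Qed.

End ArrangementTheory.

(** * Ideals of centres in the local rings of charts *)

Section ChartLocal.
Variables (C : numFieldType) (r : nat).
Local Notation E := 'rV[C]_r.+1.
Local Notation K := (ratfun C r).
Local Notation fr := (@emb C r).
Implicit Types (A P S T : set K) (U : {vspace 'cV[C]_r}) (V W : {vspace E}) (y z : E).

Lemma ipow_dvd A T S k g x : is_subring S -> A `<=` S -> x != 0 ->
  (forall t, T t -> S (t / x)) -> ipow A T k g -> S (g / x ^+ k).
Proof.
move=> hS AS x0 TS; elim=> {k g} [a Aa|k|k a b _ IHa _ IHb|k t a Tt _ IH].
- by rewrite expr0 divr1; apply: AS.
- by rewrite mul0r; apply: subring0.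
- by rewrite mulrDl; apply: subringD.
- by rewrite exprS -mulf_div; apply: subringM => //; apply: TS.
Qed.

Lemma ipow_maxid A T P k a : is_local P -> A `<=` P -> T `<=` maxid P ->
  ipow A T k.+1 a -> maxid P a.
Proof.
move=> [hP PD] AP TP; have TP' : T `<=` P by move=> t /TP[].
have key j b : ipow A T j b -> P b.
  elim=> {j b} [b Ab|j|j b c _ IHb _ IHc|j t b Tt _ IH].
  - exact: AP.
  - exact: subring0.
  - exact: subringD.
  - by apply: subringM => //; apply: TP'.
move E: k.+1 => m ip; elim: ip k E => {m a} // [m k _|m a b _ IHa _ IHb k e|m t a Tt ia _ k _].
- exact: maxid0.
- by apply: PD; [apply: IHa e | apply: IHb e].
- by rewrite mulrC; apply: maxidM => //; [apply: key ia | apply: TP].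
Qed.

Section Key.
Variables (A P : set K) (W : {vspace E}) (y : E) (theta : 'End(E)).
Hypotheses (hchart : chart A W y theta) (hloc : is_loc A P).
Variable U : {vspace 'cV[C]_r}.
Hypotheses (Ubi : bidual U) (UW : (ann U <= W)%VS).

Let V0 : unitv C ord0 \in ann U := unitv0_ann U.

(** Denominators of P are units at the generic point of P(U), hence have order 0, and the statement
    for the chart carries over. *)
Lemma chart_loc_ipow g k : y \notin ann U -> P `<=` point_infty U -> P g ->
  vge (ann U) k%:Z g -> ipow P (lfr (ann U) y) k g.
Proof.
move=> yU PZ Pg vg; have [AP hP locP] := hloc.
have [a [d [Aa Ad ud ge]]] := locP g Pg.
have /unit_point -/(_ Ubi) := sub_unit_in PZ ud.
case=> _ d0 nd; have vd : vge (ann U) 0 d by right; rewrite nd.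
have ga : a = g * d by rewrite ge divfK.
have va : vge (ann U) k%:Z a by rewrite ga -[k%:Z]addr0; apply: vgeM.
have ia := chart_ipow hchart V0 UW yU Aa va.
rewrite ge mulrC; apply: ipowA => //; first by case: ud.
by apply: ipow_sub ia => // t Tt; apply: ipow_gen.
Qed.

(* The converse of the fact that the ideal of a centre through [P] lies in    *)
(* the maximal ideal of [P].                                                  *)
Lemma chart_maxid_sub : is_local P -> lfr (ann U) y `<=` maxid P -> P `<=` point_infty U.
Proof.
move=> lP TP; have [AP hP locP] := hloc.
have [hA Wth [y0 yW] WA [_ pointA]] := hchart.
have yU : y \notin ann U.
  apply/negP => yU; apply: (maxid1 hP); rewrite -(divff (_ : afr y != 0)) ?afr_eq0 //.
  by apply: TP; apply: lfr_in.
have AZ := pointA U Ubi UW yU; have hZ := point_subring Ubi.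
move=> g /locP[a [d [Aa Ad ud ->]]]; apply: subringM => //; first exact: AZ.
have d0 : d != 0 by case: ud.
have Zd := AZ d Ad; apply: point_inv => //.
have := vge_neq0 d0 (point_sub Ubi Zd) => nd; apply/eqP; rewrite eq_le nd andbT.
(* A denominator of positive order would lie in the ideal of the centre, hence in the maximal ideal
   of P, although it is a unit. *)
rewrite leNgt; apply/negP => nd'.
have vd : vge (ann U) 1%N%:Z d by right; rewrite -gtz0_ge1.
have := ipow_maxid lP AP TP (chart_ipow hchart V0 UW yU Ad vd).
by case=> _; apply.
Qed.

End Key.

End ChartLocal.

(** * The invariant of the successive blow-ups *)

Section Stages.
Variables (C : numFieldType) (r n : nat) (l : 'I_n -> 'rV[C]_r).
Local Notation E := 'rV[C]_r.+1.
Local Notation K := (ratfun C r).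
Local Notation fr := (@emb C r).
Local Notation LF := (LF l).
Implicit Types (F G H : {set 'I_n}) (P S : set K) (X : set (set K)) (s : seq {set 'I_n}).

Hypothesis hl : (\bigcap_(j < n) hyp l j)%VS = 0%VS.

(** The invariant at a point P while the flats of s remain to be blown up. A remaining strict
    transform through P has its equations in W and avoids the pivot; conversely a flat with
    equations in W all of whose ratios to y vanish at P is still waiting in s, so the earlier
    centres have been moved away from P. *)
Definition stage s P : Prop := exists A W y theta,
  [/\ chart A W y theta, is_loc A P, is_local P,
      forall F, F \in s -> P `<=` point_infty (LF F) ->
        (ann (LF F) <= W)%VS /\ y \notin ann (LF F)
    & forall H, proper_flat l H -> (ann (LF H) <= W)%VS ->
        lfr (ann (LF H)) y `<=` maxid P -> H \in s].

Lemma proj_completion_loc P : proj_completion P -> exists i,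
  is_loc (subring_span (lfr fullv (unitv C i))) P /\ is_local P.
Proof.
move=> [I [hI pI [i Ii ->]]]; exists i; split; last exact: proj_stalk_local.
have [hA _ [y0 _] WA _] := @chart_base C r i.
set A := subring_span _ in hA WA *.
have ye : afr (unitv C i) = fr (hcoord C i) by rewrite /afr aff_unitv.
have hP := proj_stalk_subring pI.
have Xi : ('X_i : {mpoly C[r.+1]}) \is 1.-homog by rewrite dhomogX /= mdeg1.
have AP : A `<=` proj_stalk I.
  apply: subring_span_sub => // _ [v _ <-].
  rewrite /afr -!dehomp_linform; apply: (ratio_stalk (linform_homog _) (linform_homog _)).
  by rewrite linform_unitv.
have y1 : afr (unitv C i) != 0 by rewrite afr_eq0.
split=> // x [d [G [H [hG hH IH ->]]]].
have H0 := stalk_neq0 pI hH IH; have yd := expf_neq0 d y1.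
have e : afr (unitv C i) ^+ d = fr (dehomp ('X_i ^+ d)).
  by rewrite rmorphXn rmorphXn /= -linform_unitv dehomp_linform.
have hX : ('X_i ^+ d : {mpoly C[r.+1]}) \is d.-homog.
  by rewrite -[d in d.-homog]mul1n; apply: dhomogMn.
have IXn : ~ I ('X_i ^+ d).
  have [_ I1 IM] := pI.
  elim: {e hX yd hG hH} d => [|d IHd]; first by rewrite expr0.
  by rewrite exprS => h; case: (IM _ _ Logic.I Logic.I h).
have span N : N \is d.-homog -> A (fr (dehomp N) / afr (unitv C i) ^+ d).
  by move=> hN; rewrite ye; apply: homog_in_span.
exists (fr (dehomp G) / afr (unitv C i) ^+ d), (fr (dehomp H) / afr (unitv C i) ^+ d).
split; [exact: span | exact: span | |].
- rewrite e in yd *; split; first exact: div_neq0 H0 yd.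
    exact: ratio_stalk hX IXn.
  by rewrite invf_div; apply: ratio_stalk hH IH.
- by rewrite !dehomE invf_div mulrA (divfK yd).
Qed.

Lemma nu_lfr_notin (U : {vspace 'cV[C]_r}) v y : y \in ann U -> y != 0 ->
  v \notin ann U -> ~ vge (ann U) 0 (afr v / afr y).
Proof.
move=> yU y0 vU; have V0 := unitv0_ann U.
have v1 : afr v != 0 by rewrite afr_eq0 (notin_neq0 vU).
have y1 : afr y != 0 by rewrite afr_eq0.
move/(vge_neq0 (div_neq0 v1 y1)); rewrite (nu_div V0 v1 y1).
by rewrite nu_afr_notin // nu_afr_in.
Qed.

Lemma stage_base s P : (forall F, proper_flat l F = (F \in s)) ->
  proj_completion P -> stage s P.
Proof.
move=> hs /proj_completion_loc[i [loc lP]].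
have cb := @chart_base C r i; have [hA _ [y0 _] WA _] := cb; have [AP hP _] := loc.
exists (subring_span (lfr fullv (unitv C i))), fullv, (unitv C i), \1%VF; split=> //.
- move=> F Fs PZ; rewrite subvf; split=> //; apply/negP => yF.
  have /ann_proper[w wF] := proper_flat_neq0 (etrans (hs F) Fs).
  apply: (nu_lfr_notin yF y0 wF); apply: point_sub (@bidual_LF C r n l F) _ _.
  by apply: PZ; apply: AP; apply: WA; apply: lfr_in; rewrite memvf.
- by move=> H; rewrite hs.
Qed.

Section Step.
Variables (X : set (set K)) (G : {set 'I_n}) (s : seq {set 'I_n}).
Hypothesis X_stage : forall P, X P -> stage (G :: s) P.
Local Notation Z := (point_infty (LF G)).
Local Notation V := (ann (LF G)).

Let Gbi : bidual (LF G) := @bidual_LF C r n l G.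

(** On the centre, its ideal is generated by the v/y with v in V, so one of these can replace the
    pivot x, and S localizes the chart of [chart_step]. The order by dimension then gives the two
    conditions on flats. *)
Lemma blowup_stage S : uniq (G :: s) -> (forall F, F \in G :: s -> proper_flat l F) ->
    (forall F, F \in s -> (\dim (LF G) <= \dim (LF F))%N) ->
  blowup X Z S -> stage s S.
Proof.
move=> /= /andP[Gs us] prop dims [P [x [q [XP Ix x0 qP Se]]]].
set B := subring_span _ in qP Se.
have hB : is_subring B := subring_span_subring _.
have lS : is_local S by rewrite Se; apply: localization_local.
have locBS : is_loc B S by rewrite Se; apply: is_loc_localization.
have [BS hS locB] := locBS.
have PB : P `<=` B by move=> f Pf; apply: sub_subring_span; left.
have PS : P `<=` S by apply: subset_trans BS.
have [A [W [y [theta [ch loc lP Rm D]]]]] := X_stage XP.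
have [AP hP locA] := loc; have [hA Wth [y0 yW] WA _] := ch.
have y1 : afr y != 0 by rewrite afr_eq0.
(* Off the centre x is a unit of S, so S is a localization of P and the chart of P serves again. *)
have [PZ|PZ] := EM (P `<=` Z); last first.
  have ux : unit_in S x.
    split; [exact: x0 | by apply: PS; case: Ix |].
    apply: BS; apply: sub_subring_span; right; exists 1; rewrite ?div1r //.
    by rewrite ideal_at_nsub //; apply: subring1.
  have locP : is_loc P S.
    apply: (is_loc_unit locBS hP PS _ ux); first by case: Ix.
    have [Px _] := Ix; apply: (blowup_span_form hP _ Px x0).
    by move=> f [].
  exists A, W, y, theta; split=> //; first exact: is_loc_trans locP.
    by move=> F Fs SZ; apply: Rm; [rewrite inE Fs orbT | apply: subset_trans SZ].
  move=> H pH VW TS.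
  have TP : lfr (ann (LF H)) y `<=` maxid P.
    move=> t Tt; apply: (sub_maxid PS) (TS t Tt); apply: AP; apply: WA.
    by case: Tt => v vH <-; apply: lfr_in; apply: (subvP VW).
  (* H is not the centre: [chart_maxid_sub] would put P on it. *)
  have := D H pH VW TP; rewrite inE => /orP[/eqP He|//]; case: PZ.
  by rewrite He in VW TP; apply: (chart_maxid_sub ch loc Gbi VW lP TP).
have [VW yV] := Rm G (mem_head _ _) PZ.
set T := lfr V y.
have TW t : T t -> P t.
  by move=> [v vV <-]; apply: AP; apply: WA; apply: lfr_in; apply: (subvP VW).
have Tm t : T t -> maxid Z t by move=> [v vV <-]; apply: lfr_maxid.
have TI t : T t -> S (t / x).
  move=> Tt; apply: BS; apply: sub_subring_span; right; exists t => //.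
  by rewrite ideal_at_sub //; split; [apply: TW | apply: Tm].
have I_ipow f : ideal_at Z P f -> ipow P T 1 f.
  rewrite ideal_at_sub // => -[Pf /(maxid_point Gbi)[_ vf]].
  exact: (chart_loc_ipow ch loc Gbi VW yV PZ Pf).
(* x is a combination of elements of T over P. If every t/x were in the maximal ideal of S, then so
   would be x/x = 1. *)
have [z zV uz] : exists2 z, z \in V & unit_in S (afr z / afr y / x).
  apply: contrapT => nex; apply: (maxid1 hS).
  have {nex} Tmx t : T t -> maxid S (t / x).
    move=> Tt; split; first exact: TI.
    by move=> ut; apply: nex; case: Tt ut => v vV <- ut; exists v.
  rewrite -(divff x0); move: {1 2}x (I_ipow _ Ix) => f; move E: 1%N => k ip.
  elim: ip E => {k f} [//|k _|k a b _ IHa _ IHb e|k t a Tt ia _ [e]].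
  - by rewrite mul0r; apply: maxid0.
  - by rewrite mulrDl; case: lS => _; apply; [apply: IHa | apply: IHb].
  - rewrite -e in ia; rewrite mulrAC mulrC; apply: maxidM (Tmx _ Tt) => //.
    by apply: PS; apply: ipow0 ia.
have z0 : z != 0.
  by case: uz => + _ _; apply: contraNneq => ->; rewrite /afr linear0 emb0 !mul0r.
have z1 : afr z != 0 by rewrite afr_eq0.
have zy : A (afr z / afr y) by apply: WA; apply: lfr_in; apply: (subvP VW).
have zy0 := div_neq0 z1 y1.
have [theta' ch'] := chart_step ch (unitv0_ann _) VW yV zV z0.
set A' := subring_span _ in ch'; have [hA' _ _ VA' _] := ch'.
have AA' : A `<=` A' by move=> f Af; apply: sub_subring_span; left.
have vzE v : afr v / afr y / (afr z / afr y) = afr v / afr z.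
  by rewrite invf_div mulrA (divfK y1).
have A'S : A' `<=` S.
  apply: subring_span_sub => // f [/AP/PS //|[v vV <-]].
  have -> : afr v / afr z = (afr v / afr y / x) / (afr z / afr y / x).
    by rewrite invf_div mulrA (divfK x0) vzE.
  apply: subringM => //; last by case: uz.
  by apply: TI; apply: lfr_in.
(* As z/y and x differ by a unit of S, the chart B with pivot x consists of fractions of A' with
   denominators invertible in S, and both charts have the localization S. *)
have hQ := fractions_in_subring hA' hS; have A'Q := sub_fractions_in hA' hS.
set Q := fractions_in A' S in hQ A'Q.
have PQ : P `<=` Q.
  move=> f /locA[a [d [Aa Ad ud ->]]]; exists a, d.
  by split; [exact: AA' | exact: AA' | exact: sub_unit_in PS ud |].
have IQ f : ideal_at Z P f -> Q (f / (afr z / afr y)).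
  move/I_ipow => ip; rewrite -[_ / afr y]expr1; apply: (ipow_dvd hQ PQ zy0 _ ip).
  by move=> _ [v vV <-]; rewrite vzE; apply: A'Q; apply: VA'; apply: lfr_in.
have BQ : B `<=` Q.
  apply: subring_span_sub => // f [/PQ //|[g Ig <-]].
  have -> : g / x = g / (afr z / afr y) * (x / (afr z / afr y))^-1.
    by rewrite [(x / _)^-1]invf_div mulrA (divfK zy0).
  apply: subringM => //; first exact: IQ.
  apply: (fractions_in_inv A'S hS); first exact: IQ.
  by have := unit_inV uz; rewrite [_^-1]invf_div.
have locA' : is_loc A' S.
  split=> // f /locB[a [d [/BQ Ba /BQ Bd ud ->]]].
  by apply: (subringM hQ Ba); apply: fractions_in_inv.
exists A', V, z, theta'; split=> //.
- move=> F Fs SZ; have FGs : F \in G :: s by rewrite inE Fs orbT.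
  have PZF := subset_trans PS SZ; have [FW yF] := Rm F FGs PZF.
  have Fbi := @bidual_LF C r n l F.
  (* The forms whose ratio to y vanishes at P. They are closed under linear combinations and contain
     the annihilators of L_F and L_G, hence that of their intersection L_H; y is not among them. *)
  pose M := [set w | w \in W /\ maxid P (afr w / afr y)].
  have MZ F' : P `<=` point_infty (LF F') -> (ann (LF F') <= W)%VS ->
      y \notin ann (LF F') -> {in ann (LF F'), forall w, M w}.
    move=> PZ' F'W yF' w wF'; have wW := subvP F'W _ wF'; split=> //.
    apply: (sub_maxid PZ'); first by apply: AP; apply: WA; apply: lfr_in.
    by apply: lfr_maxid => //; apply: bidual_LF.
  have MF := MZ F PZF FW yF; have MG := MZ G PZ VW yV.
  have ML c v w : M v -> M w -> M (c *: v + w).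
    move=> [vW mv] [wW mw]; split; first by rewrite memvD ?memvZ.
    rewrite afrD mulrDl; case: lP => _; apply => //.
    rewrite afrZ -mulrA; apply: maxidM => //.
    by apply: AP; apply: WA; apply: lfr_const.
  have M0 : M 0 by apply: MF; rewrite mem0v.
  pose H := cl l (F :|: G).
  have MH w : w \in ann (LF H) -> M w.
    rewrite LF_cl => /ann_LF[c ->]; apply: (ML); first by apply: MF; apply: unitv0_ann.
    rewrite -[X in M X]addr0; apply: (big_ind (fun w => M (w + 0))) => [|u v|i].
    + by rewrite addr0.
    + by rewrite !addr0 => Mu Mv; rewrite -[u]scale1r; apply: (ML).
    + rewrite inE => /orP[iF|iG]; apply: (ML) => //.
        exact/MF/lrow_ann.
      exact/MG/lrow_ann.
  have yH : y \notin ann (LF H).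
    apply/negP => /MH[_]; rewrite (divff y1); exact: maxid1.
  have pH : proper_flat l H by apply: (proper_cl hl (w := y)); rewrite -LF_cl.
  have HGs : H \in G :: s.
    apply: D => //; first by apply/subvP => w /MH[].
    by move=> _ [w /MH[_ mw] <-].
  have HG : (LF H <= LF G)%VS.
    rewrite LF_cl; apply/subvP => v /LFP h; apply/LFP => i iG.
    by apply: h; rewrite inE iG orbT.
  have HF : (LF H <= LF F)%VS.
    rewrite LF_cl; apply/subvP => v /LFP h; apply/LFP => i iF.
    by apply: h; rewrite inE iF.
  (* H is G or comes after it, so its space is at least as large; being inside L_G it equals L_G,
     and L_G is contained in L_F. *)
  have dimGH : (\dim (LF G) <= \dim (LF H))%N.
    by move: HGs; rewrite inE => /orP[/eqP->|/dims].
  have GH : LF H = LF G by apply/eqP; rewrite eqEdim HG.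
  have GF : (LF G <= LF F)%VS by rewrite -GH.
  have FG : (ann (LF F) <= V)%VS by rewrite ann_LF_subv.
  (* If z vanished on L_F, the inclusion of S in O_F would make every v/z with v in V have
     nonnegative order, so V would vanish on L_F and F would be G. *)
  split=> //; apply/negP => zF.
  have : (V <= ann (LF F))%VS.
    apply/subvP => v vV; apply/negPn/negP => vF; apply: (nu_lfr_notin zF z0 vF).
    by apply: (point_sub Fbi); apply: SZ; apply: A'S; apply: VA'; apply: lfr_in.
  rewrite ann_LF_subv => FG'; case/negP: Gs; suff -> : G = F by [].
  apply: (@LF_inj C r n l).
  + by have := prop G (mem_head _ _) => /andP[].
  + by have := prop F FGs => /andP[].
  + by apply/eqP; rewrite eqEsubv GF.
- move=> H pH HV TS.
  have HW := subv_trans HV VW.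
  have TP : lfr (ann (LF H)) y `<=` maxid P.
    move=> _ [v vH <-]; apply: (sub_maxid PS).
      by apply: AP; apply: WA; apply: lfr_in; apply: (subvP HW).
    have -> : afr v / afr y = (afr z / afr y) * (afr v / afr z).
      by rewrite -vzE [RHS]mulrC (divfK zy0).
    by apply: maxidM => //; [apply: A'S; apply: AA' | apply: TS; apply: lfr_in].
  (* H = G would put z/z = 1 in the maximal ideal of S. *)
  have := D H pH HW TP; rewrite inE => /orP[/eqP He|//].
  by case: (maxid1 hS); rewrite -(divff z1); apply: TS; rewrite He; apply: lfr_in.
Qed.

End Step.

End Stages.

(** * Classification of the discrete valuation rings *)

Section Classification.
Variables (C : numFieldType) (r n : nat) (l : 'I_n -> 'rV[C]_r).
Local Notation E := 'rV[C]_r.+1.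
Local Notation K := (ratfun C r).
Local Notation fr := (@emb C r).
Local Notation LF := (LF l).
Local Notation Z F := (point_infty (LF F)).
Local Notation V F := (ann (LF F)).
Local Notation O F := (vge (ann (LF F)) 0).
Implicit Types (F G H : {set 'I_n}) (P S : set K) (X : set (set K)) (s : seq {set 'I_n}).

Hypothesis hl : (\bigcap_(j < n) hyp l j)%VS = 0%VS.

Let V0 F : unitv C ord0 \in V F := unitv0_ann (LF F).
Let bi F : bidual (LF F) := @bidual_LF C r n l F.

Lemma vge_maximal S p F w : is_subring S -> uniformizer S p ->
  w \notin V F -> S `<=` O F -> S = O F.
Proof.
move=> hS pS wF SO; symmetry.
apply: (uniformizer_maximal hS pS (vge0_subring (V0 F)) _ SO).
by exists (afr w); apply: vge0_proper.
Qed.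

Definition classified S : Prop :=
  (forall g, S (fr g)) \/ exists2 F, proper_flat l F & S = O F.

(** If 1/y is a unit of S then S contains all affine forms. Otherwise 1/y lies in the maximal ideal,
    so S is centred on the hyperplane at infinity and is contained in its valuation ring. *)
Lemma classified_base P S p : proj_completion P -> is_loc P S -> uniformizer S p ->
  classified S.
Proof.
move=> /proj_completion_loc[i [loc lP]] locS pS.
have cb := @chart_base C r i; have [hA _ [y0 _] WA _] := cb.
have {}loc := is_loc_trans hA loc locS; have [AS hS _] := loc.
have lS := uniformizer_local hS pS.
set y := unitv C i in cb hA WA loc AS y0.
have y1 : afr y != 0 by rewrite afr_eq0.
have Sv v : S (afr v / afr y) by apply: AS; apply: WA; apply: lfr_in; apply: memvf.
have [uy|Ny] := EM (unit_in S (afr (unitv C ord0) / afr y)).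
  left; have Sy : S (afr y) by case: uy => _ _; rewrite afr0 div1r invrK.
  have Saff v : S (afr v) by rewrite -[afr v](divfK y1); apply: subringM.
  apply: (mpoly_ring_ind (P := fun g => S (fr g))) => [c|j|g h|g h].
  - have -> : fr c%:MP = afr (c *: unitv C ord0).
      by rewrite /afr linearZ /= aff0 alg_mpolyC.
    exact: Saff.
  - by have := Saff (unitv C (lift ord0 j)); rewrite /afr aff_lift.
  - by rewrite embD; apply: subringD.
  - by rewrite embM; apply: subringM.
(* The closure of the empty set is the flat with L_F = L, and P(L_F) is the whole hyperplane at
   infinity. *)
right; pose F := cl l finset.set0.
have LT : LF F = fullv.
  by rewrite LF_cl; apply/vspaceP => v; rewrite memvf; apply/LFP => j; rewrite inE.
have TS : lfr (V F) y `<=` maxid S.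
  move=> _ [v vF <-]; have vE : v = v ord0 ord0 *: unitv C ord0.
    apply/rowP => k; rewrite !mxE /=; have [j ->|->] := unliftP ord0 k; last by rewrite mulr1.
    rewrite mulr0; move: vF; rewrite LT => /annP/(_ (delta_mx j ord0) (memvf _)).
    rewrite /pairing (bigD1 j) //= big1 => [|a aj].
      by rewrite mxE !eqxx mulr1 addr0.
    by rewrite mxE (negbTE aj) mulr0.
  rewrite vE afrZ -mulrA; apply: maxidM (conj (Sv _) Ny) => //.
  by apply: AS; apply: WA; apply: lfr_const => //; apply: memvf.
have SZ := chart_maxid_sub cb loc (@bi F) (subvf _) lS TS.
have yF : y \notin V F.
  apply/negP => yF; apply: (maxid1 hS); rewrite -(divff y1).
  by apply: TS; apply: lfr_in.
have pF : proper_flat l F by apply: (proper_cl hl (w := y)); rewrite -LF_cl.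
exists F => //; apply: (vge_maximal hS pS yF).
by apply: subset_trans (point_sub (@bi F)).
Qed.

(** The statement is about rings localizing a point because, when the pivot x is a unit of S, S only
    localizes the point Q below. When x is not a unit, orders for [nu (V G)] control divisibility by
    powers of x in S, and S is forced into O_G. *)
Lemma classified_step X G s S P p : proper_flat l G ->
    (forall P, X P -> stage l (G :: s) P) ->
    (forall P S p, X P -> is_loc P S -> uniformizer S p -> classified S) ->
  blowup X (Z G) P -> is_loc P S -> uniformizer S p -> classified S.
Proof.
move=> pG Xst Xcl [Q [x [q [XQ Ix x0 qP ->]]]] locS pS.
set B := subring_span _ in qP locS.
have hB : is_subring B := subring_span_subring _.
have {}locS : is_loc B S := is_loc_trans hB (is_loc_localization hB qP) locS.
have [BS hS locB] := locS; have lS := uniformizer_local hS pS.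
have QB : Q `<=` B by move=> f Pf; apply: sub_subring_span; left.
have QS := subset_trans QB BS.
have [A [W [y [theta [ch loc lQ Rm D]]]]] := Xst Q XQ.
have [AQ hQ locA] := loc; have [hA Wth [y0 yW] WA _] := ch.
have [Qx _] := Ix.
have [ux|Nux] := EM (unit_in S x).
  apply: (Xcl Q S p XQ _ pS); apply: (is_loc_unit locS hQ QS Qx ux).
  by apply: (blowup_span_form hQ _ Qx x0) => f [].
have QZ : Q `<=` Z G.
  apply: contrapT => QZ; apply: Nux; split; [exact: x0 | exact: QS |].
  apply: BS; apply: sub_subring_span; right; exists 1; rewrite ?div1r //.
  by rewrite ideal_at_nsub //; apply: subring1.
have mx : maxid S x by split; first exact: QS.
have [VW yV] := Rm G (mem_head _ _) QZ.
have IE f : ideal_at (Z G) Q f <-> Q f /\ vge (V G) 1 f.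
  rewrite ideal_at_sub //; split=> -[Qf].
    by case/(maxid_point (@bi G)) => _ vf.
  by move=> vf; split=> //; apply/(maxid_point (@bi G)); split=> //; apply: QZ.
have [_ vx] := (IE x).1 Ix.
pose Y : set K := [set b | exists k h, [/\ Q h, vge (V G) k%:Z h & b = h / x ^+ k]].
have up k j h : Q h -> vge (V G) k%:Z h ->
    [/\ Q (h * x ^+ j), vge (V G) (k + j)%N%:Z (h * x ^+ j)
      & h / x ^+ k = (h * x ^+ j) / x ^+ (k + j)].
  move=> Qh vh; split.
  - by apply: subringM => //; apply: subringX.
  - rewrite PoszD; apply: vgeM => //; elim: j => [|j IHj].
      by rewrite expr0; right; rewrite nu1.
    by rewrite exprSr -addn1 PoszD; apply: vgeM.
  - by rewrite exprD invfM mulrA mulrAC mulfK ?expf_neq0 // mulrC.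
have BY : B `<=` Y.
  apply: subring_span_sub; last first.
    move=> f [Qf|[g /IE[Qg vg] <-]]; last by exists 1%N, g; rewrite expr1.
    exists 0%N, f; rewrite expr0 divr1; split=> //.
    exact: point_sub (@bi G) _ (QZ _ Qf).
  split.
  - exists 0%N, 1; rewrite expr0 divr1; split; [exact: subring1 | by right; rewrite nu1 | by []].
  - move=> _ _ [k [h [Qh vh ->]]] [j [g [Qg vg ->]]].
    have [Qh' vh' ->] := up k j h Qh vh; have [Qg' vg' ->] := up j k g Qg vg.
    rewrite [(j + k)%N]addnC in vg' *.
    exists (k + j)%N, (h * x ^+ j - g * x ^+ k); rewrite mulrBl; split=> //.
      exact: subringB.
    by apply: vgeD => //; apply: vgeN.
  - move=> _ _ [k [h [Qh vh ->]]] [j [g [Qg vg ->]]].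
    exists (k + j)%N, (h * g); rewrite mulf_div -exprD PoszD; split=> //.
      exact: subringM.
    exact: vgeM.
(* This is where the filtration by order is known to be the filtration by powers of the ideal, whose
   generators are divisible by x in S. *)
have dvd g k : Q g -> vge (V G) k%:Z g -> S (g / x ^+ k).
  move=> Qg vg; have := chart_loc_ipow ch loc (@bi G) VW yV QZ Qg vg.
  apply: ipow_dvd => // _ [v vG <-]; apply: BS; apply: sub_subring_span; right.
  exists (afr v / afr y) => //; apply/IE; split.
    by apply: AQ; apply: WA; apply: lfr_in; apply: (subvP VW).
  by case: ((maxid_point (@bi G) _).1 (lfr_maxid (@bi G) yV vG)).
suff SO : S `<=` O G by right; exists G => //; apply: (vge_maximal hS pS yV SO).
move=> _ /locB[a [d [/BY[k [h [Qh vh ->]]] /BY[j [g [Qg vg de]]] ud ->]]].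
have [Qh' vh' ->] := up k j h Qh vh; have [Qg' vg' de'] := up j k g Qg vg.
rewrite [(j + k)%N]addnC in vg' de'; rewrite {}de {}de' in ud *.
move: (h * x ^+ j) (g * x ^+ k) (k + j)%N Qh' vh' Qg' vg' ud => {h g k j Qh vh Qg vg}.
move=> h g m Qh vh Qg vg ud.
have xm : x ^+ m != 0 by apply: expf_neq0.
have g0 : g != 0 by case: ud => + _ _; apply: contraNneq => ->; rewrite mul0r.
have [->|h0] := eqVneq h 0; first by rewrite !mul0r; left.
(* A larger order would make g/x^m = (g/x^(m+1)) x a multiple of the non-unit x. *)
have ng : nu (V G) g = m.
  apply/eqP; rewrite eq_le (vge_neq0 g0 vg) andbT leNgt; apply/negP => lt.
  have vg' : vge (V G) m.+1%:Z g by right; rewrite -addn1 PoszD lezD1.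
  case: (maxid_unit (_ : maxid S (g / x ^+ m)) ud).
  have -> : g / x ^+ m = (g / x ^+ m.+1) * x.
    by rewrite exprSr invfM mulrA (divfK x0).
  by apply: maxidM => //; apply: dvd.
right; rewrite invf_div mulrA (divfK xm) (nu_div (V0 G) h0 g0) ng subr_ge0.
exact: vge_neq0.
Qed.

End Classification.

(** * Prime divisors of the affine space L *)

Lemma div_pow_cancel (F : fieldType) (a b c d : F) : a != 0 -> b != 0 ->
  a * c / (b * d) / (a / b) = c / d.
Proof. by move=> a0 b0; rewrite -(mulf_div a b c d) mulrAC divff ?mul1r ?div_neq0. Qed.

Section PrimeStalks.
Variables (C : numFieldType) (r : nat).
Local Notation M := {mpoly C[r]}.
Local Notation N := {mpoly C[r.+1]}.
Local Notation K := (ratfun C r).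
Local Notation fr := (@emb C r).
Implicit Types (f g h : M) (G H : N).

Lemma mpoly_multiplicity (p g : M) : prime_elt p -> g != 0 ->
  exists k h, g = p ^+ k * h /\ ~ divides p h.
Proof.
move=> pp g0; have [m] := mpoly_factorial g0.
elim: m g g0 => [|m IHm] g g0 gm.
  exists 0%N, g; rewrite expr0 mul1r; split=> // -[c e].
  by move: gm; rewrite e mulrC => /(factors_in_cancel pp)[].
have [[c e]|Np] := EM (divides p g); last by exists 0%N, g; rewrite expr0 mul1r.
have c0 : c != 0 by apply: contraNneq g0 => c0; rewrite e c0 mul0r.
move: gm; rewrite e mulrC => /(factors_in_cancel pp)[j [<-]] /(IHm _ c0)[k [h [ce ph]]].
by exists k.+1, h; rewrite {1}ce mulrA -exprS.
Qed.

Definition prime_stalk (p : M) : set K :=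
  [set f | exists g h, ~ divides p h /\ f = fr g / fr h].

Lemma ndivides_neq0 (p h : M) : ~ divides p h -> h != 0.
Proof. by apply: contra_notN => /eqP->; exists 0; rewrite mul0r. Qed.

Lemma sub_prime_stalk (p g : M) : prime_elt p -> prime_stalk p (fr g).
Proof.
move=> pp; exists g, 1; rewrite emb1 divr1; split=> //.
by apply: prime_elt_unit => //; apply: unitr1.
Qed.

Lemma prime_stalk_subring p : prime_elt p -> is_subring (prime_stalk p).
Proof.
move=> pp; have [_ _ pM] := pp.
have ndM h h' : ~ divides p h -> ~ divides p h' -> ~ divides p (h * h').
  by move=> ph ph' /pM[].
split.
- by rewrite -(emb1 C r); apply: sub_prime_stalk.
- move=> _ _ [g [h [ph ->]]] [g' [h' [ph' ->]]].
  have h0 : fr h != 0 by rewrite emb_eq0; apply: ndivides_neq0 ph.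
  have h'0 : fr h' != 0 by rewrite emb_eq0; apply: ndivides_neq0 ph'.
  exists (g * h' - g' * h), (h * h'); split; first exact: ndM.
  by rewrite -mulNr (addf_div _ _ h0 h'0) embB !embM mulNr.
- move=> _ _ [g [h [ph ->]]] [g' [h' [ph' ->]]].
  by exists (g * g'), (h * h'); split; [exact: ndM | rewrite mulf_div !embM].
Qed.

Lemma uniformizer_prime_stalk p : prime_elt p -> uniformizer (prime_stalk p) (fr p).
Proof.
move=> pp; have [p0 pN pM] := pp; have hS := prime_stalk_subring pp.
have unit g h : ~ divides p g -> ~ divides p h -> unit_in (prime_stalk p) (fr g / fr h).
  move=> pg ph; split.
  - by apply: div_neq0; rewrite emb_eq0; apply: ndivides_neq0; eassumption.
  - by exists g, h.
  - by rewrite invf_div; exists h, g.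
have frp0 : fr p != 0 by rewrite emb_eq0.
split=> //.
  split; first exact: sub_prime_stalk.
  case=> _ _ [g [h [ph e]]]; apply: (ph); exists g.
  have h0 : fr h != 0 by rewrite emb_eq0; apply: ndivides_neq0 ph.
  apply/eqP; rewrite -emb_eq embM -[fr g](divfK h0) -e mulrAC mulVf //.
  by rewrite mul1r.
move=> x x0; have [[nn d] [/= d0 xe]] := ratfun_emb x.
have n0 : nn != 0 by apply: contraNneq x0 => e; rewrite xe e emb0 mul0r.
have [k [h [ne ph]]] := mpoly_multiplicity pp n0.
have [j [g [de pg]]] := mpoly_multiplicity pp d0.
exists (k%:Z - j%:Z).
have -> : x / fr p ^ (k%:Z - j%:Z) = fr h / fr g; last exact: unit.
have g0 : fr g != 0 by rewrite emb_eq0; apply: ndivides_neq0 pg.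
have pk := expf_neq0 k frp0; have pj := expf_neq0 j frp0.
rewrite xe ne de !embM !rmorphXn expfzDr // -invr_expz -!exprnP.
exact: (div_pow_cancel (fr h) (fr g) pk pj).
Qed.

(** The prime factors of the denominator are cancelled one at a time: regularity at p forces p to
    divide the numerator. *)
Lemma prime_stalk_range (f : K) : (forall p, prime_elt p -> prime_stalk p f) ->
  exists g, f = fr g.
Proof.
have [[nn d] [/= d0 ->]] := ratfun_emb f; have [k dk] := mpoly_factorial d0.
move: nn; apply: (factors_in_ind (P := fun d => forall m,
  (forall p, prime_elt p -> prime_stalk p (fr m / fr d)) ->
  exists g, fr m / fr d = fr g) _ _ dk) => {k d d0 dk f} [u uu m _|p d pp d0 IH m h].
  exists (m * u^-1); rewrite embM; congr (_ * _).
  by rewrite -[LHS]mul1r -(emb1 C r) -(mulVr uu) embM mulfK // emb_eq0; apply: contraTneq uu => ->; rewrite unitr0.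
have [p0 pN pM] := pp; have [g [h' [ph' e]]] := h p pp.
have frp0 : fr p != 0 by rewrite emb_eq0.
have frd0 : fr d != 0 by rewrite emb_eq0.
have h'0 : fr h' != 0 by rewrite emb_eq0; apply: ndivides_neq0 ph'.
have : divides p (m * h').
  exists (g * d); apply/eqP; rewrite -emb_eq !embM; move/eqP: e.
  rewrite embM (eqr_div _ _ (mulf_neq0 frp0 frd0) h'0) => /eqP->.
  by rewrite mulrCA mulrC.
case/pM => // -[c me].
have ce : fr m / fr (p * d) = fr c / fr d.
  by rewrite me !embM [fr c * _]mulrC -mulf_div (divff frp0) mul1r.
by rewrite ce; apply: IH => q qq; rewrite -ce; apply: h.
Qed.

(* [hompart G] is [G (t, t x_1, ..., t x_r)].                                 *)
Fact hompart_key : unit. Proof. exact: tt. Qed.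

Definition hompart : N -> {poly M} := locked_with hompart_key
  (mmap (polyC \o @mpolyC r C) (fun i => hcoord C i *: 'X)).

Lemma hompartE G : hompart G = mmap (polyC \o @mpolyC r C) (fun i => hcoord C i *: 'X) G.
Proof. by rewrite /hompart unlock. Qed.

Fact hompart_is_zmod_morphism : zmod_morphism hompart.
Proof. by move=> G H; rewrite !hompartE rmorphB. Qed.

Fact hompart_is_monoid_morphism : monoid_morphism hompart.
Proof. by split=> [|G H]; rewrite !hompartE ?rmorph1 ?rmorphM. Qed.

HB.instance Definition _ :=
  GRing.isZmodMorphism.Build N {poly M} hompart hompart_is_zmod_morphism.
HB.instance Definition _ :=
  GRing.isMonoidMorphism.Build N {poly M} hompart hompart_is_monoid_morphism.

Lemma hompart0 : hompart 0 = 0. Proof. exact: rmorph0. Qed.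
Lemma hompartD : {morph hompart : G H / G + H}. Proof. exact: rmorphD. Qed.
Lemma hompartM : {morph hompart : G H / G * H}. Proof. exact: rmorphM. Qed.

Lemma hompart_coef G d : (hompart G)`_d = dehomp (pihomog mdeg d G).
Proof.
elim/mpolyind: G => [|c m G _ _ IHG].
  by rewrite hompart0 pihomog0 dehomp0 coef0.
rewrite hompartD coefD IHG pihomogD dehompD; congr (_ + _).
rewrite hompartE mmapZ mmapX linearZ /= dehompZ pihomogX coefCM; congr (_ * _).
have -> : mmap1 (fun i => hcoord C i *: 'X) m = (\prod_i hcoord C i ^+ m i) *: 'X^(mdeg m).
  rewrite /mmap1 mdegE (big_morph _ (exprD 'X) (expr0 _)) -mul_polyC rmorph_prod -big_split /=.
  by apply: eq_bigr => i _; rewrite -mul_polyC exprMn rmorphXn.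
rewrite coefZ coefXn eq_sym; case: eqP => _; last by rewrite mulr0 dehomp0.
by rewrite mulr1 dehompX.
Qed.

Lemma homogenize f d : (msize f <= d.+1)%N -> exists2 G, G \is d.-homog & dehomp G = f.
Proof.
move=> sf; pose t (m : 'X_{1..r}) : 'X_{1..r.+1} := [multinom coords (d - mdeg m)%N m i | i < r.+1].
exists (\sum_(m <- msupp f) f@_m *: 'X_[t m]).
  rewrite big_seq; apply: rpred_sum => m /msize_mdeg_lt mf; apply: dhomogZ.
  rewrite dhomogX /= mdegE big_ord_recl mnmE /coords unlift_none /=.
  under eq_bigr => i _ do rewrite mnmE /coords liftK /=.
  by rewrite -mdegE subnK // -ltnS (leq_trans mf).
rewrite raddf_sum [RHS]mpolyE; apply: eq_bigr => m _ /=.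
rewrite dehompZ mul_mpolyC dehompX; congr (_ *: _).
rewrite big_ord_recl hcoord0 expr1n mul1r mpolyXE_id; apply: eq_bigr => j _.
by rewrite hcoord_lift mnmE /coords liftK.
Qed.

(** The homogeneous prime is that of the closure of p = 0: the G such that p divides the
    dehomogenization of each homogeneous component. It is prime because p remains prime in
    polynomials in t, and it avoids ['X_ord0], which dehomogenizes to 1. *)
Lemma prime_stalk_proj p : prime_elt p -> proj_completion (prime_stalk p).
Proof.
move=> pp; have [p0 pN pM] := pp; have pd i : divides p 0 by exists 0; rewrite mul0r.
have [_ _ PM] := prime_eltC pp.
pose P : set N := [set G | divides p%:P (hompart G)].
have PE G : P G <-> forall d, divides p (dehomp (pihomog mdeg d G)).
  by rewrite /P /= (dividesCP _ p0); split=> h d; have := h d; rewrite hompart_coef.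
have Phom d H : H \is d.-homog -> P H <-> divides p (dehomp H).
  move=> hH; rewrite PE; split=> [/(_ d)|h k]; first by rewrite pihomog_dE.
  have [<-|dk] := eqVneq d k; first by rewrite pihomog_dE.
  by rewrite (pihomog_ne0 dk hH) dehomp0; exists 0; rewrite mul0r.
have PI : is_ideal_in setT P.
  split=> //.
  - by exists 0; rewrite hompart0 mul0r.
  - by move=> G H [c ce] [c' ce']; exists (c + c'); rewrite hompartD ce ce' mulrDl.
  - by move=> G H _ [c ce]; exists (hompart G * c); rewrite hompartM ce mulrA.
have N1 : ~ divides p 1 by apply: prime_elt_unit => //; apply: unitr1.
exists P; split.
- split=> // G d /PE h; apply/(Phom d); first exact: pihomogP.
  exact: h.
- split=> //.
    by move=> /(Phom 0%N 1 (dhomog1 _ _)); rewrite dehomp1.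
  by move=> G H _ _; rewrite /P /= hompartM; apply: PM.
- exists ord0; rewrite (Phom 1%N) ?dhomogX /= ?mdeg1 //.
  by rewrite -linform_unitv dehomp_linform aff0.
- apply/seteqP; split=> [_ [g [h [ph ->]]]|_ [d [G [H [hG hH PH ->]]]]].
    have [G hG <-] := homogenize (leq_trans (leq_maxl (msize g) (msize h)) (leqnSn _)).
    have [H hH He] := homogenize (leq_trans (leq_maxr (msize g) (msize h)) (leqnSn _)).
    rewrite -He in ph *; apply: (ratio_stalk hG hH).
    by move/(Phom _ _ hH).
  by exists (dehomp G), (dehomp H); rewrite !dehomE; split=> // /(Phom _ _ hH).
Qed.

End PrimeStalks.

(** * Divisors and sections of the wonderful variety *)

Section Wonderful.
Variables (C : numFieldType) (r n : nat) (l : 'I_n -> 'rV[C]_r).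
Local Notation E := 'rV[C]_r.+1.
Local Notation M := {mpoly C[r]}.
Local Notation K := (ratfun C r).
Local Notation fr := (@emb C r).
Local Notation LF := (LF l).
Local Notation Z F := (point_infty (LF F)).
Local Notation V F := (ann (LF F)).
Local Notation O F := (vge (ann (LF F)) 0).
Implicit Types (F G H : {set 'I_n}) (P S : set K) (X : set (set K)) (s : seq {set 'I_n}).

Let V0 F : unitv C ord0 \in V F := unitv0_ann (LF F).
Let bi F : bidual (LF F) := @bidual_LF C r n l F.

Lemma point_sub_ann F G : G \in [pred G | proper_flat l G] -> Z F `<=` Z G ->
  (V G <= V F)%VS.
Proof.
move=> pG ZFG; have [v vG] := ann_proper (proper_flat_neq0 pG).
apply/subvP => z zG; apply/negPn/negP => zF.
apply: (nu_lfr_notin zG (notin_neq0 zF) vG); apply: (point_sub (@bi G)).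
exact: (ZFG _ (lfr_point v zF)).
Qed.

Lemma proj_completion_point F : proper_flat l F -> proj_completion (Z F).
Proof.
move=> pF; have [w wF] := ann_proper (proper_flat_neq0 pF).
exists (ideal_infty (LF F)); split=> //.
- exact: ideal_infty_hom.
- exact: ideal_infty_prime.
- apply: contrapT => nex; case/negP: wF; rewrite [w]row_sum_delta; apply: rpred_sum => i _.
  apply: memvZ; apply/linform_infty; rewrite linform_unitv.
  by apply: contrapT => ni; apply: nex; exists i.
Qed.

Lemma point_proper F : proper_flat l F -> exists y, ~ Z F y.
Proof.
move=> pF; have [w wF] := ann_proper (proper_flat_neq0 pF); exists (afr w).
by move/(point_sub (@bi F)); apply: vge0_proper.
Qed.

(* The exceptional divisor over [P(L_F)] is found in the chart of the         *)
(* blow-up of the point [Z F] given by the pivot [1 / afr z].                 *)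
Lemma vge_blowup X F : proper_flat l F -> X (Z F) -> blowup X (Z F) (O F).
Proof.
move=> pF XF; have [z zF] := ann_proper (proper_flat_neq0 pF).
have z1 : afr z != 0 by rewrite afr_eq0 (notin_neq0 zF).
have zV1 : (afr z)^-1 != 0 by rewrite invr_eq0.
have hZ := point_subring (@bi F); have lZ := point_local (@bi F).
have nz : nu (V F) (afr z) = -1 by apply: nu_afr_notin.
have IE f : ideal_at (Z F) (Z F) f <-> maxid (Z F) f.
  by rewrite ideal_at_sub //; split=> [[]|mf]; [|split=> //; case: mf].
have mz : maxid (Z F) (afr z)^-1.
  by have := lfr_maxid (@bi F) zF (V0 F); rewrite afr0 div1r.
have [B BE] : exists B, B = subring_span (Z F `|` [set y / (afr z)^-1 | y in ideal_at (Z F) (Z F)]).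
  by eexists.
have hB : is_subring B by rewrite BE; apply: subring_span_subring.
have hO := vge0_subring (V0 F).
have ZB : Z F `<=` B by move=> f Zf; rewrite BE; apply: sub_subring_span; left.
have mB f : maxid (Z F) f -> B (f * afr z).
  move=> mf; rewrite BE; apply: sub_subring_span; right; exists f; last by rewrite invrK.
  exact/IE.
have BO : B `<=` O F.
  rewrite BE; apply: subring_span_sub => // f [/(point_sub (@bi F)) //|[g /IE mg <-]].
  have [_ vg] := (maxid_point (@bi F) g).1 mg; rewrite invrK.
  have vz : vge (V F) (-1) (afr z) by right; rewrite nz.
  by have := vgeM (V0 F) vg vz; rewrite subrr.
(* The prime of the chart at which O_F appears is the centre of the valuation on B. *)
pose q : set K := [set f | B f /\ vge (V F) 1 f].
have qP : is_prime_in B q.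
  split.
  - split; first by move=> f [].
    + by split; [apply: subring0 | left].
    + by move=> f g [Bf vf] [Bg vg]; split; [exact: (subringD hB Bf Bg) | exact: (vgeD (V0 F) vf vg)].
    + move=> f g Bf [Bg vg]; split; first exact: (subringM hB Bf Bg).
      by have := vgeM (V0 F) (BO f Bf) vg; rewrite add0r.
  - by case=> _ [/eqP|]; rewrite ?oner_eq0 // nu1.
  - move=> f g Bf Bg [_ vfg].
    have [->|f0] := eqVneq f 0; first by left; split; [apply: subring0 | left].
    have [->|g0] := eqVneq g 0; first by right; split; [apply: subring0 | left].
    have vf := vge_neq0 f0 (BO f Bf); have vg := vge_neq0 g0 (BO g Bg).
    have := vge_neq0 (mulf_neq0 f0 g0) vfg; rewrite (nuM (V0 F) f0 g0) => h.
    have [nf|nf] := eqVneq (nu (V F) f) 0.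
      by right; split=> //; right; rewrite nf add0r in h.
    by left; split=> //; right; rewrite -gtz0_ge1 lt_neqAle eq_sym nf.
exists (Z F), (afr z)^-1, q; cbv zeta; rewrite -BE; split=> //; first exact/IE.
have q0 : q 0 by split; [exact: subring0 hB | left].
(* Each form not in V is paid for by one factor 1/z, while a form w of V is already in B, as w/z
   lies in the ideal of the centre and is divided by the pivot 1/z. *)
have filB a g : fil (V F) a g -> B (fr g / afr z ^+ a).
  have Bzv v : B (afr v / afr z) by apply: ZB; apply: lfr_point.
  have Bz a' : B ((afr z ^+ a')^-1).
    by rewrite -exprVn; apply: subringX => //; apply: ZB; case: mz.
  elim=> {a g} [a c|a g h _ IHg _ IHh|a w g wV _ IH|a w g _ IH].
  - apply: subringM => //; apply: ZB.
    have -> : fr c%:MP = afr (c *: z) / afr z.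
      by rewrite afrZ (mulfK z1).
    exact: lfr_point.
  - by rewrite embD mulrDl; apply: subringD.
  - rewrite embM -mulrA; apply: subringM => //.
    by rewrite -[fr (aff w)](divfK z1); apply: mB; apply: lfr_maxid.
  - by rewrite embM exprS -mulf_div; apply: subringM => //; apply: Bzv.
apply/seteqP; split=> [f vf|_ [b [d [Bb Bd qd ->]]]]; last first.
  have d0 : d != 0 by apply: contra_notN qd => /eqP->; exact: q0.
  have [->|b0] := eqVneq b 0; first by left; rewrite mul0r.
  right; rewrite (nu_div (V0 F) b0 d0).
  suff -> : nu (V F) d = 0 by rewrite subr0; apply: vge_neq0 (BO b Bb).
  apply/eqP; rewrite eq_le (vge_neq0 d0 (BO d Bd)) andbT leNgt.
  by apply/negP => h; apply: qd; split=> //; right; rewrite -gtz0_ge1.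
have [[m d] [/= d0 fe]] := ratfun_emb f.
have za := expf_neq0 (dg (V F) d) z1.
exists (fr m / afr z ^+ dg (V F) d), (fr d / afr z ^+ dg (V F) d); split.
- apply: filB; apply/(dgE (V0 F)); have [m0|m0] := eqVneq m 0.
    by rewrite m0 -mpolyC0 dgC.
  have f0 : f != 0 by rewrite fe; apply: div_neq0; rewrite emb_eq0.
  by have := vge_neq0 f0 vf; rewrite fe (nu_frac (V0 F) m0 d0) subr_ge0 lez_nat.
- by apply: filB; apply/(dgE (V0 F)).
- case=> _ /vge_neq0; rewrite div_neq0 ?emb_eq0 // => /(_ isT).
  have fd0 : fr d != 0 by rewrite emb_eq0.
  rewrite (nu_div (V0 F) fd0 za) nu_fr // (nuX (V0 F)) // nz.
  by rewrite mulNrn opprK natz addNr.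
- by rewrite invf_div mulrA (divfK za).
Qed.

Lemma wonderful_rcons s F : wonderful l (rcons s F) = blowup (wonderful l s) (Z F).
Proof. by rewrite /wonderful map_rcons foldl_rcons. Qed.

Lemma wonderful_subring s P : wonderful l s P -> is_subring P.
Proof.
elim/last_ind: s P => [|s F IHs] P; first by case=> I [_ pI _ ->]; apply: proj_stalk_subring.
by rewrite wonderful_rcons => /(blowup_local IHs)[].
Qed.

Lemma wonderful_cat_dvr s1 s2 S p : {in s2, forall F, proper_flat l F} ->
  wonderful l s1 S -> uniformizer S p -> wonderful l (s1 ++ s2) S.
Proof.
move=> ps2 s1S pS; have hS := wonderful_subring s1S.
elim/last_ind: s2 ps2 => [|s2 F IHs] ps2; first by rewrite cats0.
rewrite -rcons_cat wonderful_rcons; apply: (blowup_uniformizer _ hS pS).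
- by apply: IHs => G Gs; apply: ps2; rewrite mem_rcons inE Gs orbT.
- exact: point_subring.
- by apply: point_proper; apply: ps2; rewrite mem_rcons mem_head.
Qed.

Section Order.
Hypothesis hl : (\bigcap_(j < n) hyp l j)%VS = 0%VS.
Variable s : seq {set 'I_n}.
Hypothesis hs : blowup_order l s.

Lemma mem_order F : (F \in s) = proper_flat l F.
Proof. by have [/perm_mem-> _] := hs; rewrite mem_filter mem_enum andbT. Qed.

Lemma uniq_order : uniq s.
Proof. by have [/perm_uniq-> _] := hs; rewrite filter_uniq // enum_uniq. Qed.

Lemma dim_order s1 G s2 : s = s1 ++ G :: s2 ->
  {in s1, forall F, (\dim (LF F) <= \dim (LF G))%N} /\
  {in s2, forall F, (\dim (LF G) <= \dim (LF F))%N}.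
Proof.
have [_ +] := hs; move=> + se; rewrite se sorted_pairwise ?map_cat /=; last exact: leq_trans.
rewrite pairwise_cat allrel_consr pairwise_cons => /and4P[/andP[h1 _] _ h2 _].
split=> F Fs; [apply: (allP h1) | apply: (allP h2)]; exact: map_f.
Qed.

Lemma wonderful_stage s1 s2 P : s = s1 ++ s2 -> wonderful l s1 P -> stage l s2 P.
Proof.
elim/last_ind: s1 s2 P => [|s1 G IHs] s2 P se.
  by move=> h; apply: stage_base => // F; rewrite -mem_order se.
rewrite cat_rcons in se; rewrite wonderful_rcons.
apply: (blowup_stage hl (X := wonderful l s1)).
- by move=> Q; apply: IHs.
- by have := uniq_order; rewrite se cat_uniq => /and3P[].
- by move=> F Fs; rewrite -mem_order se mem_cat Fs orbT.
- by have [_ h] := dim_order se.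
Qed.

Lemma wonderful_classified s1 s2 P S p : s = s1 ++ s2 -> wonderful l s1 P ->
  is_loc P S -> uniformizer S p -> classified l S.
Proof.
elim/last_ind: s1 s2 P S p => [|s1 G IHs] s2 P S p se.
  by move=> h; apply: classified_base h.
rewrite cat_rcons in se; rewrite wonderful_rcons.
apply: (classified_step (X := wonderful l s1) (s := s2)).
- by rewrite -mem_order se mem_cat mem_head orbT.
- by move=> Q; apply: wonderful_stage.
- by move=> Q S' p'; apply: IHs se.
Qed.

Lemma prime_divisor_classified s1 s2 S : s = s1 ++ s2 ->
  prime_divisor (wonderful l s1) S -> classified l S.
Proof.
move=> se [s1S [p pS]]; apply: (wonderful_classified se s1S _ pS).
exact/is_loc_refl/(wonderful_subring s1S).
Qed.

(** An earlier centre through this point would have L_F inside L_G, but L_G has at most the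
    dimension of L_F, so the flats would coincide. The point is therefore off all earlier
    centres. *)
Lemma wonderful_point s1 F s2 : s = s1 ++ F :: s2 -> wonderful l s1 (Z F).
Proof.
move=> se; have pF : proper_flat l F by rewrite -mem_order se mem_cat mem_head orbT.
have [dF _] := dim_order se; have us := uniq_order.
have Fs1 : F \notin s1.
  by apply: contraTN us => Fs; rewrite se cat_uniq /= Fs andbF.
have ps1 G : G \in s1 -> proper_flat l G by move=> Gs; rewrite -mem_order se mem_cat Gs.
elim/last_ind: s1 {se us} dF Fs1 ps1 => [|s1 G IHs] dF Fs1 ps1.
  exact: proj_completion_point.
rewrite mem_rcons inE negb_or in Fs1; have [FG Fs1'] := andP Fs1.
rewrite wonderful_rcons; apply: blowup_nsub; last 1 first.
- have Gs : G \in rcons s1 G by rewrite mem_rcons mem_head.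
  move=> /(point_sub_ann (ps1 G Gs)); rewrite ann_LF_subv => h; case/eqP: FG.
  apply: (@LF_inj C r n l); [by case/andP: pF | by case/andP: (ps1 G Gs) |].
  by apply/eqP; rewrite eqEdim h dF.
- apply: IHs => // H Hs; [apply: dF | apply: ps1]; by rewrite mem_rcons inE Hs orbT.
- exact: point_local.
Qed.

Lemma vge_wonderful s1 F s2 : s = s1 ++ F :: s2 -> wonderful l (rcons s1 F) (O F).
Proof.
move=> se; rewrite wonderful_rcons; apply: vge_blowup; last exact: wonderful_point se.
by rewrite -mem_order se mem_cat mem_head orbT.
Qed.

Lemma uniformizer_vge F : proper_flat l F -> exists p, uniformizer (O F) p.
Proof.
move=> pF; have [w wF] := ann_proper (proper_flat_neq0 pF).
by exists (afr w)^-1; apply: uniformizer_vge0.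
Qed.

Lemma order_split F : proper_flat l F -> exists s1 s2,
  s = s1 ++ F :: s2 /\ take (index F s).+1 s = rcons s1 F.
Proof.
rewrite -mem_order => Fs; have := uniq_order.
case/splitPr: {-1}_ / Fs (erefl s) => s1 s2 se us.
exists s1, s2; split=> //; have Fs1 : F \notin s1.
  by apply: contraTN us => Fs; rewrite cat_uniq /= Fs andbF.
rewrite index_cat (negbTE Fs1) /= eqxx addn0 -cat_rcons take_size_cat // size_rcons.
by [].
Qed.

(** For z not in V_F, domination puts 1/z in the maximal ideal, so S does not contain all
    polynomials and is some O_H. Positivity of [nu (V H)] on the v/z with v in V_F and on the 1/v
    with v outside V_F gives V_F = V_H. *)
Lemma is_DP F S : proper_flat l F -> is_D l s F S <-> S = O F.
Proof.
move=> pF; have [s1 [s2 [se te]]] := order_split pF.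
rewrite /is_D te; split=> [[pS [ZS mS]]|->]; last first.
  split; first by split; [apply: vge_wonderful se | apply: uniformizer_vge].
  split; first exact: point_sub.
  by move=> f /(maxid_point (@bi F))[_ vf]; apply/(maxid_vge0 (V0 F)).
have [s1S [p upS]] := pS; have hS := wonderful_subring s1S.
have [z zF] := ann_proper (proper_flat_neq0 pF).
have z1 : afr z != 0 by rewrite afr_eq0 (notin_neq0 zF).
have mzv v : v \in V F -> maxid S (afr v / afr z) by move=> vF; apply/mS/lfr_maxid.
have mz : maxid S (afr z)^-1 by have := mzv _ (V0 F); rewrite afr0 div1r.
rewrite -cat_rcons in se.
have [Sfr|[H pH SO]] := prime_divisor_classified se pS.
  case: mz => Sz []; split; rewrite ?invr_eq0 ?invrK //; exact: Sfr.
suff HF : V F = V H by rewrite SO HF.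
have nzH f : f != 0 -> maxid S f -> 1 <= nu (V H) f.
  by move=> f0; rewrite SO => /(maxid_vge0 (V0 H)); apply: vge_neq0.
have zH : nu (V H) (afr z) <= -1.
  have := nzH _ (_ : (afr z)^-1 != 0) mz; rewrite invr_eq0 => /(_ z1).
  by rewrite (nuV (V0 H) z1); lia.
apply/eqP; rewrite eqEsubv; apply/andP; split; apply/subvP => v.
  move=> vF; have [->|v0] := eqVneq v 0; first exact: mem0v.
  have v1 : afr v != 0 by rewrite afr_eq0.
  have h1 := nu_afr_ge (V0 H) (notin_neq0 zF).
  apply/negPn/negP => vH; have := nzH _ (div_neq0 v1 z1) (mzv v vF).
  by rewrite (nu_div (V0 H) v1 z1) (nu_afr_notin (V0 H) vH); lia.
move=> vH; apply/negPn/negP => vF.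
have v1 : afr v != 0 by rewrite afr_eq0 (notin_neq0 vF).
have mv : maxid S (afr v)^-1.
  by have := mS _ (lfr_maxid (@bi F) vF (V0 F)); rewrite afr0 div1r.
have := nzH _ (_ : (afr v)^-1 != 0) mv; rewrite invr_eq0 => /(_ v1).
by rewrite (nuV (V0 H) v1) nu_afr_in // (notin_neq0 vF).
Qed.

Lemma vge_inj F G : proper_flat l F -> proper_flat l G -> O F = O G -> F = G.
Proof.
move=> pF pG FG; have key F' G' : O F' = O G' -> (V F' <= V G')%VS.
  move=> e; apply/subvP => v vF; apply/negPn/negP => /(vge0_proper (V0 G')); apply.
  rewrite -e; have [->|v0] := eqVneq v 0; first by left; rewrite /afr linear0 emb0.
  by right; rewrite nu_afr_in.
have [/andP[fF _] /andP[fG _]] := conj pF pG.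
apply: (LF_inj fF fG); apply/eqP; rewrite eqEsubv -!ann_LF_subv.
by apply/andP; split; apply: (key); [exact: esym FG | exact: FG].
Qed.

Variable a : {set 'I_n} -> int.

Lemma divD_vge F : proper_flat l F -> divD l s a (O F) = a F.
Proof.
move=> pF; rewrite /divD (big_pred1 F) // => G /=.
apply/andP/eqP => [[pG /asboolP/(is_DP _ pG)/esym/(vge_inj pG pF)//]|->].
by split=> //; apply/asboolP/is_DP.
Qed.

Lemma divD_affine S : (forall g, S (fr g)) -> divD l s a S = 0.
Proof.
move=> Sfr; rewrite /divD big_pred0 // => F; apply/negP => /andP[pF].
move=> /asboolP/(is_DP _ pF) SO; have [w wF] := ann_proper (proper_flat_neq0 pF).
by apply: (vge0_proper (V0 F) wF); rewrite -SO; apply: Sfr.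
Qed.

(** The prime stalks have coefficient 0, so they force f to be a polynomial; along O_F the order is
    minus the degree and the coefficient is a_F. Conversely the classification leaves no other
    condition. *)
Lemma H0P (f : K) : H0 (wonderful l s) (divD l s a) f <->
  exists g, f = fr g /\ forall F, proper_flat l F -> g != 0 -> (dg (V F) g)%:Z <= a F.
Proof.
split=> [[->|Hf]|[g [-> Hg]]].
- by exists 0; rewrite emb0 eqxx.
- have [->|f0] := eqVneq f 0; first by exists 0; rewrite emb0 eqxx.
  have [g ge] : exists g, f = fr g.
    apply: prime_stalk_range => p pp; have up := uniformizer_prime_stalk pp.
    have hS := prime_stalk_subring pp.
    have ps : prime_divisor (wonderful l s) (prime_stalk p).
      split; last by exists (fr p).
      apply: (@wonderful_cat_dvr [::] s _ (fr p)) => //; last exact: prime_stalk_proj.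
      by move=> F; rewrite mem_order.
    have := Hf _ ps; rewrite divD_affine ?addr0 => [|g]; last exact: sub_prime_stalk.
    by move/(uniformizer_sub hS up (ord_unit hS up f0)).
  exists g; split=> // F pF g0; have [w wF] := ann_proper (proper_flat_neq0 pF).
  have [s1 [s2 [se te]]] := order_split pF.
  have pO : prime_divisor (wonderful l s) (O F).
    have [p up] := uniformizer_vge pF; split; last by exists p.
    rewrite se -cat_rcons; apply: (wonderful_cat_dvr _ (vge_wonderful se) up).
    by move=> G Gs; rewrite -mem_order se mem_cat inE Gs !orbT.
  have := Hf _ pO; rewrite divD_vge // (ord_vge0 (V0 F) wF f0) ge nu_fr //; lia.
- have [->|g0] := eqVneq g 0; [by left; rewrite emb0 | right=> S pS].
  have g1 : fr g != 0 by rewrite emb_eq0.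
  have [s1S [p up]] := pS; have hS := wonderful_subring s1S.
  have [Sfr|[F pF ->]] := prime_divisor_classified (esym (cats0 s)) pS.
    by rewrite divD_affine // addr0; apply/(uniformizer_sub hS up (ord_unit hS up g1)).
  have [w wF] := ann_proper (proper_flat_neq0 pF).
  by have := Hg F pF g0; rewrite divD_vge // (ord_vge0 (V0 F) wF g1) nu_fr //; lia.
Qed.

End Order.
End Wonderful.

(** * Apolarity *)

Section Apolarity.
Variables (C : numFieldType) (r : nat).
Local Notation M := {mpoly C[r]}.
Implicit Types (f g h : M) (v : 'cV[C]_r) (I J : set M).

Lemma odotwE k f g : (msize f <= k)%N ->
  odot f g = \sum_(m : 'X_{1..r < k}) f@_m *: g^`M[m].
Proof.
move=> fk; rewrite /odot; set T : subFinType _ := 'X_{1..r < k}.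
rewrite (big_mksub T) ?msupp_uniq //=; first last.
  by move=> x /msize_mdeg_lt /leq_trans; apply.
rewrite big_rmcond //= => j /memN_msupp_eq0 ->.
by rewrite scale0r.
Qed.

Lemma odotDl f h g : odot (f + h) g = odot f g + odot h g.
Proof.
pose k := maxn (msize (f + h)) (maxn (msize f) (msize h)).
rewrite !(@odotwE k) /k ?leq_max ?leqnn ?orbT // -big_split /=.
by apply: eq_bigr => m _; rewrite mcoeffD scalerDl.
Qed.

Lemma odotZl c f g : odot (c *: f) g = c *: odot f g.
Proof.
pose k := maxn (msize (c *: f)) (msize f).
rewrite !(@odotwE k) /k ?leq_max ?leqnn ?orbT // scaler_sumr.
by apply: eq_bigr => m _; rewrite mcoeffZ scalerA.
Qed.

Lemma odot0l g : odot 0 g = 0.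
Proof. by rewrite -[X in odot X _](scale0r 0) odotZl scale0r. Qed.

Lemma odotX m g : odot 'X_[m] g = g^`M[m].
Proof. by rewrite /odot msuppX big_seq1 mcoeffX eqxx scale1r. Qed.

Fact odot_is_linear f : linear (odot f).
Proof.
move=> c g h; rewrite /odot scaler_sumr -big_split; apply: eq_bigr => m _ /=.
by rewrite linearP scalerDr !scalerA mulrC.
Qed.

HB.instance Definition _ f := GRing.isLinear.Build C M M _ (odot f) (odot_is_linear f).

Lemma odotM f h g : odot (f * h) g = odot f (odot h g).
Proof.
elim/mpolyind: f => [|c m f _ _ IHf]; first by rewrite mul0r !odot0l.
rewrite mulrDl !odotDl IHf; congr (_ + _); rewrite -scalerAl !odotZl; congr (_ *: _).
rewrite odotX; elim/mpolyind: h {IHf} => [|d m' h _ _ IHh].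
  by rewrite mulr0 !odot0l linear0.
rewrite mulrDr !odotDl IHh linearD; congr (_ + _).
by rewrite -scalerAr !odotZl -mpolyXD !odotX linearZ /= addmC mderivmDm.
Qed.

(** The apolar pairing, diagonal in the monomials with weights given by products of factorials. *)
Definition apair f g : C := (odot f g).@[fun=> 0].

Lemma meval0_coef g : g.@[fun=> 0] = g@_0%MM.
Proof.
elim/mpolyind: g => [|c m g _ _ IHg]; first by rewrite meval0 mcoeff0.
rewrite mevalD mcoeffD IHg; congr (_ + _); rewrite mevalZ mcoeffZ mcoeffX mevalX.
congr (_ * _); have [->|m0] := eqVneq m 0%MM.
  by rewrite big1 // => i _; rewrite mnm0E expr0.
have [i mi] : exists i, m i != 0%N.
  apply: contrapT => /forallNP h; case/eqP: m0; apply/mnmP => i.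
  by rewrite mnm0E; apply/eqP/negPn/negP => hi; apply: (h i).
by rewrite (bigD1 i) //= expr0n (negbTE mi) mul0r.
Qed.

Lemma apairXl m g : apair 'X_[m] g = g@_m *+ \prod_(i < r) (m i)`!.
Proof.
rewrite /apair odotX meval0_coef mcoeff_mderivm addm0; congr (_ *+ _).
by apply: eq_bigr => i _; rewrite ffactnn.
Qed.

Lemma apairwE k f g : (msize f <= k)%N ->
  apair f g = \sum_(m : 'X_{1..r < k}) f@_m * (g@_m *+ \prod_(i < r) (m i)`!).
Proof.
move=> fk; rewrite /apair (odotwE _ fk) raddf_sum; apply: eq_bigr => m _ /=.
by rewrite mevalZ -odotX -/(apair _ _) apairXl.
Qed.

Lemma prod_fact_neq0 (m : 'X_{1..r}) : (\prod_(i < r) (m i)`!)%:R != 0 :> C.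
Proof.
by rewrite pnatr_eq0 -lt0n prodn_gt0 // => i; apply: fact_gt0.
Qed.

Lemma apair_eq0 g : (forall f, apair f g = 0) -> g = 0.
Proof.
move=> h; apply/mpolyP => m; rewrite mcoeff0; move/eqP: (h 'X_[m]).
by rewrite apairXl -mulr_natr mulf_eq0 (negbTE (prod_fact_neq0 m)) orbF => /eqP.
Qed.

Lemma mcoeff_pihomog d g m : (pihomog mdeg d g)@_m = if mdeg m == d then g@_m else 0.
Proof.
elim/mpolyind: g => [|c m' g _ _ IHg]; first by rewrite pihomog0 !mcoeff0 if_same.
rewrite pihomogD !mcoeffD IHg linearZ /= pihomogX !mcoeffZ.
have -> : (if mdeg m' == d then 'X_[m'] else 0)@_m =
    if mdeg m == d then ('X_[m'] : M)@_m else 0.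
  have [->|mm] := eqVneq m' m; first by case: ifP => _; rewrite ?mcoeff0.
  by do 2!case: ifP => _; rewrite ?mcoeffX ?(negbTE mm) ?mcoeff0.
by case: ifP; rewrite ?mulr0 ?addr0.
Qed.

Lemma apair_pihomog d f g : apair f (pihomog mdeg d g) = apair (pihomog mdeg d f) g.
Proof.
pose k := maxn (msize f) (msize (pihomog mdeg d f)).
rewrite !(@apairwE k) /k ?leq_max ?leqnn ?orbT //; apply: eq_bigr => m _.
by rewrite !mcoeff_pihomog; case: ifP => //; rewrite mul0rn mul0r mulr0.
Qed.

(** A maximal independent family in J turns this predicate into the row space of a matrix, and a
    column of its cokernel separates x. *)
Lemma separate_row N (J : set 'rV[C]_N) (x : 'rV[C]_N) :
    J 0 -> (forall (c : C) (u v : 'rV[C]_N), J u -> J v -> J (c *: u + v)) -> ~ J x ->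
  exists2 c : 'cV[C]_N, (forall u, J u -> u *m c = 0) & x *m c != 0.
Proof.
move=> J0 JL Jx.
pose P k := `[< exists A : 'M[C]_(k, N), row_free A /\ forall i, J (row i A) >].
have P0 : exists k, P k.
  by exists 0%N; apply/asboolP; exists 0; split=> [|[]//]; rewrite -row_leq_rank.
have Pb k : P k -> (k <= N)%N.
  by move/asboolP=> [A [/eqP fA _]]; rewrite -fA rank_leq_col.
have [k /asboolP[A [fA JA]] kmax] := ex_maxnP P0 Pb.
have span u : (u <= A)%MS -> J u.
  move=> /submxP[c ->]; rewrite mulmx_sum_row.
  by elim/big_rec: _ => // i v _ Jv; apply: JL.
have JA' u : J u -> (u <= A)%MS.
  move=> Ju; apply/negPn/negP => uA; have : P k.+1; last by move/kmax; rewrite ltnn.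
  apply/asboolP; exists (col_mx u A); split.
    have lt : (A < u + A)%MS.
      rewrite ltmxE addsmxSr; apply: contra uA; apply: submx_trans; exact: addsmxSl.
    rewrite -row_leq_rank; have := rank_ltmx lt.
    by rewrite (eqP fA) addsmxE.
  move=> i; case: (@split_ordP 1 k i) => j ->.
    by rewrite (@rowKu _ 1 k) row_id.
  by rewrite (@rowKd _ 1 k).
have : x *m cokermx A != 0 by rewrite -submxE; apply/negP => /span.
case/rV0Pn => j xj; exists (col j (cokermx A)).
  move=> u /JA'; rewrite submxE => /eqP e.
  by rewrite colE mulmxA e mul0mx.
apply: contraNneq xj => e; have := congr1 (fun B : 'M_1 => B ord0 ord0) e.
by rewrite /= colE mulmxA -colE mxE [RHS]mxE => ->.
Qed.

Lemma pihomog_XiM d i f : pihomog mdeg d.+1 ('X_i * f) = 'X_i * pihomog mdeg d f.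
Proof.
elim/mpolyind: f => [|c m f _ _ IHf]; first by rewrite mulr0 !pihomog0 mulr0.
rewrite mulrDr !pihomogD IHf mulrDr; congr (_ + _).
rewrite -scalerAr -mpolyXD !linearZ /= !pihomogX /= mdegD mdeg1 add1n eqSS -scalerAr.
by case: ifP => _; rewrite ?mpolyXD ?mulr0.
Qed.

Lemma pihomog0_XiM i f : pihomog mdeg 0 ('X_i * f) = 0.
Proof.
elim/mpolyind: f => [|c m f _ _ IHf]; first by rewrite mulr0 pihomog0.
by rewrite mulrDr pihomogD IHf addr0 -scalerAr -mpolyXD linearZ /= pihomogX /= mdegD mdeg1 scaler0.
Qed.

Lemma ideal_span_ideal (G : set M) : is_ideal_in setT (ideal_span G).
Proof.
split=> [//|I [_ I0 _ _] _|x y Ix Iy I hI GI|x y _ Iy I hI GI]; first exact: I0.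
  by case: (hI) => _ _ ID _; apply: ID; [apply: Ix | apply: Iy].
by case: (hI) => _ _ _ IM; apply: IM => //; apply: Iy.
Qed.

Lemma sub_ideal_span (G : set M) : G `<=` ideal_span G.
Proof. by move=> x Gx I _; apply. Qed.

(** The polynomials all of whose components lie in the span form an ideal containing G; stability
    under products is checked on constants and variables. *)
Lemma ideal_span_homog (G : set M) : (forall g, G g -> exists d, g \is d.-homog) ->
  forall f d, ideal_span G f -> ideal_span G (pihomog mdeg d f).
Proof.
move=> Gh f d If; have [_ I0 ID IM] := ideal_span_ideal G.
pose J : set M := [set f | forall d, ideal_span G (pihomog mdeg d f)].
suff : J f by apply.
apply: If; last first.
  move=> g Gg k; have [e ge] := Gh g Gg; have [<-|ek] := eqVneq e k.
    by rewrite pihomog_dE //; apply: sub_ideal_span.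
  by rewrite (pihomog_ne0 ek ge).
split=> // [k|g h Jg Jh k|]; first by rewrite pihomog0.
  by rewrite pihomogD; apply: ID.
move=> x y _; move: x y; apply: (mpoly_ring_ind (P := fun x => forall y, J y -> J (x * y))).
- by move=> c y Jy k; rewrite mul_mpolyC linearZ /= -mul_mpolyC; apply: IM.
- move=> i y Jy [|k]; first by rewrite pihomog0_XiM.
  by rewrite pihomog_XiM; apply: IM.
- by move=> g h Hg Hh y Jy k; rewrite mulrDl pihomogD; apply: ID; [apply: Hg | apply: Hh].
- by move=> g h Hg Hh y Jy; rewrite -mulrA; apply: Hg; apply: Hh.
Qed.

(** An f outside the homogeneous ideal I has a component of some degree d outside I. A linear
    functional on forms of degree d separates it from I, and the pairing represents this functional
    by a form, the weights being invertible. *)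
Lemma homog_apolar_dual I : is_ideal_in setT I ->
  (forall f d, I f -> I (pihomog mdeg d f)) ->
  is_inverse_system I [set g | forall f, I f -> apair f g = 0].
Proof.
move=> [_ I0 ID IM] Ih; split.
  split=> [f _|g h Sg Sh f If|c g Sg f If|g d Sg f If].
  - by rewrite /apair linear0 meval0.
  - by rewrite /apair linearD mevalD -!/(apair _ _) Sg ?Sh ?addr0.
  - by rewrite /apair linearZ mevalZ -/(apair _ _) Sg // mulr0.
  - by rewrite apair_pihomog; apply: Sg; apply: Ih.
apply/seteqP; split=> [f If g|f Sf]; first by apply.
apply: contrapT => NIf.
have [d NId] : exists d, ~ I (pihomog mdeg d f).
  apply: contrapT => /forallNP h; apply: NIf.
  rewrite (pihomog_partitionE (leqnn (msize f)) : f = _).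
  elim/big_rec: _ => // i g _ Ig; apply: ID => //; exact: contrapT (h i).
pose T : finType := 'X_{1..r < d.+1}.
pose row (g : M) : 'rV[C]_#|T| := \row_i (pihomog mdeg d g)@_(enum_val i : T).
have row_inj g h : row g = row h -> pihomog mdeg d g = pihomog mdeg d h.
  move=> e; apply/mpolyP => m; have [md|md] := ltnP (mdeg m) d.+1.
    have := congr1 (fun B : 'rV_#|T| => B ord0 (enum_rank (BMultinom md : T))) e.
    by rewrite /= !mxE enum_rankK.
  by rewrite !mcoeff_pihomog gtn_eqF.
have row_lin c g h : row (c *: g + h) = c *: row g + row h.
  by apply/rowP => i; rewrite !mxE linearP /= mcoeffD mcoeffZ.
have [||[g Ig /row_inj e]|c Jc fc] := @separate_row _ [set row g | g in I] (row f).
- by exists 0 => //; apply/rowP => i; rewrite !mxE pihomog0 mcoeff0.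
- move=> c _ _ [g Ig <-] [h Ih' <-]; exists (c *: g + h); last by rewrite row_lin.
  by apply: ID => //; rewrite -mul_mpolyC; apply: IM.
- by apply: NId; rewrite -e; apply: Ih.
(* Dividing by the factorials cancels the weights of the pairing; the default 0 is for monomials of
   degree above d. *)
pose a (m : 'X_{1..r}) : C := oapp (fun t : T => c (enum_rank t) ord0) 0 (insub m) /
  (\prod_(i < r) (m i)`!)%:R.
pose g : M := \sum_(m : T) a (val m) *: 'X_[val m].
have ga (m : T) : g@_(val m) = a (val m).
  rewrite raddf_sum (bigD1 m) //= mcoeffZ mcoeffX eqxx mulr1 big1 ?addr0 // => j jm.
  by rewrite mcoeffZ mcoeffX (inj_eq val_inj) (negbTE jm) mulr0.
have apg h : apair h (pihomog mdeg d g) = (row h *m c) ord0 ord0.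
  rewrite apair_pihomog (@apairwE d.+1).
    rewrite mxE (reindex (@enum_rank T)) /=; last exact: onW_bij (@enum_rank_bij T).
    apply: eq_bigr => m _; rewrite mxE enum_rankK; congr (_ * _).
    rewrite ga -mulr_natr /a.
    by rewrite valK divfK ?prod_fact_neq0.
  have [->|h0] := eqVneq (pihomog mdeg d h) 0; first by rewrite mmeasure0.
  rewrite -(mlead_deg h0) ltnS.
  by rewrite (dhomogP _ _ _ (pihomogP mdeg d h) _ (mlead_supp h0)).
case/eqP: fc; apply/matrixP => i j; rewrite !ord1 -apg mxE.
apply: Sf => h Ih'; rewrite apg (Jc (row h)) ?mxE //; by exists h.
Qed.

Definition line_var (u v : 'cV[C]_r) (i : 'I_r) : {poly C} :=
  (u i ord0)%:P + v i ord0 *: 'X.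

Fact line_key : unit. Proof. exact: tt. Qed.

Definition line (u v : 'cV[C]_r) : M -> {poly C} :=
  locked_with line_key (mmap polyC (line_var u v)).

Lemma lineE u v g : line u v g = mmap polyC (line_var u v) g.
Proof. by rewrite /line unlock. Qed.

Fact line_is_zmod_morphism u v : zmod_morphism (line u v).
Proof. by move=> g h; rewrite !lineE rmorphB. Qed.

Fact line_is_monoid_morphism u v : monoid_morphism (line u v).
Proof. by split=> [|g h]; rewrite !lineE ?rmorph1 ?rmorphM. Qed.

HB.instance Definition _ u v :=
  GRing.isZmodMorphism.Build M {poly C} (line u v) (line_is_zmod_morphism u v).
HB.instance Definition _ u v :=
  GRing.isMonoidMorphism.Build M {poly C} (line u v) (line_is_monoid_morphism u v).

Lemma lineC u v c : line u v c%:MP = c%:P. Proof. by rewrite lineE mmapC. Qed.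
Lemma lineX u v i : line u v 'X_i = line_var u v i.
Proof. by rewrite lineE mmapX mmap1U. Qed.
Lemma lineD u v : {morph line u v : g h / g + h}. Proof. exact: rmorphD. Qed.
Lemma lineM u v : {morph line u v : g h / g * h}. Proof. exact: rmorphM. Qed.

Lemma odot_vec v g : odot (vec v) g = \sum_i v i ord0 *: g^`M(i).
Proof.
rewrite /vec; elim/big_ind2: _ => [|f1 g1 f2 g2 <- <-|i _].
- exact: odot0l.
- exact: odotDl.
- by rewrite odotZl odotX mderivmU1m.
Qed.

Lemma odot_vecM v g h : odot (vec v) (g * h) = odot (vec v) g * h + g * odot (vec v) h.
Proof.
rewrite !odot_vec mulr_suml mulr_sumr -big_split /=; apply: eq_bigr => i _.
by rewrite mderivM scalerDr -scalerAl -scalerAr.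
Qed.

Lemma deriv_line u v g : (line u v g)^`() = line u v (odot (vec v) g).
Proof.
move: g; apply: mpoly_ring_ind => [c|i|g h Hg Hh|g h Hg Hh].
- rewrite lineC derivC odot_vec big1 ?rmorph0 // => i _.
  by rewrite mderivC scaler0.
- rewrite lineX /line_var derivD derivC add0r derivZ derivX odot_vec.
  rewrite (bigD1 i) //= big1 ?addr0 => [|j ji].
    rewrite mderivX mnm1E eqxx scale1r -mul_mpolyC lineM lineC.
    rewrite (_ : (U_(i) - U_(i))%MM = 0%MM) ?mpolyX0 ?rmorph1 ?mulr1 ?alg_polyC //.
    by apply/mnmP => k; rewrite mnmBE subnn mnm0E.
  by rewrite mderivX mnm1E eq_sym (negbTE ji) scale0r scaler0.
- by rewrite lineD derivD Hg Hh linearD lineD.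
- by rewrite lineM derivM Hg Hh odot_vecM lineD !lineM.
Qed.

Lemma derivn_line u v g k : (line u v g)^`(k) = line u v (odot (vec v ^+ k) g).
Proof.
elim: k g => [|k IHk] g.
  by rewrite expr0 derivn0 -(mpolyX0 _ C) odotX mderivm0m.
by rewrite derivSn deriv_line IHk exprSr odotM.
Qed.

Lemma line_at0 u v g : (line u v g).[0] = g.@[fun i => u i ord0].
Proof.
move: g; apply: (mpoly_rmorph_ext (f := horner_eval 0 \o line u v)
  (g := meval (fun i => u i ord0))) => [c|i] /=.
  by rewrite lineC /horner_eval hornerC mevalC.
by rewrite lineX /horner_eval /line_var hornerD hornerC hornerZ hornerX mulr0 addr0 mevalXU.
Qed.

Lemma size_derivn_eq0 (p : {poly C}) k : p^`(k) = 0 -> (size p <= k)%N.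
Proof.
move=> pk; apply/leq_sizeP => j kj; have := congr1 (fun q : {poly C} => q`_(j - k)) pk.
rewrite coef_derivn coef0 subnKC // -mulr_natr => /eqP.
by rewrite mulf_eq0 pnatr_eq0 -[(_ ^_ _)%N == 0%N]negbK -lt0n ffact_gt0 kj orbF => /eqP.
Qed.

Lemma size_line_aff u v w : (size (line u v (aff w)) <= 2)%N /\
  (pairing w v = 0 -> (size (line u v (aff w)) <= 1)%N).
Proof.
have -> : line u v (aff w) = (w ord0 ord0 + pairing w u)%:P + pairing w v *: 'X.
  rewrite affE lineD lineC rmorph_sum polyCD -addrA; congr (_ + _).
  rewrite -mul_polyC !rmorph_sum mulr_suml -big_split; apply: eq_bigr => j _ /=.
  by rewrite -mul_mpolyC lineM lineC lineX /line_var mulrDr -mul_polyC mulrA -!polyCM.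
split=> [|->]; last by rewrite scale0r addr0 size_polyC_leq1.
apply: leq_trans (size_polyD _ _) _; rewrite geq_max (leq_trans (size_polyC_leq1 _)) //=.
by apply: leq_trans (size_scale_leq _ _) _; rewrite size_polyX.
Qed.

Lemma fil_size_line (U : {vspace 'cV[C]_r}) a g u v : v \in U -> fil (ann U) a g ->
  (size (line u v g) <= a.+1)%N.
Proof.
move=> vU; elim=> {a g} [a c|a g h _ IHg _ IHh|a w g wV _ IH|a w g _ IH].
- by rewrite lineC; apply: leq_trans (size_polyC_leq1 _) _.
- by rewrite lineD; apply: leq_trans (size_polyD _ _) _; rewrite geq_max IHg.
- rewrite lineM -[a]add0n; apply: size_polyM_leqS => //.
  by apply: (size_line_aff u v w).2; apply: (annP _ _ wV).
- rewrite lineM -[a.+1]add1n; apply: size_polyM_leqS => //.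
  exact: (size_line_aff u v w).1.
Qed.

Lemma meval_sig (U : {vspace 'cV[C]_r}) (u : 'cV[C]_r) g : exists u', map_poly (meval (fun i => u i ord0))
  (sig (projv (ann U)) g) = line u' (moving (projv (ann U)) u) g.
Proof.
exists (\col_j (aff (projv (ann U) (unitv C (lift ord0 j)))).@[fun i => u i ord0]).
set pi := projv _; set u' := \col_j _.
move: g; apply: (mpoly_rmorph_ext
  (f := map_poly (meval (fun i => u i ord0)) \o sig pi) (g := line u' (moving pi u))).
  by move=> c /=; rewrite sigC map_polyC lineC /= mevalC.
move=> j /=; rewrite sigX /sig_var lineX /line_var rmorphD /= map_polyC map_polyZ map_polyX.
by rewrite /moving !mxE.
Qed.

(** Both conditions bound by a the degree of g on all lines with direction in U; the derivative
    detects this in characteristic zero. For the converse, [sig] evaluated at a point is the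
    restriction of g to a line with direction [moving], which lies in U. *)
Lemma dg_odot (U : {vspace 'cV[C]_r}) g a : bidual U ->
  (dg (ann U) g <= a)%N <-> forall v, v \in U -> odot (vec v ^+ a.+1) g = 0.
Proof.
move=> Ubi; have V0 := unitv0_ann U; split=> [/(dgE V0) fg v vU|h].
  apply: mpoly_eval_eq0 => u; pose u' : 'cV[C]_r := \col_i u i.
  have -> : (odot (vec v ^+ a.+1) g).@[u] = (odot (vec v ^+ a.+1) g).@[fun i => u' i ord0].
    by apply: meval_eq => i; rewrite mxE.
  by rewrite -(line_at0 _ v) -derivn_line derivn_poly0 ?horner0 // (fil_size_line _ vU).
apply/(dgE V0)/(filE V0 (isproj_projv _)); apply/leq_sizeP => j aj.
apply: mpoly_eval_eq0 => u; pose u' : 'cV[C]_r := \col_i u i.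
have -> : forall f : M, f.@[u] = f.@[fun i => u' i ord0].
  by move=> f; apply: meval_eq => i; rewrite mxE.
have [u1 e] := meval_sig U u' g.
transitivity ((line u1 (moving (projv (ann U)) u') g)`_j); first by rewrite -e coef_map.
apply: nth_default; apply: leq_trans aj; apply: size_derivn_eq0.
by rewrite derivn_line h ?rmorph0 //; apply: moving_in.
Qed.

End Apolarity.

(** * Power ideals and the conclusion *)

Section PowerIdeal.
Variables (C : numFieldType) (r n : nat) (l : 'I_n -> 'rV[C]_r) (a : {set 'I_n} -> int).
Local Notation M := {mpoly C[r]}.
Implicit Types (f g : M) (F : {set 'I_n}).

Let gens : set M := [set g | exists F v, [/\ proper_flat l F, v \in LF l F, v != 0
  & g = vec v ^+ absz (a F + 1)]].

Lemma power_ideal_unit F f : proper_flat l F -> a F < 0 -> power_ideal l a f.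
Proof. by move=> pF aF; left; exists F. Qed.

Lemma power_ideal_ideal : is_ideal_in setT (power_ideal l a).
Proof.
have [_ I0 ID IM] := ideal_span_ideal gens.
split=> // [|f g [h|If] [h'|Ig]|f g _ [h|Ig]]; try by left.
- by right.
- by right; apply: ID.
- by right; apply: IM.
Qed.

Lemma power_ideal_homog f d : power_ideal l a f -> power_ideal l a (pihomog mdeg d f).
Proof.
case=> [h|If]; [by left | right]; apply: ideal_span_homog If.
move=> _ [F [v [_ _ _ ->]]]; exists (1 * absz (a F + 1)%R)%N; apply: dhomogMn.
by apply: rpred_sum => i _; apply: dhomogZ; rewrite dhomogX /= mdeg1.
Qed.

Lemma power_ideal_apolar g :
  (forall f, power_ideal l a f -> apair f g = 0) <->
  (forall F, proper_flat l F -> g != 0 -> (dg (ann (LF l F)) g)%:Z <= a F).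
Proof.
split=> [h F pF g0|h f If].
  (* If a_F < 0 the power ideal is the unit ideal, and the pairing being nondegenerate g would be
     0. *)
  have aF : 0 <= a F.
    rewrite leNgt; apply/negP => aF; case/eqP: g0; apply: apair_eq0 => f.
    exact/h/power_ideal_unit/aF.
  case ak: (a F) aF => [k|//] _; rewrite lez_nat.
  apply/(dg_odot _ _ (@bidual_LF C r n l F)) => v vF; apply: apair_eq0 => f.
  (* The generators exclude v = 0, for which the positive power of D_v is zero anyway. *)
  have [->|v0] := eqVneq v 0.
    have -> : vec (0 : 'cV[C]_r) = 0.
      by rewrite /vec big1 // => i _; rewrite mxE scale0r.
    by rewrite expr0n odot0l /apair linear0 meval0.
  rewrite /apair -odotM -/(apair _ _); apply: h; right.
  have [_ _ _ IM] := ideal_span_ideal gens; apply: IM => //; apply: sub_ideal_span.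
  by exists F, v; split=> //; rewrite ak -PoszD addn1.
have [->|g0] := eqVneq g 0; first by rewrite /apair linear0 meval0.
case: If => [[F [pF aF]]|If].
  by have := h F pF g0; rewrite leNgt (lt_le_trans aF).
suff e : odot f g = 0 by rewrite /apair e meval0.
apply: (If [set f | odot f g = 0]).
  split=> // [|x y|x y _]; first exact: odot0l.
    by rewrite /= odotDl => -> ->; rewrite addr0.
  by rewrite /= odotM => ->; rewrite linear0.
move=> _ [F [v [pF vF _ ->]]]; have := h F pF g0.
case: (a F) => // k; rewrite lez_nat -PoszD addn1 => dk.
exact: (dg_odot _ _ (@bidual_LF C r n l F)).1 dk v vF.
Qed.

End PowerIdeal.

Theorem theorem1p1 (R : realType) (r n : nat) (l : 'I_n -> 'rV[R[i]]_r)
    (hl : (\bigcap_(j < n) hyp l j)%VS = 0%VS)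
    (s : seq {set 'I_n}) (hs : blowup_order l s)
    (a : {set 'I_n} -> int) :
  H0 (wonderful l s) (divD l s a) `<=` range (@tofrac {mpoly R[i][r]}) /\
  is_inverse_system (power_ideal l a)
    [set g : {mpoly R[i][r]} | H0 (wonderful l s) (divD l s a) (tofrac g)].
Proof.
have H0E := H0P hl hs a.
split=> [f /H0E[g [-> _]]|]; first by exists g; rewrite // embE.
have -> : [set g : {mpoly R[i][r]} | H0 (wonderful l s) (divD l s a) (tofrac g)] =
    [set g | forall f, power_ideal l a f -> apair f g = 0].
  apply/seteqP; split=> g /=.
    by rewrite -embE => /H0E[h [/eqP + hh]]; rewrite emb_eq => /eqP->; apply/power_ideal_apolar.
  by move=> /power_ideal_apolar h; rewrite -embE; apply/H0E; exists g.
by apply: homog_apolar_dual; [apply: power_ideal_ideal | move=> f d; apply: power_ideal_homog].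
Qed.
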